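(* For any integer $n\ge1$, any theory in $S_n$ is complete and admits quantifier elimination in the language $\mathcal L_n^+$. Furthermore $S_n$ is the set of all complete theories of $n$-colored good trees.
   Context: **Good trees.** A tree is a partial order in which every $\{y:y\le x\}$ is a chain; it is good if any two elements have a meet $x\wedge y$, every element is below a maximal element (leaf), and every element is a leaf or a node (meet of two distinct leaves). $L$ ($L_T$) and $N$ ($N_T$) denote the sets of leaves and nodes; $br(x)=\{y:y\le x\}$. The cones at $x$ are the classes of $t\wedge t'>x$ on $\{t:t>x\}$. A leaf is isolated if it has a predecessor. $\mathcal L_1=\{\le,\wedge,N,L\}$. **1-colored trees.** A 1-colored good tree of branching color $(m,\mu)$: type (0) (color $(m,0)$): one node and $m$ leaves, $m\ge2$ or $\infty$; type (1.a) (color $(0,\mu)$, $\mu\ge2$ or $\infty$): for every leaf $\alpha$, $]-\infty,\alpha[$ is dense without first element and at each node there are exactly $\mu$ cones, all infinite; type (1.b) (color $(m,\mu)$, $m,\mu\ge1$ or $\infty$): every leaf $\alpha$ has a predecessor $p(\alpha)$, $]-\infty,p(\alpha)]$ is dense without first element, at each node exactly $m$ cones consist of a single leaf and exactly $\mu$ cones are infinite. $\Sigma_{(m,\mu)}$ is the set of $\mathcal L_1$-axioms describing 1-colored good trees of branching color $(m,\mu)$; $S_1$ is the set of all $\Sigma_{(m,\mu)}$, $m,\mu\in\mathbb N\cup\{\infty\}$, $m+\mu\ge2$. **Extension.** $T\rtimes T_0$ is the tree on $N_T\dot\cup(L_T\times T_0)$ with the order of $T$ on $N_T$; $(\alpha,t)\le(\alpha',t')$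 iff $\alpha=\alpha'$ and $t\le t'$; $x\le(\alpha,t)$ iff $x\le\alpha$. It is associative. **The theory $\Sigma\rtimes\Sigma_0$.** Let $\mathcal F$ be a finite set of unary function symbols $f$, each with unary predicates $D_f,F_f$, and $\mathcal L=\mathcal L_1\cup\{f,D_f,F_f:f\in\mathcal F\}$, $\mathcal L'=\mathcal L\cup\{e,E,D_e\}$ ($D_e$ also written $E_\ge$, $F_e=E$). Condition (4$\star$) for $f$: $L\subseteq D_f=\{x:\exists y\in F_f,\,y\le x\}$, $F_f\cap L=\emptyset$; $f(t)=t$ for $t\notin D_f$; $f(D_f)=F_f$; $f(t)\le t$ for $t\in D_f$; $f(t)=t$ for $t\in F_f$. Let $\Sigma$ be the complete theory of a good tree $T$ (an $\mathcal L$-structure satisfying (4$\star$)) and $\Sigma_0$ the complete $\mathcal L_1$-theory of a good tree $T_0$, neither a singleton, with: all leaves of $T$ isolated or all non-isolated; if $T$ has non-isolated leaves then $T_0$ has a root; if $T$ has isolated leaves the set of their predecessors is convex. Then $\Sigma\rtimes\Sigma_0$ is the $\mathcal L'$-theory stating, of $\Lambda$: $\Lambda$ is a good tree; $E$ is convex; $D_e=\{x:\exists y\in E,\,y\le x\}$; $E=e(D_e)=e(L)$; $e(x)=x$ for $x\notin D_e$; $L\subseteq D_e$; $E\cap L=\emptyset$; $e(x)\le x$; for $x\in D_e$, $e(x)=\max(E\cap br(x))$. Moreover, with $E_<$ the complement of $E_\ge$, $E_\le=E_<\cup E$, $E_>=E_\ge\setminus E$, let $x\sim y$ mean: $x=y\in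 E_<$, or $x,y\in E_\ge$ and: $e(x)=e(y)$, if $T_0$ has a root (then $E$ is required to be an antichain); $e(x)=e(y)<x\wedge y$ or $x=y$, if $T_0$ has no root. Then: the $\sim$-class of each $x\in E_\ge$ (if $T_0$ has a root), resp. $x\in E_>$ (if not), is elementarily equivalent to $T_0$; the quotient $\overline\Lambda=\Lambda/\sim$, with the induced order, carries an $\mathcal L$-structure, determined as follows, elementarily equivalent to $T$: for $f\in\mathcal F$ and $x\in E_\le$, $x\in D_f$ iff $\bar x\in D_{\bar f}$, and then $f(x)$ is the unique $y\in E_\le$ with $\bar y=\bar f(\bar x)$; $f(x)=f(e(x))$ for $x\in E_\ge$; $F_f$ corresponds to $F_{\bar f}$ and (4$\star$) holds for $f$; finally if $T_0$ has no root, leaves of $\overline\Lambda$ have predecessors and the image of $E$ in $\overline\Lambda$ is the set of these predecessors. **$S_n$.** Let $T_1,\dots,T_n$ be 1-colored good trees of colors $(m_i,\mu_i)$, with $\mathcal L_1$-theories $\Sigma_1,\dots,\Sigma_n$, such that $T_{i+1}$ is of type (0) whenever $T_i$ is of type (1.a), and such that: [no Exception 1] no two consecutive $T_{i},T_{i+1}$ are of types (1.b), (1.a) with $\mu_{i+1}=m_i+\mu_i$; [no Exception 2] no three consecutive $T_i,T_{i+1},T_{i+2}$ are of types (1.a), (0), (1.a) with $\mu_i=m_{i+1}=\mu_{i+2}$. Put $\mathcal L_{k+1}=\mathcal L_k\cup\{e_k,E_k,E_{\ge,k}\}$. The $\mathcal L_n$-theory $\Sigma_1\rtimes\cdots\rtimes\Sigma_n$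 is defined inductively as $(\Sigma_1\rtimes\cdots\rtimes\Sigma_{n-1})\rtimes\Sigma_n$ with $\mathcal F=\{e_1,\dots,e_{n-2}\}$, $\mathcal L=\mathcal L_{n-1}$, and $(e,E,D_e)$ called $(e_{n-1},E_{n-1},E_{\ge,n-1})$. It is an extension by definition of its restriction to $\mathcal L_1$, and is also regarded as an $\mathcal L_1$-theory; $S_n$ is the set of all these theories. An $n$-colored good tree is a model of some theory in $S_n$. $\mathcal L_n^+=\mathcal L_n\cup\{p,D_p,F_p\}$, where $D_p$ is the set of elements having an immediate predecessor, $p$ is the predecessor function on $D_p$ and the identity elsewhere, $F_p=p(D_p)$ (an extension by definition). *)

(* Defs.v *)
From mathcomp Require Import all_boot.
From mathcomp Require Import boolp classical_sets functions cardinality.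

Set Implicit Arguments.
Unset Strict Implicit.
Unset Printing Implicit Defensive.

Local Open Scope classical_set_scope.
Local Open Scope card_scope.

(* First-order logic with equality over the languages
     L(F) = {<=, meet, N, L} U {f, D_f, F_f : f in F}.
   All the languages involved have this shape: the language {<=, meet, N, L}
   is L(void), and adding one function symbol together with its two predicates
   turns L(F) into L(option F), the new symbol being None. *)

Inductive term (F : Type) : Type :=
| Var of nat
| Meet of term F & term F
| App of F & term F.

Inductive formula (F : Type) : Type :=
| Fls
| Eq of term F & term F
| Le of term F & term F
| Node of term F
| Leaf of term F
| Dom of F & term F
| Img of F & term F
| Imp of formula F & formula F
| All of nat & formula F.

Arguments Var {F}.
Arguments Fls {F}.

Definition Neg F (phi : formula F) : formula F := Imp phi Fls.

Fixpoint term_var F (x : nat) (t : term F) : Prop :=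
  match t with
  | Var y => x = y
  | Meet t u => term_var x t \/ term_var x u
  | App _ t => term_var x t
  end.

Fixpoint free_var F (x : nat) (phi : formula F) : Prop :=
  match phi with
  | Fls => False
  | Eq t u | Le t u => term_var x t \/ term_var x u
  | Node t | Leaf t | Dom _ t | Img _ t => term_var x t
  | Imp phi psi => free_var x phi \/ free_var x psi
  | All y phi => x <> y /\ free_var x phi
  end.

Definition sentence F (phi : formula F) : Prop := forall x, ~ free_var x phi.

Fixpoint quantifier_free F (phi : formula F) : Prop :=
  match phi with
  | Imp phi psi => quantifier_free phi /\ quantifier_free psi
  | All _ _ => False
  | _ => True
  end.

Fixpoint map_term F G (h : F -> G) (t : term F) : term G :=
  match t with
  | Var x => Var x
  | Meet t u => Meet (map_term h t) (map_term h u)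
  | App f t => App (h f) (map_term h t)
  end.

Fixpoint map_formula F G (h : F -> G) (phi : formula F) : formula G :=
  match phi with
  | Fls => Fls
  | Eq t u => Eq (map_term h t) (map_term h u)
  | Le t u => Le (map_term h t) (map_term h u)
  | Node t => Node (map_term h t)
  | Leaf t => Leaf (map_term h t)
  | Dom f t => Dom (h f) (map_term h t)
  | Img f t => Img (h f) (map_term h t)
  | Imp phi psi => Imp (map_formula h phi) (map_formula h psi)
  | All x phi => All x (map_formula h phi)
  end.

Record interp (F D : Type) : Type := Interp {
  le : D -> D -> Prop;
  meet : D -> D -> D;
  node : set D;
  leaf : set D;
  fn : F -> D -> D;
  fdom : F -> set D;
  fimg : F -> set D
}.

Record structure (F : Type) : Type := Structure {
  carrier :> Type;
  interp_of :> interp F carrier;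
  carrier_inhabited : inhabited carrier
}.

Definition update D (env : nat -> D) (x : nat) (a : D) : nat -> D :=
  fun y => if y == x then a else env y.

Section Satisfaction.
Variables (F D : Type) (I : interp F D).

Fixpoint eval (env : nat -> D) (t : term F) : D :=
  match t with
  | Var x => env x
  | Meet t u => meet I (eval env t) (eval env u)
  | App f t => fn I f (eval env t)
  end.

Fixpoint sat (env : nat -> D) (phi : formula F) : Prop :=
  match phi with
  | Fls => False
  | Eq t u => eval env t = eval env u
  | Le t u => le I (eval env t) (eval env u)
  | Node t => node I (eval env t)
  | Leaf t => leaf I (eval env t)
  | Dom f t => fdom I f (eval env t)
  | Img f t => fimg I f (eval env t)
  | Imp phi psi => sat env phi -> sat env psi
  | All x phi => forall a, sat (update env x a) phi
  end.

Definition holds (phi : formula F) : Prop := forall env, sat env phi.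

End Satisfaction.

Definition elem_equiv F D D' (I : interp F D) (J : interp F D') : Prop :=
  forall phi, sentence phi -> (holds I phi <-> holds J phi).

Definition theory (F : Type) : Type := set (formula F).

Definition model F (Gamma : theory F) (M : structure F) : Prop :=
  forall phi, Gamma phi -> holds M phi.

Definition entails F (Gamma : theory F) (phi : formula F) : Prop :=
  forall M, model Gamma M -> holds M phi.

Definition complete F (Gamma : theory F) : Prop :=
  (exists M, model Gamma M) /\
  (forall phi, sentence phi -> entails Gamma phi \/ entails Gamma (Neg phi)).

Definition theory_of F (M : structure F) : theory F :=
  [set phi | sentence phi /\ holds M phi].

(* The (deductively closed) theory "stating that M is in K".  It is used for
   classes K given by first-order conditions (counting, infinity and elementary
   equivalence being expressed by schemes). *)
Definition theory_of_class F (K : set (structure F)) : theory F :=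
  [set phi | sentence phi /\ forall M, K M -> holds M phi].

Definition admits_qe F (Gamma : theory F) : Prop :=
  forall phi : formula F, exists psi : formula F,
    quantifier_free psi /\
    (forall x, free_var x psi -> free_var x phi) /\
    (forall M, model Gamma M -> forall env, sat M env phi <-> sat M env psi).

Section Trees.
Variables (F D : Type) (I : interp F D).
Implicit Types (x y z a b : D) (A C : set D).

Definition lt x y : Prop := le I x y /\ x <> y.

Definition br x : set D := [set y | le I y x].

Definition maximal x : Prop := forall y, le I x y -> x = y.

Record good_tree : Prop := GoodTree {
  le_refl : forall x, le I x x;
  le_antisym : forall x y, le I x y -> le I y x -> x = y;
  le_trans : forall x y z, le I x y -> le I y z -> le I x z;
  br_chain : forall x y z, br x y -> br x z -> le I y z \/ le I z y;
  meet_lel : forall x y, le I (meet I x y) x;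
  meet_ler : forall x y, le I (meet I x y) y;
  meet_glb : forall x y z, le I z x -> le I z y -> le I z (meet I x y);
  leafP : forall x, leaf I x <-> maximal x;
  nodeP : forall x, node I x <->
    exists a b, leaf I a /\ leaf I b /\ a <> b /\ x = meet I a b;
  below_leaf : forall x, exists2 a, leaf I a & le I x a;
  leaf_or_node : forall x, leaf I x \/ node I x
}.

Definition is_pred y x : Prop := lt y x /\ forall z, ~ (lt y z /\ lt z x).

Definition isolated a : Prop := leaf I a /\ exists y, is_pred y a.

Definition leaf_preds : set D := [set y | exists2 a, leaf I a & is_pred y a].

Definition convex A : Prop :=
  forall x y z, A x -> A z -> le I x y -> le I y z -> A y.

Definition antichain A : Prop := forall x y, A x -> A y -> le I x y -> x = y.

Definition is_max A x : Prop := A x /\ forall y, A y -> le I y x.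

Definition has_root : Prop := exists r, forall x, le I r x.

(* Non-emptiness is required: otherwise a one-point tree would satisfy the
   conditions defining the color (0, mu), for every mu. *)
Definition dense_without_first A : Prop :=
  A !=set0 /\
  (forall x y, A x -> A y -> lt x y -> exists z, A z /\ lt x z /\ lt z y) /\
  ~ (exists x, A x /\ forall y, A y -> le I x y).

Definition cones x : set (set D) :=
  [set C | exists2 t, lt x t & C = [set s | lt x s /\ lt x (meet I t s)]].

Definition leaf_cones x : set (set D) :=
  [set C | cones x C /\ exists2 a, leaf I a & C = [set a]].

Definition infinite_cones x : set (set D) :=
  [set C | cones x C /\ infinite_set C].

End Trees.

(* Elements of N U {oo}; None is oo. *)
Definition enat : Type := option nat.

Definition enat_add (k l : enat) : enat :=
  if (k, l) is (Some i, Some j) then Some (i + j)%N else None.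

Definition has_card T (A : set T) (k : enat) : Prop :=
  if k is Some i then A #= `I_i else infinite_set A.

Definition color : Type := enat * enat.

Definition valid_color (c : color) : Prop :=
  if enat_add c.1 c.2 is Some i then (2 <= i)%N else True.

(* For valid colors these three types are exclusive and exhaustive. *)
Definition type0 (c : color) : Prop := c.2 = Some 0.
Definition type1a (c : color) : Prop := c.1 = Some 0.
Definition type1b (c : color) : Prop := c.1 <> Some 0 /\ c.2 <> Some 0.

Definition one_colored F D (c : color) (I : interp F D) : Prop :=
  good_tree I /\
  (type0 c -> has_card (node I) (Some 1) /\ has_card (leaf I) c.1) /\
  (type1a c ->
     (forall a, leaf I a -> dense_without_first I [set x | lt I x a]) /\
     (forall x, node I x -> has_card (cones I x) c.2 /\
        forall C, cones I x C -> infinite_set C)) /\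
  (type1b c ->
     (forall a, leaf I a ->
        exists2 p, is_pred I p a & dense_without_first I (br I p)) /\
     (forall x, node I x -> has_card (leaf_cones I x) c.1 /\
        has_card (infinite_cones I x) c.2)).

Definition Sigma (c : color) : theory void :=
  theory_of_class [set M : structure void | one_colored c M].

(* Condition (4-star) for the symbol f. *)
Record star F D (I : interp F D) (f : F) : Prop := Star {
  star_leaf : leaf I `<=` fdom I f;
  star_dom : fdom I f = [set x | exists2 y, fimg I f y & le I y x];
  star_img_leaf : fimg I f `&` leaf I = set0;
  star_out : forall t, ~ fdom I f t -> fn I f t = t;
  star_img : fn I f @` fdom I f = fimg I f;
  star_le : forall t, fdom I f t -> le I (fn I f t) t;
  star_fix : forall t, fimg I f t -> fn I f t = t
}.

Definition singleton (D : Type) : Prop := exists x : D, forall y, y = x.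

Record extension_hyp (F : finType) (T : structure F) (T0 : structure void)
    : Prop := ExtensionHyp {
  hyp_tree : good_tree T;
  hyp_star : forall f, star T f;
  hyp_tree0 : good_tree T0;
  hyp_nontriv : ~ singleton T;
  hyp_nontriv0 : ~ singleton T0;
  hyp_leaves : (forall a, leaf T a -> isolated T a) \/
               (forall a, leaf T a -> ~ isolated T a);
  hyp_root : (exists a, leaf T a /\ ~ isolated T a) -> has_root T0;
  hyp_convex : (exists a, isolated T a) -> convex T (leaf_preds T)
}.

Definition quotient D (R : D -> D -> Prop) : Type :=
  {C : set D | exists x, C = R x}.

Definition class D (R : D -> D -> Prop) (x : D) : quotient R :=
  exist (fun C => exists x, C = R x) (R x) (ex_intro _ x erefl).

Section Extension.
Variables (F : finType) (T : structure F) (T0 : structure void).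
Variables (D : Type) (I : interp (option F) D).
Implicit Types (x y : D).

Let e : D -> D := fn I None.
Let E : set D := fimg I None.
Let Ege : set D := fdom I None.
Let Elt : set D := ~` Ege.
Let Ele : set D := Elt `|` E.
Let Egt : set D := Ege `\` E.

Definition sim x y : Prop :=
  (x = y /\ Elt x) \/
  (Ege x /\ Ege y /\
   ((has_root T0 /\ e x = e y) \/
    (~ has_root T0 /\ ((e x = e y /\ lt I (e x) (meet I x y)) \/ x = y)))).

(* On a class or on the quotient only the order is prescribed: in a good tree
   it determines meets, nodes and leaves, and being a good tree is part of the
   theory of T0, resp. T. *)
Definition class_equiv x : Prop :=
  exists J : interp void {y | sim x y},
    (forall u v, le J u v <-> le I (sval u) (sval v)) /\ elem_equiv J T0.

Record quotient_structure (J : interp F (quotient sim)) : Prop :=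
  QuotientStructure {
  quot_le : forall C C' : quotient sim,
    le J C C' <-> exists x y, sval C x /\ sval C' y /\ le I x y;
  quot_dom : forall f x, Ele x ->
    (fdom I (Some f) x <-> fdom J f (class sim x));
  quot_fn : forall f x, Ele x -> fdom I (Some f) x ->
    unique (fun y => Ele y /\ class sim y = fn J f (class sim x))
           (fn I (Some f) x);
  quot_fn_ge : forall f x, Ege x -> fn I (Some f) x = fn I (Some f) (e x);
  quot_img : forall f x, fimg I (Some f) x <-> fimg J f (class sim x);
  quot_star : forall f, star I (Some f);
  quot_equiv : elem_equiv J T;
  quot_pred : ~ has_root T0 ->
    (forall C, leaf J C -> isolated J C) /\ class sim @` E = leaf_preds J
}.

Record rtimes_spec : Prop := RtimesSpec {
  ext_tree : good_tree I;
  ext_convex : convex I E;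
  ext_dom : Ege = [set x | exists2 y, E y & le I y x];
  ext_img : E = e @` Ege;
  ext_img_leaf : E = e @` leaf I;
  ext_out : forall x, ~ Ege x -> e x = x;
  ext_leaf_dom : leaf I `<=` Ege;
  ext_leaf_img : E `&` leaf I = set0;
  ext_le : forall x, le I (e x) x;
  ext_max : forall x, Ege x -> is_max I (E `&` br I x) (e x);
  ext_antichain : has_root T0 -> antichain I E;
  ext_class_root : has_root T0 -> forall x, Ege x -> class_equiv x;
  ext_class_noroot : ~ has_root T0 -> forall x, Egt x -> class_equiv x;
  ext_quotient : exists J, quotient_structure J
}.

End Extension.

(* Sigma ><| Sigma0; when Sigma and Sigma0 are complete, being a model of them
   amounts to having them as complete theories. *)
Definition rtimes (F : finType) (Gamma : theory F) (Gamma0 : theory void)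
    : theory (option F) :=
  theory_of_class [set M : structure (option F) |
    exists (T : structure F) (T0 : structure void),
      model Gamma T /\ model Gamma0 T0 /\
      extension_hyp T T0 /\ rtimes_spec T T0 M].

(* e_1, ..., e_k *)
Fixpoint symbols (k : nat) : finType :=
  if k is j.+1 then option (symbols j) else void.

(* Sigma_1 ><| ... ><| Sigma_(k+1), where c i is the color of T_(i+1). *)
Fixpoint rtimes_seq (c : nat -> color) (k : nat) : theory (symbols k) :=
  match k return theory (symbols k) with
  | 0 => Sigma (c 0)
  | j.+1 => rtimes (@rtimes_seq c j) (Sigma (c j.+1))
  end.

Arguments rtimes_seq : clear implicits.

Record admissible (n : nat) (c : nat -> color) : Prop := Admissible {
  adm_valid : forall i, (i < n)%N -> valid_color (c i);
  adm_type : forall i, (i.+1 < n)%N -> type1a (c i) -> type0 (c i.+1);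
  adm_exc1 : forall i, (i.+1 < n)%N ->
    ~ (type1b (c i) /\ type1a (c i.+1) /\
       (c i.+1).2 = enat_add (c i).1 (c i).2);
  adm_exc2 : forall i, (i.+2 < n)%N ->
    ~ (type1a (c i) /\ type0 (c i.+1) /\ type1a (c i.+2) /\
       (c i).2 = (c i.+1).1 /\ (c i.+1).1 = (c i.+2).2)
}.

(* The languages L_n and L_n^+ are L(Fn n) and L(Fn_plus n); in the latter,
   (p, D_p, F_p) is the triple attached to None. *)
Definition Fn (n : nat) : finType := symbols n.-1.
Definition Fn_plus (n : nat) : finType := option (Fn n).

Definition S_Ln (n : nat) : set (theory (Fn n)) :=
  [set Gamma | exists2 c, admissible n c & Gamma = rtimes_seq c n.-1].

Arguments S_Ln : clear implicits.

Definition colored_good_tree (n : nat) (M : structure (Fn n)) : Prop :=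
  exists2 Gamma, S_Ln n Gamma & model Gamma M.

Arguments colored_good_tree : clear implicits.

Definition restrict_L1 F (Gamma : theory F) : theory void :=
  [set phi | Gamma (map_formula (of_void F) phi)].

(* The theories in S_n and the n-colored good trees, in the language L_1. *)
Definition S_L1 (n : nat) : set (theory void) :=
  [set restrict_L1 Gamma | Gamma in S_Ln n].

Definition colored_good_tree_L1 (n : nat) (M : structure void) : Prop :=
  exists2 Gamma, S_L1 n Gamma & model Gamma M.

Record plus_expansion F (D : Type) (I : interp F D) (J : interp (option F) D)
    : Prop := PlusExpansion {
  plus_le : le J = le I;
  plus_meet : meet J = meet I;
  plus_node : node J = node I;
  plus_leaf : leaf J = leaf I;
  plus_fn : forall f, fn J (Some f) = fn I f;
  plus_fdom : forall f, fdom J (Some f) = fdom I f;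
  plus_fimg : forall f, fimg J (Some f) = fimg I f;
  plus_p_dom : fdom J None = [set x | exists y, is_pred I y x];
  plus_p : forall x, fdom J None x -> is_pred I (fn J None x) x;
  plus_p_out : forall x, ~ fdom J None x -> fn J None x = x;
  plus_p_img : fimg J None = fn J None @` fdom J None
}.

Definition plus_theory F (Gamma : theory F) : theory (option F) :=
  theory_of_class [set N : structure (option F) |
    exists (M : structure F) (J : interp (option F) M),
      model Gamma M /\ plus_expansion M J /\
      N = Structure J (carrier_inhabited M)].

(* Main.v *)
(* An n-colored good tree is the same thing as a good tree with a level function:
   the nodes of level i < n are those of the copies of T_(i+1), the leaves have
   level n.  E_f is a level, D_f the union of the levels from E_f on, and f(x) is
   the last element of that level below x; the colors say how many cones at a node
   of level i meet level i again (inner cones) or not (border cones), and whether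
   a level has a first element on a branch.  These conditions are first-order and
   are inherited from the factors of an extension, so they hold in every model.

   Two trees with such level functions are compared by back and forth.  A finite
   set closed under meets and under the partial functions "last element of level i
   below x" is determined up to isomorphism by the order and the levels, and such
   an isomorphism extends to any further point: inside an interval by density of
   the levels, in a new cone because the numbers of border and inner cones agree.
   These closures are generated by finitely many terms of L_n^+, whence
   completeness and quantifier elimination.  Consistency needs models: finitely
   supported functions on initial segments of the rationals, with leaves attached
   in the types (0) and (1.b), and the trees T ><| T0. *)
Require Import Defs.
From Stdlib Require List.
From mathcomp Require Import all_boot all_order all_algebra.
From mathcomp Require Import boolp classical_sets functions cardinality.

Set Implicit Arguments.
Unset Strict Implicit.
Unset Printing Implicit Defensive.

Local Open Scope classical_set_scope.
Local Open Scope card_scope.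

(** * First-order definability *)

(** The class behind [rtimes] is described through structures [T], [T0], a quotient and elementary
    equivalence, so a model of the resulting theory is only known to satisfy the sentences true in
    all members of the class. The axioms of [levtree] are therefore chosen to be expressible: the
    level of an element is a sum of truth values of formulas of L_n, and cones are counted by lists
    of pairwise apart elements, one sentence for each length. Two level functions compatible with
    the symbols agree, so the level function of an extension may be assembled from its quotient and
    its classes and then identified with the definable one. The theories are closed under
    consequence, so back and forth between arbitrary models makes each of them the full theory of
    any of its models. For quantifier elimination, the closure of a tuple depends on the structure
    through the levels of its entries, but it is always listed by terms from one finite list; the
    order and the levels of all these terms provide finitely many quantifier-free formulas that
    decide the given one. *)

Definition And F (p q : formula F) : formula F := Neg (Imp p (Neg q)).
Definition Or F (p q : formula F) : formula F := Imp (Neg p) q.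
Definition Iff F (p q : formula F) : formula F := And (Imp p q) (Imp q p).

Section Logic.
Variable F : Type.
Implicit Types (p q phi psi : formula F).

Lemma sat_And D (I : interp F D) env p q :
  sat I env (And p q) <-> sat I env p /\ sat I env q.
Proof.
rewrite /=; split=> [H|[Hp Hq]]; last by apply.
by apply: contrapT => N; apply: H => Hp Hq; apply: N.
Qed.

Lemma sat_Or D (I : interp F D) env p q :
  sat I env (Or p q) <-> sat I env p \/ sat I env q.
Proof.
rewrite /=; split=> [H|[Hp|Hq]] //.
by have [Hp|Hp] := pselect (sat I env p); [left|right; apply: H].
Qed.

Lemma sat_Iff D (I : interp F D) env p q :
  sat I env (Iff p q) <-> (sat I env p <-> sat I env q).
Proof. by rewrite /Iff sat_And /=; tauto. Qed.

Lemma eval_ext D (I : interp F D) env env' (t : term F) :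
  (forall x, term_var x t -> env x = env' x) -> eval I env t = eval I env' t.
Proof.
elim: t => /= [x|t IHt u IHu|f t IH] H; first exact: H.
- by rewrite IHt ?IHu // => x Hx; apply: H; [right|left].
- by rewrite IH.
Qed.

Lemma sat_ext D (I : interp F D) phi : forall env env',
  (forall x, free_var x phi -> env x = env' x) ->
  sat I env phi <-> sat I env' phi.
Proof.
elim: phi => /= [|t u|t u|t|t|f t|f t|p IHp q IHq|y p IH] env env' H //.
- by rewrite (@eval_ext _ I env env' t) ?(@eval_ext _ I env env' u) // => x Hx;
    apply: H; [right|left].
- by rewrite (@eval_ext _ I env env' t) ?(@eval_ext _ I env env' u) // => x Hx;
    apply: H; [right|left].
- by rewrite (@eval_ext _ I env env' t).
- by rewrite (@eval_ext _ I env env' t).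
- by rewrite (@eval_ext _ I env env' t).
- by rewrite (@eval_ext _ I env env' t).
- have {}IHp := IHp env env' (fun x Hx => H x (or_introl Hx)).
  have {}IHq := IHq env env' (fun x Hx => H x (or_intror Hx)).
  by rewrite IHp IHq.
- split=> Ha a.
  + apply/(IH (update env y a)) => // x Hx; rewrite /update.
    by case: (eqVneq x y) => // /eqP xy; apply: H.
  + apply/(IH _ (update env' y a)) => // x Hx; rewrite /update.
    by case: (eqVneq x y) => // /eqP xy; apply: H.
Qed.

Lemma free_var_seq phi : exists s : seq nat, forall x, free_var x phi -> x \in s.
Proof.
have tv (t : term F) : exists s : seq nat, forall x, term_var x t -> x \in s.
  elim: t => [y|t [s Hs] u [s' Hs']|f t [s Hs]].
  - by exists [:: y] => x /= ->; rewrite inE.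
  - by exists (s ++ s') => x /= [/Hs|/Hs'] Hx; rewrite mem_cat Hx ?orbT.
  - by exists s.
have cat2 (P Q : nat -> Prop) :
    (exists s : seq nat, forall x, P x -> x \in s) ->
    (exists s : seq nat, forall x, Q x -> x \in s) ->
    exists s : seq nat, forall x, P x \/ Q x -> x \in s.
  move=> [s Hs] [s' Hs']; exists (s ++ s') => x [/Hs|/Hs'] Hx;
  by rewrite mem_cat Hx ?orbT.
elim: phi => /= [|t u|t u|t|t|f t|f t|p IHp q IHq|y p [s IH]]; try exact: tv.
- by exists [::].
- by apply: cat2; apply: tv.
- by apply: cat2; apply: tv.
- exact: cat2.
- by exists s => x [_ /IH].
Qed.

Lemma free_var_bound phi : exists N, forall x, free_var x phi -> x < N.
Proof.
have [s Hs] := free_var_seq phi; exists (\max_(x <- s) x).+1 => x /Hs xs.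
by rewrite ltnS (@leq_bigmax_seq _ s xpredT (fun i => i)).
Qed.

Fixpoint term_ren (r : nat -> nat) (t : term F) : term F :=
  match t with
  | Var x => Var (r x)
  | Meet t u => Meet (term_ren r t) (term_ren r u)
  | App f t => App f (term_ren r t)
  end.

Lemma eval_ren D (I : interp F D) env r t :
  eval I env (term_ren r t) = eval I (env \o r) t.
Proof. by elim: t => //= [t -> u ->|f t ->]. Qed.

(** A quantified variable is replaced by [z], larger than every [r x] with [x] free in the body, so
    nothing is captured and [r] may be any map. *)
Lemma rename phi : forall r : nat -> nat, exists psi,
  forall D (I : interp F D) env, sat I env psi <-> sat I (env \o r) phi.
Proof.
elim: phi => [|t u|t u|t|t|f t|f t|p IHp q IHq|y p IH] r.
- by exists Fls.
- by exists (Eq (term_ren r t) (term_ren r u)) => D I env /=; rewrite !eval_ren.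
- by exists (Le (term_ren r t) (term_ren r u)) => D I env /=; rewrite !eval_ren.
- by exists (Node (term_ren r t)) => D I env /=; rewrite !eval_ren.
- by exists (Leaf (term_ren r t)) => D I env /=; rewrite !eval_ren.
- by exists (Dom f (term_ren r t)) => D I env /=; rewrite !eval_ren.
- by exists (Img f (term_ren r t)) => D I env /=; rewrite !eval_ren.
- have [p' Hp] := IHp r; have [q' Hq] := IHq r.
  by exists (Imp p' q') => D I env /=; rewrite Hp Hq.
- have [s Hs] := free_var_seq p.
  pose z := (\max_(x <- s) r x).+1.
  have [p' Hp] := IH (fun x => if x == y then z else r x).
  exists (All z p') => D I env /=.
  suff E a : sat I (update env z a) p' <-> sat I (update (env \o r) y a) p.
    by split=> H a; apply/E.
  rewrite Hp; apply: sat_ext => x /Hs xs /=; rewrite /update.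
  case: (eqVneq x y) => [_|_]; first by rewrite eqxx.
  have rx : r x < z by rewrite ltnS (@leq_bigmax_seq _ s xpredT r).
  by rewrite (ltn_eqF rx).
Qed.

Fixpoint closure N phi := if N is k.+1 then closure k (All k phi) else phi.

Lemma holds_All D (I : interp F D) x phi :
  holds I (All x phi) <-> holds I phi.
Proof.
split=> H env; last by move=> a; apply: H.
have := H env (env x); congr sat; apply: funext => y; rewrite /update.
by case: eqVneq => [->|].
Qed.

Lemma holds_closure D (I : interp F D) N phi :
  holds I (closure N phi) <-> holds I phi.
Proof. by elim: N phi => //= N IH phi; rewrite IH holds_All. Qed.

Lemma free_var_closure N phi x :
  free_var x (closure N phi) -> N <= x /\ free_var x phi.
Proof.
elim: N phi => //= N IH phi /IH[Nx [xN Hx]]; split=> //.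
by rewrite ltn_neqAle Nx andbT; apply/eqP => /esym.
Qed.

(** Theories of classes contain sentences only, so an open formula passes from one structure to
    another through its closure. *)
Lemma universal_closure phi : exists psi, sentence psi /\
  forall D (I : interp F D), holds I psi <-> holds I phi.
Proof.
have [N HN] := free_var_bound phi; exists (closure N phi); split.
  by move=> x /free_var_closure[Nx /HN]; rewrite ltnNge Nx.
by move=> D I; apply: holds_closure.
Qed.

(** One formula must work in all interpretations at once. Predicates of environments make
    definability compositional, so that formulas need not be written out. *)
Definition definable (P : forall D (I : interp F D), (nat -> D) -> Prop) :=
  exists phi, forall D (I : interp F D) env, sat I env phi <-> P D I env.

Definition term_definable (t : forall D (I : interp F D), (nat -> D) -> D) :=
  exists u : term F, forall D (I : interp F D) env, eval I env u = t D I env.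

Section Transfer.
Variables (K : Type) (X : K -> Type) (fam : forall i, interp F (X i)).

Definition in_class_theory D (I : interp F D) : Prop :=
  forall phi, sentence phi -> (forall i, holds (fam i) phi) -> holds I phi.

(** The closure of the formula defining [P] is one of the sentences common to the family [fam]. An
    element of [D] provides the environment in which it is read back. *)
Lemma transfer (P : forall D, interp F D -> Prop) :
  definable (fun D I _ => P D I) -> (forall i, P (X i) (fam i)) ->
  forall D (I : interp F D), inhabited D -> in_class_theory I -> P D I.
Proof.
move=> [phi Hphi] HK D I [a] HI.
have [psi [Spsi Hpsi]] := universal_closure phi.
apply/(Hphi D I (fun=> a)); apply: (Hpsi _ I).1.
by apply: HI => // i; apply/Hpsi => env; apply/Hphi/HK.
Qed.

End Transfer.

Lemma def_iff P Q : (forall D I env, P D I env <-> Q D I env) ->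
  definable P -> definable Q.
Proof. by move=> PQ [phi H]; exists phi => D I env; rewrite H PQ. Qed.

Lemma def_prop (P : Prop) : definable (fun _ _ _ => P).
Proof.
by have [H|H] := pselect P; [exists (Neg Fls)|exists Fls] => D I env /=; tauto.
Qed.

Lemma def_imp P Q : definable P -> definable Q ->
  definable (fun D I env => P D I env -> Q D I env).
Proof. by move=> [p Hp] [q Hq]; exists (Imp p q) => D I env /=; rewrite Hp Hq. Qed.

Lemma def_not P : definable P -> definable (fun D I env => ~ P D I env).
Proof. by move=> [p Hp]; exists (Neg p) => D I env /=; rewrite Hp. Qed.

Lemma def_and P Q : definable P -> definable Q ->
  definable (fun D I env => P D I env /\ Q D I env).
Proof.
by move=> [p Hp] [q Hq]; exists (And p q) => D I env; rewrite sat_And Hp Hq.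
Qed.

Lemma def_or P Q : definable P -> definable Q ->
  definable (fun D I env => P D I env \/ Q D I env).
Proof.
by move=> [p Hp] [q Hq]; exists (Or p q) => D I env; rewrite sat_Or Hp Hq.
Qed.

Lemma def_equiv P Q : definable P -> definable Q ->
  definable (fun D I env => P D I env <-> Q D I env).
Proof.
by move=> [p Hp] [q Hq]; exists (Iff p q) => D I env; rewrite sat_Iff Hp Hq.
Qed.

(** The quantified element is read from variable 0 and the older variables move up by one, so the
    tactic [definability] can go under quantifiers. In the formula itself 0 becomes [N], which lies
    beyond the free variables. *)
Lemma def_all (Q : forall D (I : interp F D), (nat -> D) -> D -> Prop) :
  definable (fun D I env => Q D I (fun i => env i.+1) (env 0)) ->
  definable (fun D I env => forall a, Q D I env a).
Proof.
move=> [phi H]; have [N HN] := free_var_bound phi.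
have [psi Hpsi] := rename phi (fun i => if i is j.+1 then j else N).
exists (All N psi) => D I env /=.
suff E a : sat I (update env N a) psi <-> Q D I env a by split=> Ha a; apply/E.
rewrite Hpsi -(H D I (fun i => if i is j.+1 then env j else a)).
apply: sat_ext => -[|x] /HN Hx /=; rewrite /update ?eqxx //.
by rewrite (ltn_eqF (ltnW Hx)).
Qed.

Lemma def_ex (Q : forall D (I : interp F D), (nat -> D) -> D -> Prop) :
  definable (fun D I env => Q D I (fun i => env i.+1) (env 0)) ->
  definable (fun D I env => exists a, Q D I env a).
Proof.
move=> /def_not H.
have := def_not (@def_all (fun D I env a => ~ Q D I env a) H).
apply: def_iff => D I env; split=> [|[a Ha] /(_ a)//].
by move=> N; apply: contrapT => Na; apply: N => a Qa; apply: Na; exists a.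
Qed.

Lemma def_ex2 (P Q : forall D (I : interp F D), (nat -> D) -> D -> Prop) :
  definable (fun D I env => P D I (fun i => env i.+1) (env 0)) ->
  definable (fun D I env => Q D I (fun i => env i.+1) (env 0)) ->
  definable (fun D I env => exists2 a, P D I env a & Q D I env a).
Proof.
move=> HP HQ.
have := @def_ex (fun D I env a => P D I env a /\ Q D I env a) (def_and HP HQ).
by apply: def_iff => D I env; split=> [[a []]|[a]]; exists a.
Qed.

(** A quantifier over a finite type, such as the symbols of the language or the possible levels, is
    a finite disjunction. *)
Lemma def_ex_fin (T : finType) (P : T -> forall D (I : interp F D), (nat -> D) -> Prop) :
  (forall f, definable (P f)) -> definable (fun D I env => exists f, P f D I env).
Proof.
move=> H.
have E (s : seq T) : definable (fun D I env => exists2 f, f \in s & P f D I env).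
  elim: s => [|g s IH].
    by apply: def_iff (def_prop False) => D I env; split=> // -[].
  apply: def_iff (def_or (H g) IH) => D I env; split.
    by move=> [Hg|[f fs Hf]]; [exists g|exists f] => //; rewrite inE ?eqxx ?fs ?orbT.
  move=> [f]; rewrite inE => /orP[/eqP->|fs] Hf; [by left|by right; exists f].
apply: def_iff (E (enum T)) => D I env; split=> [[f _]|[f]]; exists f => //.
by rewrite mem_enum.
Qed.

Lemma tdef_var i : term_definable (fun D I env => env i).
Proof. by exists (Var i). Qed.

Lemma tdef_meet t u : term_definable t -> term_definable u ->
  term_definable (fun D I env => meet I (t D I env) (u D I env)).
Proof. by move=> [a Ha] [b Hb]; exists (Meet a b) => D I env /=; rewrite Ha Hb. Qed.

Lemma tdef_fn f t : term_definable t ->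
  term_definable (fun D I env => fn I f (t D I env)).
Proof. by move=> [a Ha]; exists (App f a) => D I env /=; rewrite Ha. Qed.

Lemma def_eq t u : term_definable t -> term_definable u ->
  definable (fun D I env => t D I env = u D I env).
Proof. by move=> [a Ha] [b Hb]; exists (Eq a b) => D I env /=; rewrite Ha Hb. Qed.

Lemma def_le t u : term_definable t -> term_definable u ->
  definable (fun D I env => le I (t D I env) (u D I env)).
Proof. by move=> [a Ha] [b Hb]; exists (Le a b) => D I env /=; rewrite Ha Hb. Qed.

Lemma def_node t : term_definable t ->
  definable (fun D I env => node I (t D I env)).
Proof. by move=> [a Ha]; exists (Node a) => D I env /=; rewrite Ha. Qed.

Lemma def_leaf t : term_definable t ->
  definable (fun D I env => leaf I (t D I env)).
Proof. by move=> [a Ha]; exists (Leaf a) => D I env /=; rewrite Ha. Qed.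

Lemma def_fdom f t : term_definable t ->
  definable (fun D I env => fdom I f (t D I env)).
Proof. by move=> [a Ha]; exists (Dom f a) => D I env /=; rewrite Ha. Qed.

Lemma def_fimg f t : term_definable t ->
  definable (fun D I env => fimg I f (t D I env)).
Proof. by move=> [a Ha]; exists (Img f a) => D I env /=; rewrite Ha. Qed.

End Logic.
Arguments def_prop {F} P.

Ltac definability :=
  repeat first
    [ exact: tdef_var | apply: tdef_meet | apply: tdef_fn
    | apply: def_eq | apply: def_le | apply: def_node | apply: def_leaf
    | apply: def_fdom | apply: def_fimg
    | apply: def_and | apply: def_or | apply: def_equiv | apply: def_not
    | apply: def_ex2 | apply: def_ex | apply: def_all | apply: def_imp ].

(** * Counting pairwise separated elements *)

Section Families.
Variables (D : Type) (K : D -> Prop) (sep : D -> D -> Prop).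

(** Cones are counted through representatives: a list of pairwise separated elements meets as many
    cones as its length. This avoids quantifying over sets. *)
Fixpoint sepfam (u : seq D) : Prop :=
  if u is t :: v then K t /\ (forall s, List.In s v -> sep t s) /\ sepfam v
  else True.

Definition at_least r : Prop := exists2 u, size u = r & sepfam u.

Definition exactly (m : enat) : Prop :=
  if m is Some k then at_least k /\ ~ at_least k.+1 else forall r, at_least r.

(** Nested existential quantifiers, with the elements already chosen in [acc]: the first-order form
    of [at_least]. *)
Fixpoint extends_by (acc : seq D) r : Prop :=
  if r is q.+1 then
    exists t, K t /\ (forall s, List.In s acc -> sep t s) /\ extends_by (t :: acc) q
  else True.

Lemma sepfam_catr v w : sepfam (v ++ w) -> sepfam w.
Proof. by elim: v => //= t v IH [_ [_ /IH]]. Qed.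

Lemma at_least_extends r : at_least r <-> extends_by [::] r.
Proof.
split=> [[v <-]|].
  rewrite -{1}[v]cats0; elim/last_ind: v [::] => //= v t IH acc.
  rewrite cat_rcons size_rcons => H; exists t.
  by have [Kt [Ht _]] := sepfam_catr H; split=> //; split=> //; apply: IH.
suff H acc : sepfam acc -> extends_by acc r ->
    exists2 u, size u = r + size acc & sepfam u.
  by move=> /(H [::] I)[u]; rewrite addn0 => Hu; exists u.
elim: r acc => [|r IH] acc Hacc /=; first by exists acc.
move=> [t [Kt [Ht /IH[|u Hu fu]]]] //; exists u => //.
by rewrite Hu addnS.
Qed.

Lemma at_least_leq r s : r <= s -> at_least s -> at_least r.
Proof.
move=> rs [u us fu]; exists (drop (s - r) u).
  by rewrite size_drop us subKn.
by apply: (@sepfam_catr (take (s - r) u)); rewrite cat_take_drop.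
Qed.

Hypothesis sepC : forall t u, sep t u -> sep u t.
Hypothesis nsep_trans : forall t u p, K t -> K u ->
  ~ sep t p -> ~ sep u p -> ~ sep t u.

Lemma sepfam_K u t : sepfam u -> List.In t u -> K t.
Proof. by elim: u => //= s u IH [Ks [_ fu]] [<-//|]; apply: IH. Qed.

Lemma sepfam_remove v t w : sepfam (v ++ t :: w) ->
  sepfam (v ++ w) /\ forall s, List.In s (v ++ w) -> sep s t.
Proof.
elim: v => [[Kt [Ht fw]]|s v IH] /=.
  by split=> // s /Ht/sepC.
move=> [Ks [Hs /IH[fvw Ht]]]; split; last first.
  move=> z [<-|/Ht//]; apply: Hs.
  by apply/List.in_app_iff; right; left.
split=> //; split=> // z /List.in_app_iff Hz; apply: Hs.
by apply/List.in_app_iff; case: Hz => Hz; [left|right; right].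
Qed.

(** By [nsep_trans], two separated elements of [K] cannot both fail to be separated from the same
    [p]. Each entry of [o] thus rules out at most one entry of [u], and one survives. *)
Lemma sepfam_pigeonhole o u : sepfam u -> size o < size u ->
  exists2 t, List.In t u & forall p, List.In p o -> sep t p.
Proof.
elim: o u => [|p o IH] u fu.
  by case: u fu => // t u _ _; exists t => //; left.
move=> su; have [[t [tu Nt]]|Nt] := pselect (exists t, List.In t u /\ ~ sep t p).
  have [v [w uE]] := List.in_split _ _ tu.
  have uE' : u = v ++ t :: w by [].
  subst u; have [fvw Ht] := sepfam_remove fu.
  have [|s sv Hs] := IH _ fvw.
    by move: su; rewrite !size_cat /= addnS ltnS.
  have su' : List.In s (v ++ t :: w).
    by apply/List.in_app_iff; move/List.in_app_iff: sv => [|]; [left|right; right].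
  exists s => // q [<-|/Hs//].
  apply: contrapT => Ns.
  exact: (nsep_trans (sepfam_K fu su') (sepfam_K fu tu) Ns Nt (Ht _ sv)).
have [|s su' Hs] := IH _ fu; first exact: ltnW.
exists s => // q [<-|/Hs//]; apply: contrapT => Ns; apply: Nt.
by exists s.
Qed.

(** Greedy choice: an entry of [s] in [K] is kept when it is separated from those already kept, so
    one that is dropped shares its class with a kept one. *)
Lemma maximal_sepfam s : (forall t, List.In t s -> K t -> ~ sep t t) ->
  exists2 o, sepfam o & (forall t, List.In t o -> List.In t s) /\
    forall t, List.In t s -> K t -> exists2 p, List.In p o & ~ sep t p.
Proof.
elim: s => [|t s IH] Hs; first by exists [::].
have [|o fo [os Ho]] := IH; first by move=> u us; apply: Hs; right.
have [[Kt Ht]|N] := pselect (K t /\ forall p, List.In p o -> sep t p).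
  exists (t :: o) => //=; split=> [u [->|/os]|u [<-|us] Ku]; [by left|by right| |].
    by exists t; [left|apply: Hs => //; left].
  by have [p po Hp] := Ho u us Ku; exists p => //; right.
exists o => //; split=> [u /os|u [<-|us] Ku]; [by right| |exact: Ho].
apply: contrapT => N'; apply: N; split=> // p po; apply: contrapT => Np.
by apply: N'; exists p.
Qed.

End Families.

Lemma exactly_at_least D D' (K : D -> Prop) (K' : D' -> Prop) sep sep' m r :
  exactly K sep m -> exactly K' sep' m -> at_least K sep r -> at_least K' sep' r.
Proof.
case: m => [k|] //= [_ N] [Hk _] Hr; apply: at_least_leq Hk.
by rewrite leqNgt; apply/negP => kr; apply: N; apply: at_least_leq Hr.
Qed.

Lemma at_least_mono D D' (K : D -> Prop) (K' : D' -> Prop) sep sep'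
    (f : D -> D') r :
  (forall t, K t -> K' (f t)) ->
  (forall t u, K t -> K u -> sep t u -> sep' (f t) (f u)) ->
  at_least K sep r -> at_least K' sep' r.
Proof.
move=> HK Hs [u <- fu]; exists (map f u); first exact: size_map.
elim: u fu => //= t u IH [Kt [Ht fu]]; split; first exact: HK.
split; last exact: IH.
move=> s /List.in_map_iff[v [<- vu]]; apply: Hs => //; last exact: Ht.
exact: sepfam_K fu vu.
Qed.

Lemma exactly_iff D D' (K : D -> Prop) (K' : D' -> Prop) sep sep' m :
  (forall r, at_least K sep r <-> at_least K' sep' r) ->
  exactly K sep m -> exactly K' sep' m.
Proof. by move=> H; case: m => [k|] /= Hm; [rewrite -!H|move=> r; rewrite -H]. Qed.

(** * Trees with levels *)

Section LevTree.
Variables (F D : Type) (I : interp F D) (lev : D -> nat).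
Implicit Types x y z t u : D.

Definition top_at i x y : Prop :=
  le I y x /\ lev y = i /\ forall z, le I z x -> lev z = i -> le I z y.

Definition inner x t : Prop :=
  lt I x t /\ exists z, lt I x z /\ le I z t /\ lev z = lev x.

Definition border x t : Prop :=
  lt I x t /\ ~ exists z, lt I x z /\ le I z t /\ lev z = lev x.

(** For [t] and [u] above [x] the meet is at least [x]; it stays at [x] exactly when the two lie in
    different cones. *)
Definition apart x t u : Prop := le I (meet I t u) x.

(* The nodes of level i < n are those of the copies of T_(i+1), of color c i;
   the leaves have level n.  Border cones lead to higher levels. *)
Record levtree (n : nat) (c : nat -> color) : Prop := LevTree {
  lt_good : good_tree I;
  lt_mono : forall x y, le I x y -> lev x <= lev y;
  lt_leaf : forall x, leaf I x <-> lev x = n;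
  lt_bound : forall x, lev x <= n;
  lt_ex : forall i x, i <= lev x -> exists y, le I y x /\ lev y = i;
  lt_top : forall i x, i < n -> (c i).1 <> Some 0 -> i < lev x ->
    exists y, top_at i x y;
  lt_nofirst : forall i x, i < n -> (c i).2 <> Some 0 -> lev x = i ->
    exists y, lt I y x /\ lev y = i;
  lt_dense : forall x y, lt I x y -> lev x = lev y ->
    exists z, lt I x z /\ lt I z y;
  lt_border : forall i x, i < n -> lev x = i ->
    exactly (border x) (apart x) (c i).1;
  lt_inner : forall i x, i < n -> lev x = i ->
    exactly (inner x) (apart x) (c i).2
}.

Section GoodTreeFacts.
Hypothesis G : good_tree I.

Lemma gt_chain x y z : le I y x -> le I z x -> le I y z \/ le I z y.
Proof. exact: (br_chain G). Qed.

Lemma gt_meetC x y : meet I x y = meet I y x.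
Proof.
by apply: (le_antisym G); apply: (meet_glb G);
  (exact: (meet_lel G) || exact: (meet_ler G)).
Qed.

Lemma gt_meet_id x y : le I x y -> meet I x y = x.
Proof.
move=> xy; apply: (le_antisym G); first exact: (meet_lel G).
by apply: (meet_glb G) => //; apply: (le_refl G).
Qed.

Lemma lt_le_trans x y z : lt I x y -> le I y z -> lt I x z.
Proof.
move=> [xy Nxy] yz; split; first exact: (le_trans G xy yz).
by move=> xz; apply: Nxy; apply: (le_antisym G) => //; rewrite xz.
Qed.

Lemma le_lt_trans x y z : le I x y -> lt I y z -> lt I x z.
Proof.
move=> xy [yz Nyz]; split; first exact: (le_trans G xy yz).
by move=> xz; apply: Nyz; apply: (le_antisym G) => //; rewrite -xz.
Qed.

Lemma nle_lt x y z : le I y x -> le I z x -> ~ le I y z -> lt I z y.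
Proof.
move=> yx zx Nyz; have [//|zy] := gt_chain yx zx; split=> // zy'.
by apply: Nyz; rewrite zy'; apply: (le_refl G).
Qed.

Lemma lt_nle x y : lt I x y -> ~ le I y x.
Proof. by move=> [xy N] yx; apply: N; apply: (le_antisym G). Qed.

Lemma apart_sym x t u : apart x t u -> apart x u t.
Proof. by rewrite /apart gt_meetC. Qed.

Lemma napart_lt x t u : lt I x t -> ~ apart x t u -> lt I x (meet I t u).
Proof. by move=> [xt _]; apply: nle_lt (meet_lel G t u) xt. Qed.

Lemma lt_napart x t u : lt I x (meet I t u) -> ~ apart x t u.
Proof. exact: lt_nle. Qed.

Lemma napart_refl x t : lt I x t -> ~ apart x t t.
Proof. by move=> xt; rewrite /apart gt_meet_id; [apply: lt_nle|apply: (le_refl G)]. Qed.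

Lemma napart_le x t u : lt I x t -> le I t u -> ~ apart x t u.
Proof. by move=> xt tu; rewrite /apart gt_meet_id //; apply: lt_nle. Qed.

(** Both [meet I t p] and [meet I u p] lie below [p], hence are comparable, and the smaller one is
    below both [t] and [u]. *)
Lemma napart_trans x t u p : lt I x t -> lt I x u ->
  ~ apart x t p -> ~ apart x u p -> ~ apart x t u.
Proof.
move=> xt xu /(napart_lt xt) tp /(napart_lt xu) up; apply: lt_napart.
have [H|H] := gt_chain (meet_ler G t p) (meet_ler G u p).
  apply: (lt_le_trans tp); apply: (meet_glb G); first exact: (meet_lel G).
  exact: (le_trans G H (meet_lel G _ _)).
apply: (lt_le_trans up); apply: (meet_glb G); last exact: (meet_lel G).
exact: (le_trans G H (meet_lel G _ _)).
Qed.

(** [x] and [meet I y p] are comparable, both being below [y]. Hence adding a point below an element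
    of a set closed under meets creates no meets other than the point itself. *)
Lemma meet_le_chain x y p : le I x y -> le I x p \/ meet I x p = meet I y p.
Proof.
move=> xy; have [H|H] := gt_chain xy (meet_lel G y p).
  by left; apply: (le_trans G H); apply: (meet_ler G).
right; apply: (le_antisym G); apply: (meet_glb G) => //.
- exact: (le_trans G (meet_lel G _ _) xy).
- exact: (meet_ler G).
- exact: (meet_ler G).
Qed.

End GoodTreeFacts.
End LevTree.

(** * Sets closed under meets and last elements; cones and levels *)

Section Closed.
Variables (F D : Type) (I : interp F D) (lev : D -> nat).
Variables (n : nat) (c : nat -> color).
Hypothesis LT : levtree I lev n c.
Implicit Types (x y z a b : D) (A : D -> Prop).

Let G : good_tree I := lt_good LT.

Lemma lev_lt_nle x y : lev x < lev y -> ~ le I y x.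
Proof. by move=> xy /(lt_mono LT); rewrite leqNgt xy. Qed.

Lemma top_at_inj i x y z : top_at I lev i x y -> top_at I lev i x z -> y = z.
Proof.
move=> [yx [yi Hy]] [zx [zi Hz]].
by apply: (le_antisym G); [apply: Hz|apply: Hy].
Qed.

Lemma top_at_restrict i x y r :
  top_at I lev i x r -> le I y x -> i < lev y -> top_at I lev i y r.
Proof.
move=> [rx [ri Hr]] yx iy; split; last first.
  by split=> // z zy; apply: Hr; apply: (le_trans G zy yx).
by have [//|/(lev_lt_nle _)] := gt_chain G rx yx; rewrite ri => /(_ iy).
Qed.

Lemma top_at_extend i x y r :
  top_at I lev i y r -> le I y x -> i < lev y -> top_at I lev i x r.
Proof.
move=> [ry [ri Hr]] yx iy; split; first exact: (le_trans G ry yx).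
split=> // z zx zi; apply: Hr => //.
by have [//|/(lev_lt_nle _)] := gt_chain G zx yx; rewrite zi => /(_ iy).
Qed.

Lemma top_at_self x : top_at I lev (lev x) x x.
Proof. by split; first exact: (le_refl G). Qed.

(** Levels with [(c i).1 = Some 0] are exempt: a last element of such a level below a point of
    higher level would be the foot of a border cone, and there are none. *)
Definition gclosed A : Prop :=
  (forall a b, A a -> A b -> A (meet I a b)) /\
  (forall i a, A a -> (c i).1 <> Some 0 -> i < lev a ->
     exists2 r, A r & top_at I lev i a r).

Lemma closed_add A y : gclosed A ->
  (forall a, A a -> le I y a \/ A (meet I y a)) ->
  (forall i, (c i).1 <> Some 0 -> i < lev y ->
     exists2 r, A r & top_at I lev i y r) ->
  gclosed (fun x => x = y \/ A x).
Proof.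
move=> [Am At] Hm Ht; split; last first.
  move=> i a [->|Aa] ci ia; first by have [r Ar] := Ht i ci ia; exists r; auto.
  by have [r Ar] := At i a Aa ci ia; exists r; auto.
move=> a b [->|Aa] [->|Ab].
- by left; rewrite (gt_meet_id G) //; apply: (le_refl G).
- have [yb|] := Hm b Ab; last by right.
  by left; rewrite (gt_meet_id G).
- rewrite (gt_meetC G); have [yb|] := Hm a Aa; last by right.
  by left; rewrite (gt_meet_id G).
- by right; apply: Am.
Qed.

Lemma closed_below A y d : gclosed A -> A d -> le I y d ->
  (forall a, A a -> le I y a \/ A (meet I y a)) /\
  (forall i, (c i).1 <> Some 0 -> i < lev y ->
     exists2 r, A r & top_at I lev i y r).
Proof.
move=> [Am At] Ad yd; split=> [a Aa|i ci iy].
  have [|->] := meet_le_chain G a yd; first by left.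
  by right; apply: Am.
have [|r Ar rT] := At i d Ad ci.
  exact: leq_trans iy (lt_mono LT yd).
by exists r => //; apply: top_at_restrict rT yd iy.
Qed.

Lemma inner_cone x t u : ~ apart I x t u -> lt I x t ->
  inner I lev x t -> inner I lev x u.
Proof.
move=> N xt [_ [z [xz [zt lz]]]].
have xm := napart_lt G xt N.
split; first exact: (lt_le_trans G xm (meet_ler G _ _)).
have [zm|mz] := gt_chain G zt (meet_lel G t u).
  by exists z; split=> //; split=> //; apply: (le_trans G zm (meet_ler G _ _)).
exists (meet I t u); split=> //; split; first exact: (meet_ler G).
apply/eqP; rewrite eqn_leq; apply/andP; split.
  by rewrite -lz; apply: (lt_mono LT).
by apply: (lt_mono LT); case: xm.
Qed.

Lemma border_or_inner x t : lt I x t -> border I lev x t \/ inner I lev x t.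
Proof.
move=> xt; have [H|H] := pselect (exists z, lt I x z /\ le I z t /\ lev z = lev x).
  by right.
by left.
Qed.

Lemma border_cone x t u : ~ apart I x t u -> lt I x t ->
  border I lev x t -> border I lev x u.
Proof.
move=> N xt [_ Nt].
have xm := napart_lt G xt N.
have xu : lt I x u by exact: (lt_le_trans G xm (meet_ler G _ _)).
split=> // Hu; apply: Nt; apply: (inner_cone _ xu _).2 => //.
by move=> /(apart_sym G).
Qed.

Lemma border_nonzero x t : lev x < n -> border I lev x t -> (c (lev x)).1 <> Some 0.
Proof.
move=> xn bt ci.
have := lt_border LT xn erefl; rewrite ci => -[_ []].
by exists [:: t].
Qed.

Lemma inner_nonzero x t : lev x < n -> inner I lev x t -> (c (lev x)).2 <> Some 0.
Proof.
move=> xn bt ci.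
have := lt_inner LT xn erefl; rewrite ci => -[_ []].
by exists [:: t].
Qed.

Lemma not_leaf_lt x y : lt I x y -> lev x < n.
Proof.
move=> [xy Nxy]; rewrite ltn_neqAle (lt_bound LT) andbT; apply/eqP.
by move=> /(lt_leaf LT)/(leafP G)/(_ _ xy).
Qed.

Lemma lt_lev_lt x y : le I x y -> lev x < lev y -> lt I x y.
Proof. by move=> xy lxy; split=> // E; rewrite E ltnn in lxy. Qed.

Lemma exists_level x i : i <= n -> exists2 y, lev y = i & le I x y \/ le I y x.
Proof.
move=> ni; have [a /(lt_leaf LT) la xa] := below_leaf G x.
have [|y [ya ly]] := @lt_ex _ _ _ _ _ _ LT i a; first by rewrite la.
by exists y => //; apply: (gt_chain G xa ya).
Qed.

(** An element of level [i] comparable with [t] cannot be below [x], whose level is smaller, so it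
    lies in the cone of [t]. *)
Lemma border_level x t i : border I lev x t -> lev x < i <= n ->
  exists y, lev y = i /\ ~ apart I x t y /\ border I lev x y.
Proof.
move=> bt /andP[xi ni]; have [y ly ty] := exists_level t ni.
have xt : lt I x t by case: bt.
have Nty : ~ apart I x t y.
  case: ty => [ty|yt]; first exact: napart_le.
  move=> /(apart_sym G); apply: (napart_le G) => //.
  have [xy|/(lt_mono LT)] := gt_chain G xt.1 yt; last by rewrite ly leqNgt xi.
  by apply: lt_lev_lt => //; rewrite ly.
by exists y; split=> //; split=> //; apply: border_cone bt.
Qed.

Lemma inner_level x t i : inner I lev x t -> lev x <= i <= n ->
  exists y, lev y = i /\ ~ apart I x t y /\ lt I x y.
Proof.
move=> [xt [z [xz [zt lz]]]] /andP[]; rewrite leq_eqVlt => /orP[/eqP<- _|xi ni].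
  exists z; split=> //; split=> //; move=> /(apart_sym G).
  exact: (napart_le G).
have [y ly ty] := exists_level t ni.
have Nty : ~ apart I x t y.
  case: ty => [ty|yt]; first exact: napart_le.
  move=> /(apart_sym G); apply: (napart_le G) => //.
  have [xy|/(lt_mono LT)] := gt_chain G xt.1 yt; last by rewrite ly leqNgt xi.
  by apply: lt_lev_lt => //; rewrite ly.
exists y; split=> //; split=> //.
by apply: (lt_le_trans G (napart_lt G xt Nty) (meet_ler G _ _)).
Qed.

(** Elements below [t] are comparable with [x], so in a border cone no element of the level of [x]
    comes later than [x] on the branch of [t]. This links the counts of border cones to last
    elements of levels. *)
Lemma border_top x t : lev x < n -> lt I x t ->
  border I lev x t <-> lev x < lev t /\ top_at I lev (lev x) t x.
Proof.
move=> xn xt; split=> [[_ Nt]|[lxt [_ [_ Hx]]]].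
  split.
    rewrite ltn_neqAle (lt_mono LT) ?andbT; last by case: xt.
    apply/eqP => E; apply: Nt; exists t; split=> //; split=> //.
    exact: (le_refl G).
  split; first by case: xt.
  split=> // z zt lz; have [//|xz] := gt_chain G zt xt.1.
  have [->|N] := pselect (x = z); first exact: (le_refl G).
  by case: Nt; exists z.
by split=> // -[z [xz [zt lz]]]; apply: (lt_nle G xz); apply: Hx.
Qed.

Lemma max_list A (s : seq D) x : (forall y, A y -> List.In y s) ->
  (forall y, A y -> le I y x) ->
  (forall y, ~ A y) \/ exists2 b, A b & forall y, A y -> le I y b.
Proof.
move=> Hs Hx; suff: (forall y, List.In y s -> ~ A y) \/
    exists2 b, A b & forall y, List.In y s -> A y -> le I y b.
  move=> [H|[b Ab Hb]]; [left=> y Ay|right]; first exact: (H y (Hs _ Ay)).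
  by exists b => // y Ay; apply: Hb => //; apply: Hs.
elim: s {Hs} => [|t s IH]; first by left.
have [At|Nt] := pselect (A t); last first.
  case: IH => [H|[b Ab Hb]]; first by left=> y [<-//|/H].
  by right; exists b => // y [<-//|/Hb].
right; case: IH => [H|[b Ab Hb]].
  by exists t => // y [<- _|/H//]; apply: (le_refl G).
have [tb|bt] := gt_chain G (Hx _ At) (Hx _ Ab).
  by exists b => // y [<-//|/Hb].
exists t => // y [<- _|/Hb H /H yb]; first exact: (le_refl G).
exact: (le_trans G yb bt).
Qed.

(** The least element is the meet of all those above [y], finitely many by [s]; it stays in [A] and
    above [y]. *)
Lemma min_list A (s : seq D) y d : (forall z, A z -> List.In z s) ->
  (forall a b, A a -> A b -> A (meet I a b)) -> A d -> le I y d ->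
  exists e, A e /\ le I y e /\ forall z, A z -> le I y z -> le I e z.
Proof.
move=> Hs Am Ad yd; suff: exists e, A e /\ le I y e /\
    forall z, List.In z s -> A z -> le I y z -> le I e z.
  move=> [e [Ae [ye He]]]; exists e; split=> //; split=> // z Az.
  by apply: He => //; apply: Hs.
elim: s {Hs} => [|t s [e [Ae [ye He]]]]; first by exists d.
have [[At yt]|N] := pselect (A t /\ le I y t); last first.
  by exists e; split=> //; split=> // z [<- At yt|/He//]; case: N.
exists (meet I t e); split; first exact: Am.
split; first exact: (meet_glb G).
move=> z [<- _ _|zs Az yz]; first exact: (meet_lel G).
exact: (le_trans G (meet_ler G _ _) (He _ zs Az yz)).
Qed.

End Closed.

(** * Back and forth *)

Section Config.
Variables (n : nat) (c : nat -> color).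

Definition dom1 D D' (s : seq (D * D')) x := exists x', List.In (x, x') s.
Definition dom2 D D' (s : seq (D * D')) x' := exists x, List.In (x, x') s.

Lemma in_dom1 D D' (s : seq (D * D')) x x' : List.In (x, x') s -> dom1 s x.
Proof. by exists x'. Qed.

Lemma in_dom2 D D' (s : seq (D * D')) x x' : List.In (x, x') s -> dom2 s x'.
Proof. by exists x. Qed.

(** A finite partial isomorphism as a list of pairs. Single-valuedness in both directions follows
    from the order, and compatibility with meets and last elements from the closure of domain and
    range. *)
Record config (F D D' : Type) (I : interp F D) (I' : interp F D')
    (lev : D -> nat) (lev' : D' -> nat) (s : seq (D * D')) : Prop := Config {
  cf_le : forall x x' y y', List.In (x, x') s -> List.In (y, y') s ->
    le I x y <-> le I' x' y';
  cf_lev : forall x x', List.In (x, x') s -> lev x = lev' x';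
  cf_closed1 : gclosed I lev c (dom1 s);
  cf_closed2 : gclosed I' lev' c (dom2 s)
}.

Definition flip D D' (s : seq (D * D')) := map (fun p => (p.2, p.1)) s.

Lemma in_flip D D' (s : seq (D * D')) x x' :
  List.In (x', x) (flip s) <-> List.In (x, x') s.
Proof.
split=> [/List.in_map_iff[[y y'] [[-> ->]]//]|xs].
by apply/List.in_map_iff; exists (x, x').
Qed.

Lemma config_flip F D D' (I : interp F D) (I' : interp F D') lev lev' s :
  config I I' lev lev' s -> config I' I lev' lev (flip s).
Proof.
move=> [Hle Hlev H1 H2].
have E1 : dom1 (flip s) = dom2 s.
  by apply: funext => x; apply: propext; split=> -[y /in_flip]; exists y.
have E2 : dom2 (flip s) = dom1 s.
  by apply: funext => x; apply: propext; split=> -[y /in_flip]; exists y.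
split; rewrite ?E1 ?E2 //.
- by move=> x x' y y' /in_flip Hx /in_flip Hy; rewrite (Hle _ _ _ _ Hx Hy).
- by move=> x x' /in_flip/Hlev.
Qed.

Section TwoTrees.
Variables (F D D' : Type) (I : interp F D) (I' : interp F D').
Variables (lev : D -> nat) (lev' : D' -> nat).
Hypotheses (LT : levtree I lev n c) (LT' : levtree I' lev' n c).
Variable s : seq (D * D').
Hypothesis C : config I I' lev lev' s.

Let G : good_tree I := lt_good LT.
Let G' : good_tree I' := lt_good LT'.

Lemma cf_inj x x' x'' : List.In (x, x') s -> List.In (x, x'') s -> x' = x''.
Proof.
move=> H1 H2; apply: (le_antisym G').
  by apply/(cf_le C H1 H2); apply: (le_refl G).
by apply/(cf_le C H2 H1); apply: (le_refl G).
Qed.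

Lemma cf_lt x x' y y' : List.In (x, x') s -> List.In (y, y') s ->
  lt I x y -> lt I' x' y'.
Proof.
move=> H1 H2 [xy Nxy]; split; first by apply/(cf_le C H1 H2).
move=> E; apply: Nxy; apply: (le_antisym G) => //.
by apply/(cf_le C H2 H1); rewrite E; apply: (le_refl G').
Qed.

(** The image of the meet and the meet of the images both belong to the range, because domain and
    range are closed; comparing them through the order shows that they coincide. *)
Lemma cf_meet x x' y y' : List.In (x, x') s -> List.In (y, y') s ->
  List.In (meet I x y, meet I' x' y') s.
Proof.
move=> H1 H2.
have [r' Hr] := (cf_closed1 C).1 _ _ (in_dom1 H1) (in_dom1 H2).
have [z Hz] := (cf_closed2 C).1 _ _ (in_dom2 H1) (in_dom2 H2).
suff <- : r' = meet I' x' y' by [].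
apply: (le_antisym G').
  apply: (meet_glb G').
    by apply/(cf_le C Hr H1); apply: (meet_lel G).
  by apply/(cf_le C Hr H2); apply: (meet_ler G).
apply/(cf_le C Hz Hr); apply: (meet_glb G).
  by apply/(cf_le C Hz H1); apply: (meet_lel G').
by apply/(cf_le C Hz H2); apply: (meet_ler G').
Qed.

Lemma cf_top i x x' : List.In (x, x') s -> (c i).1 <> Some 0 -> i < lev x ->
  exists r r', List.In (r, r') s /\ top_at I lev i x r /\ top_at I' lev' i x' r'.
Proof.
move=> Hx ci ix.
have [r [r' Hr] tr] := (cf_closed1 C).2 _ _ (in_dom1 Hx) ci ix.
rewrite (cf_lev C Hx) in ix.
have [z' [z Hz] tz] := (cf_closed2 C).2 _ _ (in_dom2 Hx) ci ix.
exists r, r'; split=> //; split=> //; have [rx [ri Hmr]] := tr.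
suff -> : r' = z' by [].
have [zx [zi Hmz]] := tz.
apply: (le_antisym G').
  by apply: Hmz; [apply/(cf_le C Hr Hx)|rewrite -(cf_lev C Hr)].
apply/(cf_le C Hz Hr); apply: Hmr; first by apply/(cf_le C Hz Hx).
by rewrite (cf_lev C Hz).
Qed.

Lemma cf_apart b b' x x' y y' : List.In (b, b') s -> List.In (x, x') s ->
  List.In (y, y') s -> apart I b x y <-> apart I' b' x' y'.
Proof. by move=> Hb Hx Hy; apply: (cf_le C (cf_meet Hx Hy) Hb). Qed.

(** The witness [z] need not be in the domain. If the image cone were a border cone, the level of
    [b] would have last elements; then [x] itself or the last element of this level below [x] is a
    witness in the domain, and it has an image. *)
Lemma cf_inner b b' x x' : List.In (b, b') s -> List.In (x, x') s ->
  lev b < n -> inner I lev b x -> inner I' lev' b' x'.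
Proof.
move=> Hb Hx bn [bx [z [bz [zx lz]]]].
have bx' := cf_lt Hb Hx bx.
have [B|//] := border_or_inner lev' bx'.
have ci : (c (lev b)).1 <> Some 0.
  by rewrite (cf_lev C Hb); apply: (border_nonzero LT' _ B); rewrite -(cf_lev C Hb).
have := lt_mono LT bx.1; rewrite leq_eqVlt => /orP[/eqP E|bltx].
  split=> //; exists x'; split=> //; split; first exact: (le_refl G').
  by rewrite -(cf_lev C Hx) -(cf_lev C Hb).
have [r [r' [Hr [[rx [ri Hmr]] [rx' [ri' _]]]]]] := cf_top Hx ci bltx.
split=> //; exists r'; split.
  apply: (cf_lt Hb Hr); apply: (lt_le_trans G bz).
  exact: Hmr.
by split=> //; rewrite ri' (cf_lev C Hb).
Qed.

Lemma config_add y y' : lev y = lev' y' ->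
  (forall x x', List.In (x, x') s -> (le I y x <-> le I' y' x') /\
                                    (le I x y <-> le I' x' y')) ->
  gclosed I lev c (fun x => x = y \/ dom1 s x) ->
  gclosed I' lev' c (fun x => x = y' \/ dom2 s x) ->
  config I I' lev lev' ((y, y') :: s).
Proof.
move=> Hlev Hle H1 H2; split.
- move=> x x' z z' [[<- <-]|Hx] [[<- <-]|Hz].
  + by split=> _; [apply: (le_refl G')|apply: (le_refl G)].
  + by case: (Hle _ _ Hz).
  + by case: (Hle _ _ Hx).
  + exact: (cf_le C).
- by move=> x x' [[<- <-]|/(cf_lev C)].
- suff -> : dom1 ((y, y') :: s) = (fun x => x = y \/ dom1 s x) by [].
  apply: funext => x; apply: propext; split=> [[z [[-> _]|]]|[->|[z]]].
  + by left.
  + by right; exists z.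
  + by exists y'; left.
  + by exists z; right.
- suff -> : dom2 ((y, y') :: s) = (fun x => x = y' \/ dom2 s x) by [].
  apply: funext => x; apply: propext; split=> [[z [[_ ->]|]]|[->|[z]]].
  + by left.
  + by right; exists z.
  + by exists y; left.
  + by exists z; right.
Qed.

Let in1 x : dom1 s x -> List.In x (map fst s).
Proof. by move=> [x' Hx]; apply: (List.in_map fst _ _ Hx). Qed.

(** If [y] and [d] share their level, density applies. Otherwise a last element of the level of [y]
    below [d] would be an element of the domain above [y] but not above [d]. So this level has no
    border cones, the cone of [d'] at [c'] is inner, and its witness is the required point. *)
Lemma exists_between c0 d y : lt I y d -> lt I c0 y -> dom1 s c0 -> dom1 s d ->
  (forall z, dom1 s z -> le I y z -> le I d z) ->
  forall c' d', List.In (c0, c') s -> List.In (d, d') s ->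
  lev c0 = lev y -> exists y', lt I' c' y' /\ lt I' y' d' /\ lev' y' = lev y.
Proof.
move=> yd cy _ [dd Hdd] Hd c' d' Hc Hd' lc.
have cd' := cf_lt Hc Hd' (lt_le_trans G cy yd.1).
have yn : lev y < n := not_leaf_lt LT yd.
have := lt_mono LT yd.1; rewrite leq_eqVlt => /orP[/eqP E|lyd].
  have [|z [cz zd]] := lt_dense LT' cd'.
    by rewrite -(cf_lev C Hc) -(cf_lev C Hd') lc.
  exists z; split=> //; split=> //; apply/eqP; rewrite eqn_leq.
  rewrite {1}E (cf_lev C Hd') (lt_mono LT') /=; last by case: zd.
  by rewrite -lc (cf_lev C Hc) (lt_mono LT') //; case: cz.
have ci : (c (lev y)).1 = Some 0.
  apply: contrapT => ci.
  have [r [r' [Hr [[rd [ri Hmr]] _]]]] := cf_top Hd' ci lyd.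
  have yr : le I y r by apply: Hmr => //; case: yd.
  have := lt_mono LT (Hd r (in_dom1 Hr) yr).
  by rewrite ri leqNgt lyd.
have lc' : lev' c' = lev y by rewrite -(cf_lev C Hc).
have [B|[_ [z [cz [zd lz]]]]] := border_or_inner lev' cd'.
  have := border_nonzero LT' _ B; rewrite lc' => /(_ yn)[].
  exact: ci.
exists z; rewrite lz lc'; split=> //; split=> //.
apply: (lt_lev_lt (lev := lev')) => //.
by rewrite lz lc' -(cf_lev C Hd').
Qed.

Lemma exists_low d d' y : List.In (d, d') s -> lt I y d ->
  exists y', lt I' y' d' /\ lev' y' = lev y.
Proof.
move=> Hd yd; have yn : lev y < n := not_leaf_lt LT yd.
have := lt_mono LT yd.1; rewrite leq_eqVlt => /orP[/eqP E|lyd].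
  have ci : (c (lev y)).2 <> Some 0.
    apply: (inner_nonzero LT yn (t := d)); split=> //.
    by exists d; split=> //; split=> //; apply: (le_refl G).
  by apply: (lt_nofirst LT' yn ci); rewrite -(cf_lev C Hd).
have [|y' [yd' ly']] := @lt_ex _ _ _ _ _ _ LT' (lev y) d'.
  by rewrite -(cf_lev C Hd) ltnW.
exists y'; split=> //; apply: (lt_lev_lt (lev := lev')) => //.
by rewrite ly' -(cf_lev C Hd).
Qed.

(** [y] lies in the gap between [d], the least element of the domain above it, and the greatest one
    below it, if any. The position of its image relative to the other elements is decided by their
    meets with [d]. *)
Lemma step_below y d0 : ~ dom1 s y -> dom1 s d0 -> le I y d0 ->
  exists y', config I I' lev lev' ((y, y') :: s).
Proof.
move=> Ny Hd0 yd0.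
have [d [Hd [yd Hdmin]]] := min_list LT in1 (cf_closed1 C).1 Hd0 yd0.
have [d' Hdd'] := Hd.
have yltd : lt I y d by split=> // E; apply: Ny; rewrite E.
have yn : lev y < n := not_leaf_lt LT yltd.
have lyd := lt_mono LT yd.
(* The last clause covers the absence of elements below y. *)
have [y' [yd' [ly' Hcy']]] : exists y', lt I' y' d' /\ lev' y' = lev y /\
    forall x x', List.In (x, x') s -> le I x y -> lt I' x' y'.
  have [|x [xs xy] |Nc|[c0 [[c' Hc] cy] Hcmax]] :=
      @max_list _ _ _ _ _ _ LT (fun x => dom1 s x /\ le I x y) (map fst s) y.
  - by move=> x [/in1].
  - by [].
  - have [y' [yd' ly']] := exists_low Hdd' yltd; exists y'; split=> //; split=> // x x' Hx xy.
    by case: (Nc x); split=> //; exists x'.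
  - have cy' : lt I c0 y by split=> // E; apply: Ny; rewrite -E; exists c'.
    have := lt_mono LT cy; rewrite leq_eqVlt => /orP[/eqP lc|lc].
      have [y' [cy'' [yd' ly']]] :=
          exists_between yltd cy' (in_dom1 Hc) Hd Hdmin Hc Hdd' lc.
      exists y'; split=> //; split=> // x x' Hx xy.
      apply: (le_lt_trans G' _ cy''); apply/(cf_le C Hx Hc).
      by apply: Hcmax; split=> //; exists x'.
    (* When [c0] has a smaller level than [y], any point of the level of [y] below [d'] will do: the
       elements below [d'] form a chain along which levels increase, so it lies above all images of
       elements below [y]. *)
    have [y' [yd' ly']] := exists_low Hdd' yltd; exists y'; split=> //; split=> // x x' Hx xy.
    have xc : le I x c0 by apply: Hcmax; split=> //; exists x'.
    have lxy : lev' x' < lev' y'.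
      by rewrite -(cf_lev C Hx) ly'; apply: leq_ltn_trans (lt_mono LT xc) lc.
    have xd : le I' x' d'.
      by apply/(cf_le C Hx Hdd'); apply: (le_trans G xy yd).
    have [//|/(lev_lt_nle LT' lxy)//] := gt_chain G' xd yd'.1.
    by move=> xy'; apply: (lt_lev_lt (lev := lev')).
exists y'.
have Ny' x x' : List.In (x, x') s -> le I' y' x' -> le I y x.
  move=> Hx yx'; apply: contrapT => Nyx.
  have Hr := cf_meet Hx Hdd'.
  have [yr|ry] := gt_chain G yd (meet_ler G x d).
    by apply: Nyx; apply: (le_trans G yr (meet_lel G _ _)).
  by apply: (lt_nle G' (Hcy' _ _ Hr ry)); apply: (meet_glb G') => //; case: yd'.
apply: config_add => //.
- move=> x x' Hx; split; split.
  + move=> yx; apply: (le_trans G' yd'.1); apply/(cf_le C Hdd' Hx).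
    by apply: Hdmin => //; exists x'.
  + exact: Ny'.
  + by move=> /(Hcy' _ _ Hx)[].
  + move=> xy'.
    have xd : le I x d.
      by apply/(cf_le C Hx Hdd'); apply: (le_trans G' xy' yd'.1).
    have [//|yx] := gt_chain G xd yd.
    have dx : le I' d' x'.
      by apply/(cf_le C Hdd' Hx); apply: Hdmin (in_dom1 Hx) yx.
    by case: (lt_nle G' yd'); apply: (le_trans G' dx xy').
- have [H1 H2] := closed_below LT (cf_closed1 C) Hd yd.
  exact: (closed_add LT (cf_closed1 C) H1 H2).
- have [H1 H2] := closed_below LT' (cf_closed2 C) (in_dom2 Hdd') yd'.1.
  exact: (closed_add LT' (cf_closed2 C) H1 H2).
Qed.

End TwoTrees.
End Config.

Section Above.
Variables (n : nat) (c : nat -> color).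
Variables (F D D' : Type) (I : interp F D) (I' : interp F D').
Variables (lev : D -> nat) (lev' : D' -> nat).
Hypotheses (LT : levtree I lev n c) (LT' : levtree I' lev' n c).
Variable s : seq (D * D').
Hypothesis C : config c I I' lev lev' s.

Let G : good_tree I := lt_good LT.
Let G' : good_tree I' := lt_good LT'.

(** A maximal family [o] of the domain in different cones of the given kind, together with [y],
    gives [size o + 1] such cones at [b], hence as many at [b']. By the pigeonhole principle one of
    them avoids the images of [o], and by maximality it avoids the whole range. *)
Lemma new_cone (K : D -> Prop) (K' : D' -> Prop) b b' y m :
  List.In (b, b') s ->
  (forall t, K t -> lt I b t) -> (forall t, K' t -> lt I' b' t) ->
  (forall t u, ~ apart I' b' t u -> K' t -> K' u) ->
  (forall t t', List.In (t, t') s -> K t <-> K' t') ->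
  exactly K (apart I b) m -> exactly K' (apart I' b') m ->
  K y -> (forall t, dom1 s t -> apart I b y t) ->
  exists2 t', K' t' & forall u', dom2 s u' -> apart I' b' t' u'.
Proof.
move=> Hb Kb Kb' cone KK' mK mK' Ky sepy.
have [o fo [os Ho]] := @maximal_sepfam (D * D') (fun p => K p.1)
  (fun p q => apart I b p.1 q.1) s (fun t _ Kt => napart_refl G (Kb _ Kt)).
have : at_least K (apart I b) (size o).+1.
  exists (y :: map fst o); first by rewrite /= size_map.
  split=> //; split.
    move=> t /List.in_map_iff[[u u'] [<- /os Hu]].
    by apply: sepy; exists u'.
  elim: o fo {os Ho} => //= p o IH [Kp [Hp fo]]; split=> //; split; last exact: IH.
  by move=> t /List.in_map_iff[q [<- /Hp]].
move=> /(exactly_at_least mK mK')[u us fu].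
have [] := @sepfam_pigeonhole _ K' (apart I' b') (@apart_sym _ _ _ G' b')
  (fun t u p Kt Ku => napart_trans G' (Kb' _ Kt) (Kb' _ Ku)) (map snd o) u fu.
  by rewrite us size_map.
move=> t' tu Ht'; have Kt' := sepfam_K fu tu.
exists t' => // p' [p Hp]; apply: contrapT => N.
have Kp : K p by apply/(KK' _ _ Hp)/(cone _ _ N Kt').
have [[q q'] qo Nq] := Ho _ Hp Kp.
have Kq' : K' q' by apply/(KK' _ _ (os _ qo)); apply: (sepfam_K fo qo).
apply: (napart_trans G' (Kb' _ Kt') (Kb' _ Kq') N).
  move=> /(apart_sym G')/(cf_apart LT LT' C Hb Hp (os _ qo)).
  exact: Nq.
by apply: Ht'; apply/List.in_map_iff; exists (q, q').
Qed.

Lemma step_above y : inhabited D' ->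
  (forall x, dom1 s x -> le I y x \/ dom1 s (meet I y x)) ->
  (forall i, (c i).1 <> Some 0 -> i < lev y ->
     exists2 r, dom1 s r & top_at I lev i y r) ->
  (forall x, dom1 s x -> ~ le I y x) ->
  exists y', config c I I' lev lev' ((y, y') :: s).
Proof.
move=> [x0] Hm Ht Ny.
have cl1 := closed_add LT (cf_closed1 C) Hm Ht.
have Hm' x : dom1 s x -> dom1 s (meet I y x).
  by move=> xs; have [/Ny|] := Hm x xs.
have [|x [xs xy] |Nb|[b [[b' Hb] yb] Hbmax]] :=
    @max_list _ _ _ _ _ _ LT (fun x => dom1 s x /\ le I x y) (map fst s) y.
- by move=> x [[x' Hx] _]; apply: (List.in_map fst _ _ Hx).
- by [].
(* Meets with [y] belong to the domain, so a domain without elements below [y] is empty, and any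
   point of the right level may be chosen. *)
- have N1 x : ~ dom1 s x.
    by move=> /Hm' xs; apply: (Nb (meet I y x)); split=> //; apply: (meet_lel G).
  have [y' ly' _] := exists_level LT' x0 (lt_bound LT y).
  exists y'; apply: (config_add LT LT' C) => //.
    by move=> x x' Hx; case: (N1 _ (in_dom1 Hx)).
  apply: (closed_add LT' (cf_closed2 C)) => [x' [x Hx]|i ci].
    by case: (N1 _ (in_dom1 Hx)).
  by rewrite ly' => /(Ht _ ci)[r Hr]; case: (N1 _ Hr).
have by' : lt I b y by split=> // E; apply: (Ny b); [exists b'|rewrite E; apply: (le_refl G)].
have bn := not_leaf_lt LT by'.
have bn' : lev' b' < n by rewrite -(cf_lev C Hb).
have sepy t : dom1 s t -> apart I b y t.
  by move=> ts; apply: Hbmax; split; [apply: Hm'|apply: (meet_lel G)].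
have HK : forall t t', List.In (t, t') s -> inner I lev b t <-> inner I' lev' b' t'.
  move=> t t' Ht'; split; first exact: (cf_inner LT LT' C).
  apply: (cf_inner LT' LT (config_flip C)) => //; exact/in_flip.
have HB : forall t t', List.In (t, t') s -> border I lev b t <-> border I' lev' b' t'.
  move=> t t' Ht'; split=> -[bt Nt].
    have bt' := cf_lt LT LT' C Hb Ht' bt.
    by have [//|/(HK _ _ Ht')[_ /Nt]] := border_or_inner lev' bt'.
  have bt' : lt I b t.
    by apply: (cf_lt LT' LT (config_flip C) _ _ bt); apply/in_flip.
  by have [//|/(HK _ _ Ht')[_ /Nt]] := border_or_inner lev bt'.
(* For a border cone its kind has to be remembered: there [b'] is the last element of its level
   below [y'], and closure of the range asks for it. *)
have [y' [ly' [sepy' [by'' Hkind]]]] : exists y', lev' y' = lev y /\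
    (forall u', dom2 s u' -> apart I' b' y' u') /\ lt I' b' y' /\
    (border I lev b y -> border I' lev' b' y').
  have trans t' u' : lt I' b' t' -> lt I' b' u' -> ~ apart I' b' t' u' ->
      (forall v, dom2 s v -> apart I' b' t' v) ->
      forall v, dom2 s v -> apart I' b' u' v.
    move=> bt bu tu Hv v vs; apply: contrapT => N.
    have bv : lt I' b' v.
      exact: (lt_le_trans G' (napart_lt G' bu N) (meet_ler G' _ _)).
    apply: (napart_trans G' bt bv tu); last exact: Hv.
    by move=> /(apart_sym G').
  have [B|Y] := border_or_inner lev by'.
    have [||||||t' Bt' Ht'] := new_cone Hb _ _ _ HB
      (lt_border LT bn erefl) (m := (c (lev b)).1) (y := y).
    - by move=> t [].
    - by move=> t [].
    - by move=> t u N Kt; apply: (border_cone LT' N Kt.1 Kt).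
    - by apply: (lt_border LT') => //; rewrite (cf_lev C Hb).
    - by [].
    - exact: sepy.
    have [|y' [ly' [Na By']]] := border_level LT' Bt' (i := lev y).
      rewrite (lt_bound LT) andbT -(cf_lev C Hb).
      by have [/(_ B)[]] := border_top LT bn by'.
    exists y'; split=> //; split; last by split; [case: By'|].
    apply: trans Na Ht'; [by case: Bt'|by case: By'].
  have [||||||t' It' Ht'] := new_cone Hb _ _ _ HK
    (lt_inner LT bn erefl) (m := (c (lev b)).2) (y := y).
  - by move=> t [].
  - by move=> t [].
  - by move=> t u N Kt; apply: (inner_cone LT' N Kt.1 Kt).
  - by apply: (lt_inner LT') => //; rewrite (cf_lev C Hb).
  - by [].
  - exact: sepy.
  have [|y' [ly' [Na By']]] := inner_level LT' It' (i := lev y).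
    by rewrite (lt_bound LT) andbT -(cf_lev C Hb) (lt_mono LT).
  exists y'; split=> //; split; last by split=> // -[_ Nt]; case: Nt; case: Y.
  by apply: trans Na Ht' => //; case: It'.
exists y'; apply: (config_add LT LT' C) => //.
- move=> x x' Hx; have xs := in_dom1 Hx; have xs' := in_dom2 Hx; split; split.
  + by move/Ny => /(_ xs).
  + move=> yx; case: (lt_nle G' by''); apply: (le_trans G' _ (sepy' _ xs')).
    by apply: (meet_glb G') => //; apply: (le_refl G').
  + move=> xy; apply: (le_trans G' _ by''.1); apply/(cf_le C Hx Hb).
    exact: Hbmax.
  + move=> xy; apply: (le_trans G _ yb); apply/(cf_le C Hx Hb).
    apply: (le_trans G' _ (sepy' _ xs')).
    by apply: (meet_glb G') => //; apply: (le_refl G').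
- apply: (closed_add LT' (cf_closed2 C)).
  + move=> x' [x Hx]; right; suff -> : meet I' y' x' = meet I' b' x'.
      exact: (in_dom2 (cf_meet LT LT' C Hb Hx)).
    apply: (le_antisym G'); apply: (meet_glb G').
    * exact: (sepy' _ (in_dom2 Hx)).
    * exact: (meet_ler G').
    * exact: (le_trans G' (meet_lel G' _ _) by''.1).
    * exact: (meet_ler G').
  + move=> i ci; rewrite ly' => iy; have [r rs tr] := Ht i ci iy.
    have [ry [ri Hr]] := tr.
    have rb : le I r b by apply: Hbmax.
    (* If [i] is the level of [b], the last element [r] is [b] itself, and the cone of [y] is a
       border cone. *)
    have := lt_mono LT rb; rewrite ri leq_eqVlt => /orP[/eqP ib|ib].
      have rbE : r = b by apply: (le_antisym G) => //; apply: Hr.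
      have B : border I lev b y.
        by apply/(border_top LT bn by'); rewrite -ib; split=> //; rewrite -rbE.
      exists b'; first by exists b.
      have [_] := (border_top LT' bn' by'').1 (Hkind B).
      by rewrite -(cf_lev C Hb) -ib.
    have [q [q' [Hq [_ tq']]]] := cf_top LT' C Hb ci ib.
    exists q'; first by exists q.
    apply: (top_at_extend LT' tq' by''.1).
    by rewrite -(cf_lev C Hb).
Qed.

Lemma step y : inhabited D' ->
  (forall x, dom1 s x -> le I y x \/ dom1 s (meet I y x)) ->
  (forall i, (c i).1 <> Some 0 -> i < lev y ->
     exists2 r, dom1 s r & top_at I lev i y r) ->
  exists2 t, config c I I' lev lev' t &
    (forall p, List.In p s -> List.In p t) /\
    (forall x, dom1 t x <-> x = y \/ dom1 s x).
Proof.
move=> D0 Hm Ht; have [ys|Ny] := pselect (dom1 s y).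
  by exists s => //; split=> // x; split=> [|[->|]] //; right.
have [y' Cy'] : exists y', config c I I' lev lev' ((y, y') :: s).
  have [[d [ds yd]]|N] := pselect (exists d, dom1 s d /\ le I y d).
    exact: (step_below LT LT' C Ny ds yd).
  by apply: step_above => // x xs yx; apply: N; exists x.
exists ((y, y') :: s) => //; split=> [p|x]; first by right.
split=> [[z [[-> _]|]]|[->|[z]]].
- by left.
- by right; exists z.
- by exists y'; left.
- by exists z; right.
Qed.

End Above.

Section Forth.
Variables (n : nat) (c : nat -> color).
Variables (F D D' : Type) (I : interp F D) (I' : interp F D').
Variables (lev : D -> nat) (lev' : D' -> nat).
Hypotheses (LT : levtree I lev n c) (LT' : levtree I' lev' n c).
Hypothesis D'0 : inhabited D'.

Let G : good_tree I := lt_good LT.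

(** A point cannot be added alone: closure demands the greatest of its meets with the domain, and
    then its last elements of lower levels. Each of these satisfies the hypotheses of [step] when
    its turn comes. *)
Lemma forth s x : config c I I' lev lev' s ->
  exists t x', config c I I' lev lev' t /\ List.In (x, x') t /\
    forall p, List.In p s -> List.In p t.
Proof.
move=> C.
have [t Ct [st Hmt]] : exists2 t, config c I I' lev lev' t &
    (forall p, List.In p s -> List.In p t) /\
    (forall z, dom1 t z -> le I x z \/ dom1 t (meet I x z)).
  have [||Nb|[b [z [zs bE]] Hb]] :=
      @max_list _ _ _ _ _ _ LT (fun b => exists z, dom1 s z /\ b = meet I x z)
      (map (fun p => meet I x p.1) s) x.
  - move=> b [z [[z' Hz] ->]].
    by apply: (List.in_map (fun p => meet I x p.1) _ _ Hz).
  - by move=> b [z [_ ->]]; apply: (meet_lel G).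
  - exists s => //; split=> // z zs; case: (Nb (meet I x z)); by exists z.
  have bx : le I b x by rewrite bE; apply: (meet_lel G).
  have bz : le I b z by rewrite bE; apply: (meet_ler G).
  have [Hm Ht] := closed_below LT (cf_closed1 C) zs bz.
  have [t Ct [st Ht1]] := step LT LT' C D'0 Hm Ht.
  exists t => //; split=> // w /Ht1 Hw; right.
  have wx : le I (meet I x w) b.
    case: Hw => [->|ws]; first exact: (meet_ler G).
    by apply: Hb; exists w.
  suff -> : meet I x w = meet I b w.
    apply: (cf_closed1 Ct).1; first by apply/Ht1; left.
    exact/Ht1.
  apply: (le_antisym G); apply: (meet_glb G) => //.
  - exact: (meet_ler G).
  - exact: (le_trans G (meet_lel G _ _) bx).
  - exact: (meet_ler G).
(* The last elements are added by increasing level, so that those required below the new one are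
   already present. *)
have addtop k : k <= lev x -> exists2 u, config c I I' lev lev' u &
    (forall p, List.In p t -> List.In p u) /\
    (forall z, dom1 u z -> le I x z \/ dom1 u (meet I x z)) /\
    (forall i, (c i).1 <> Some 0 -> i < k ->
       exists2 r, dom1 u r & top_at I lev i x r).
  elim: k => [_|k IH kx]; first by exists t.
  have [u Cu [tu [Hm Hk]]] := IH (ltnW kx).
  have [ck|ck] := pselect ((c k).1 = Some 0).
    exists u => //; split=> //; split=> // i ci.
    by rewrite ltnS leq_eqVlt => /orP[/eqP ik|/Hk]; [rewrite ik in ci|apply].
  have [r tr] := lt_top LT (leq_trans kx (lt_bound LT x)) ck kx.
  have [rx [rk _]] := tr.
  have [z zu|i ci|v Cv [uv Hv]] := @step _ _ _ _ _ _ _ _ _ LT LT' _ Cu r D'0.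
  - have [xz|H] := Hm z zu; first by left; apply: (le_trans G rx xz).
    have [rm|mr] := gt_chain G rx (meet_lel G x z).
      by left; apply: (le_trans G rm (meet_ler G _ _)).
    right; suff -> : meet I r z = meet I x z by [].
    apply: (le_antisym G); apply: (meet_glb G) => //.
    + exact: (le_trans G (meet_lel G _ _) rx).
    + exact: (meet_ler G).
    + exact: (meet_ler G).
  - rewrite rk => ik; have [q uq tq] := Hk i ci ik; exists q => //.
    by apply: (top_at_restrict LT tq rx); rewrite rk.
  exists v => //; split; first by move=> p /tu/uv.
  split.
    move=> z /Hv[->|/Hm[xz|H]]; [right|by left|by right; apply/Hv; right].
    rewrite (gt_meetC G) (gt_meet_id G) //; by apply/Hv; left.
  move=> i ci; rewrite ltnS leq_eqVlt => /orP[/eqP ->|/(Hk _ ci)[q uq tq]].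
    by exists r => //; apply/Hv; left.
  by exists q => //; apply/Hv; right.
have [u Cu [tu [Hm Hk]]] := addtop _ (leqnn _).
have [v Cv [uv Hv]] := step LT LT' Cu D'0 Hm Hk.
have [x' Hx'] : dom1 v x by apply/Hv; left.
by exists v, x'; split=> //; split=> // p /st/tu/uv.
Qed.

End Forth.

Lemma node_not_leaf F D (I : interp F D) x : good_tree I ->
  node I x <-> ~ leaf I x.
Proof.
move=> G; split=> [/(nodeP G)[a [b [la [lb [ab ->]]]]] /(leafP G) m|Nl].
  exact: (ab (etrans (esym (m _ (meet_lel G a b))) (m _ (meet_ler G a b)))).
by have [] := leaf_or_node G x.
Qed.

(** * Configurations preserve formulas *)

Section Preservation.
Variables (n : nat) (c : nat -> color).
Variables (F F' D D' : Type) (I : interp F D) (I' : interp F D').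
Variables (J : interp F' D) (J' : interp F' D').
Variables (lev : D -> nat) (lev' : D' -> nat).
Hypotheses (LT : levtree I lev n c) (LT' : levtree I' lev' n c).
Hypotheses (D0 : inhabited D) (D'0 : inhabited D').

Let cfg := config c I I' lev lev'.

Lemma back s x' : cfg s ->
  exists t x, cfg t /\ List.In (x, x') t /\ forall p, List.In p s -> List.In p t.
Proof.
move=> /config_flip C.
have [t [x [Ct [Hx st]]]] := forth LT' LT D0 x' C.
exists (flip t), x; split; first exact: (config_flip Ct).
split; first by apply/in_flip.
by move=> [y y'] Hy; apply/in_flip/st/in_flip.
Qed.

Hypotheses (leJ : le J = le I) (leJ' : le J' = le I').
Hypotheses (meetJ : meet J = meet I) (meetJ' : meet J' = meet I').

(** Configurations see only order and levels, while [J] and [J'] may live in a richer language on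
    the same trees. This isolates what has to be checked for the other symbols, so that one
    back-and-forth argument serves both L_n and L_n^+. *)
Definition preserved : Prop := forall s, cfg s -> forall x x',
  List.In (x, x') s -> (node J x <-> node J' x') /\ (leaf J x <-> leaf J' x') /\
  forall f, (fdom J f x <-> fdom J' f x') /\ (fimg J f x <-> fimg J' f x') /\
    List.In (fn J f x, fn J' f x') s.

Hypothesis P : preserved.

Lemma preserved_eval s env env' t : cfg s ->
  (forall x, term_var x t -> List.In (env x, env' x) s) ->
  List.In (eval J env t, eval J' env' t) s.
Proof.
move=> C; elim: t => [x|t IHt u IHu|f t IH] /= H; first exact: H.
  rewrite meetJ meetJ'; apply: (cf_meet LT LT' C).
    by apply: IHt => x Hx; apply: H; left.
  by apply: IHu => x Hx; apply: H; right.
by have [_ [_ /(_ f)[_ []]]] := P C (IH H).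
Qed.

Lemma preserved_sat phi : forall s env env', cfg s ->
  (forall x, free_var x phi -> List.In (env x, env' x) s) ->
  sat J env phi <-> sat J' env' phi.
Proof.
elim: phi => [|t u|t u|t|t|f t|f t|p IHp q IHq|y p IH] s env env' C /= H //.
- have Ht := preserved_eval C (fun x Hx => H x (or_introl Hx)).
  have Hu := preserved_eval C (fun x Hx => H x (or_intror Hx)).
  split=> E; rewrite E in Ht; first exact: (cf_inj LT LT' C Ht Hu).
  have Hu' := (in_flip s _ _).2 Hu; have Ht' := (in_flip s _ _).2 Ht.
  exact: (cf_inj LT' LT (config_flip C) Ht' Hu').
- have Ht := preserved_eval C (fun x Hx => H x (or_introl Hx)).
  have Hu := preserved_eval C (fun x Hx => H x (or_intror Hx)).
  by rewrite leJ leJ'; apply: (cf_le C).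
- by have [] := P C (preserved_eval C H).
- by have [_ []] := P C (preserved_eval C H).
- by have [_ [_ /(_ f)[]]] := P C (preserved_eval C H).
- by have [_ [_ /(_ f)[_ []]]] := P C (preserved_eval C H).
- rewrite (IHp s env env' C); last by move=> x Hx; apply: H; left.
  by rewrite (IHq s env env' C) // => x Hx; apply: H; right.
- have upd t a a' x : List.In (a, a') t -> (forall r, List.In r s -> List.In r t) ->
      free_var x p -> List.In (update env y a x, update env' y a' x) t.
    move=> Ha st Hx; rewrite /update; case: eqVneq => // /eqP xy.
    by apply: st; apply: H.
  split=> Hs a.
    have [t [b [Ct [Hb st]]]] := back a C.
    by apply/(IH t _ _ Ct (fun x Hx => upd t b a x Hb st Hx))/Hs.
  have [t [b [Ct [Hb st]]]] := forth LT LT' D'0 a C.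
  by apply/(IH t _ _ Ct (fun x Hx => upd t a b x Hb st Hx))/Hs.
Qed.

Lemma config_nil : cfg [::].
Proof. by split=> //; split=> [a b []|i a []]. Qed.

Lemma preserved_equiv : elem_equiv J J'.
Proof.
move=> phi Sphi; have [[a] [a']] := (D0, D'0).
have E env env' : sat J env phi <-> sat J' env' phi.
  by apply: (preserved_sat config_nil) => x /Sphi.
by split=> H env; [apply/(E (fun=> a))|apply/(E _ (fun=> a'))].
Qed.

End Preservation.

(** * Function symbols and predecessors in terms of levels *)

Section Symbols.
Variables (n : nat) (c : nat -> color) (F : Type) (h : F -> nat).

Record level_symbols D (I : interp F D) (lev : D -> nat) : Prop := LevelSymbols {
  ls_img : forall f x, fimg I f x <-> lev x = h f;
  ls_dom : forall f x, fdom I f x <-> h f <= lev x;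
  ls_out : forall f x, lev x < h f -> fn I f x = x;
  ls_fn : forall f x y, h f <= lev x ->
    y = fn I f x <-> top_at I lev (h f) x y
}.

(* The levels i such that every element of level i.+1 has a predecessor, which
   is then of level i. *)
Definition pred_level i : Prop :=
  (c i).1 <> Some 0 /\ (i.+1 = n \/ (c i.+1).2 = Some 0).

Section OneTree.
Variables (D : Type) (I : interp F D) (lev : D -> nat).
Hypothesis LT : levtree I lev n c.
Let G : good_tree I := lt_good LT.

Lemma border_exists x : lev x < n -> (c (lev x)).1 <> Some 0 ->
  exists t, border I lev x t.
Proof.
move=> xn cx; have : at_least (border I lev x) (apart I x) 1.
  have := lt_border LT xn erefl; case E : (c (lev x)).1 => [[|k]|] // [] //.
  by move=> + _; apply: at_least_leq.
by case=> -[|t []] //= _ [Bt _]; exists t.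
Qed.

(** Density excludes a predecessor of the same level, and a skipped level would put an element in
    between. So [y] is the last element of the level just below that of [x], and the level of [x],
    unless it is that of the leaves, must have a first element on each branch. *)
Lemma is_predP y x : is_pred I y x <->
  lev x = (lev y).+1 /\ top_at I lev (lev y) x y /\ pred_level (lev y).
Proof.
split=> [[yx Hyx]|[lx [ty [_ cy]]]]; last first.
  have yx : lt I y x by apply: (lt_lev_lt (lev := lev)); [case: ty|rewrite lx].
  split=> // z [yz zx].
  have := lt_mono LT yz.1; rewrite leq_eqVlt => /orP[/eqP E|lyz].
    by apply: (lt_nle G yz); apply: ty.2.2 => //; case: zx.
  have lz : lev z = lev x.
    by apply/eqP; rewrite eqn_leq (lt_mono LT zx.1) lx.
  have zn := not_leaf_lt LT zx.
  case: cy => [E|]; first by move: zn; rewrite lz lx E ltnn.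
  rewrite -lx -lz; apply: (inner_nonzero LT zn (t := x)); split=> //.
  by exists x; split=> //; split=> //; apply: (le_refl G).
have yn := not_leaf_lt LT yx.
have lyx : lev y < lev x.
  rewrite ltn_neqAle (lt_mono LT yx.1) andbT; apply/eqP => E.
  by have [z Hz] := lt_dense LT yx E; apply: (Hyx z).
have lx : lev x = (lev y).+1.
  apply/eqP; rewrite eqn_leq lyx andbT leqNgt; apply/negP => H.
  have [z [zx lz]] := @lt_ex _ _ _ _ _ _ LT (lev y).+1 x (ltnW H).
  apply: (Hyx z); split; last by apply: (lt_lev_lt (lev := lev)) => //; rewrite lz.
  have [yz|/(lt_mono LT)] := gt_chain G yx.1 zx; last by rewrite lz ltnn.
  by apply: (lt_lev_lt (lev := lev)) => //; rewrite lz.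
have ty : top_at I lev (lev y) x y.
  split; [by case: yx|split=> // z zx lz].
  have [//|yz] := gt_chain G zx yx.1.
  have [->|Nyz] := pselect (y = z); first exact: (le_refl G).
  case: (Hyx z); split=> //.
  by apply: (lt_lev_lt (lev := lev)) => //; rewrite lz.
split=> //; split=> //; split.
  by apply: (border_nonzero LT yn (t := x)); apply/(border_top LT yn yx).
have [->|/eqP Nn] := pselect ((lev y).+1 = n); [by left|right].
apply: contrapT => cx.
have yn' : (lev y).+1 < n by rewrite ltn_neqAle Nn.
have [z [zx lz]] := lt_nofirst LT yn' cx lx.
apply: (Hyx z); split=> //.
have [yz|/(lt_mono LT)] := gt_chain G yx.1 zx.1; last by rewrite lz ltnn.
by apply: (lt_lev_lt (lev := lev)) => //; rewrite lz.
Qed.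

Lemma has_predP x :
  (exists y, is_pred I y x) <-> exists i, lev x = i.+1 /\ pred_level i.
Proof.
split=> [[y /is_predP[lx [_ H]]]|[i [lx H]]]; first by exists (lev y).
have ixn : i < n by have := lt_bound LT x; rewrite lx.
have [|y ty] := lt_top LT ixn H.1 (x := x); first by rewrite lx.
by exists y; apply/is_predP; have [_ [ly _]] := ty; rewrite ly.
Qed.

Lemma is_predecessorP y :
  (exists x, is_pred I y x) <-> lev y < n /\ pred_level (lev y).
Proof.
split=> [[x Hx]|[yn H]].
  split; first by apply: (not_leaf_lt LT (y := x)); case: Hx.
  by have [_ []] := (is_predP y x).1 Hx.
have [t Bt] := border_exists yn H.1.
have [|x [lx [_ Bx]]] := border_level LT Bt (i := (lev y).+1).
  by rewrite ltnSn.
exists x; apply/is_predP; split=> //; split=> //.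
by have [_] := (border_top LT yn Bx.1).1 Bx.
Qed.

Hypothesis LS : level_symbols I lev.

Lemma level_fn_top f x : h f <= lev x -> top_at I lev (h f) x (fn I f x).
Proof. by move=> hx; apply/(ls_fn LS _ hx). Qed.

(** The value of [f] at an element of higher level is the foot of a border cone. The level of [f] is
    thus one of those for which [gclosed] asks for last elements, and configurations contain the
    values of [f]. *)
Lemma level_fn_color f x : h f < lev x -> (c (h f)).1 <> Some 0.
Proof.
move=> hx; have tx := level_fn_top (ltnW hx).
have [yx [ly _]] := tx.
have lyx : lt I (fn I f x) x by apply: (lt_lev_lt (lev := lev)); rewrite ?ly.
have yn := not_leaf_lt LT lyx.
rewrite -ly; apply: (border_nonzero LT yn (t := x)).
by apply/(border_top LT yn lyx); rewrite ly.
Qed.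

End OneTree.

Section TwoTrees.
Variables (D D' : Type) (I : interp F D) (I' : interp F D').
Variables (lev : D -> nat) (lev' : D' -> nat).
Hypotheses (LT : levtree I lev n c) (LT' : levtree I' lev' n c).
Hypotheses (LS : level_symbols I lev) (LS' : level_symbols I' lev').

Lemma symbols_preserved : preserved c I I' I I' lev lev'.
Proof.
move=> s C x x' Hx; have E := cf_lev C Hx.
have El : leaf I x <-> leaf I' x' by rewrite (lt_leaf LT) (lt_leaf LT') E.
split.
  by rewrite (node_not_leaf _ (lt_good LT)) (node_not_leaf _ (lt_good LT')) El.
split=> // f; rewrite (ls_dom LS) (ls_dom LS') (ls_img LS) (ls_img LS') E.
split=> //; split=> //.
have [xh|hx] := ltnP (lev x) (h f).
  by rewrite (ls_out LS xh) (ls_out LS') // -E.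
have tx := level_fn_top LS hx.
have tx' : top_at I' lev' (h f) x' (fn I' f x') by apply: level_fn_top; rewrite -?E.
have := hx; rewrite leq_eqVlt => /orP[/eqP hE|hlt].
  have tE := top_at_self LT x; have tE' := top_at_self LT' x'.
  rewrite -hE in tE; rewrite -E -hE in tE'.
  by rewrite (top_at_inj LT tx tE) (top_at_inj LT' tx' tE').
have [r [r' [Hr [tr tr']]]] := cf_top LT' C Hx (level_fn_color LT LS hlt) hlt.
by rewrite (top_at_inj LT tx tr) (top_at_inj LT' tx' tr').
Qed.

Variables (J : interp (option F) D) (J' : interp (option F) D').
Hypotheses (PJ : plus_expansion I J) (PJ' : plus_expansion I' J').

(** Having a predecessor, and being one, depend on the level alone; the predecessor is a last
    element of a level, so closure puts it in the configuration. *)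
Lemma plus_preserved : preserved c I I' J J' lev lev'.
Proof.
move=> s C x x' Hx; have [H1 [H2 H3]] := symbols_preserved C Hx.
have E := cf_lev C Hx.
rewrite (plus_node PJ) (plus_node PJ') (plus_leaf PJ) (plus_leaf PJ').
split=> //; split=> // -[f|].
  rewrite (plus_fdom PJ) (plus_fdom PJ') (plus_fimg PJ) (plus_fimg PJ').
  by rewrite (plus_fn PJ) (plus_fn PJ').
have domE : fdom J None x <-> fdom J' None x'.
  by rewrite (plus_p_dom PJ) (plus_p_dom PJ') /= (has_predP LT) (has_predP LT') E.
have imgE D1 (I1 : interp F D1) lev1 J1 (LT1 : levtree I1 lev1 n c)
    (P1 : plus_expansion I1 J1) y : fimg J1 None y <-> exists x, is_pred I1 y x.
  rewrite (plus_p_img P1); split=> [[z dz <-]|[z Hz]].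
    by exists z; apply: (plus_p P1).
  have dz : fdom J1 None z by rewrite (plus_p_dom P1); exists y.
  exists z => //; have := plus_p P1 dz.
  move=> /(is_predP LT1)[lz [tz _]]; have [ly [ty _]] := (is_predP LT1 _ _).1 Hz.
  have El : lev1 y = lev1 (fn J1 None z) by apply: succn_inj; rewrite -lz -ly.
  by rewrite El in ty; apply: (top_at_inj LT1 tz ty).
split=> //; split.
  rewrite (imgE _ _ _ _ LT PJ) (imgE _ _ _ _ LT' PJ').
  by rewrite (is_predecessorP LT) (is_predecessorP LT') E.
have [dx|dx] := pselect (fdom J None x); last first.
  by rewrite (plus_p_out PJ dx) (plus_p_out PJ') // -domE.
have [lx [tx [cx _]]] := (is_predP LT _ _).1 (plus_p PJ dx).
have [lx' [tx' _]] := (is_predP LT' _ _).1 (plus_p PJ' (domE.1 dx)).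
have ltx : lev (fn J None x) < lev x by rewrite lx.
have El : lev' (fn J' None x') = lev (fn J None x).
  by apply: succn_inj; rewrite -lx' -lx E.
have [r [r' [Hr [tr tr']]]] := cf_top LT' C Hx cx ltx.
rewrite El in tx'.
by rewrite (top_at_inj LT tx tr) (top_at_inj LT' tx' tr').
Qed.

End TwoTrees.
End Symbols.

(** * The level function of an L_n-structure *)

(** [None] is the most recently added symbol, with the greatest index; the indices run from 1 to
    [k]. *)
Fixpoint idx k : symbols k -> nat :=
  match k return symbols k -> nat with
  | 0 => fun _ => 0
  | j.+1 => fun f : option (symbols j) => if f is Some g then idx g else j.+1
  end.

Lemma idx_leq k (f : symbols k) : idx f <= k.
Proof. by elim: k f => [[]|k IH [f|]] //=; apply: leqW. Qed.

Lemma idx_onto k i : 0 < i <= k -> exists f : symbols k, idx f = i.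
Proof.
elim: k => [|k IH] /andP[i0]; first by case: i i0.
rewrite leq_eqVlt => /orP[/eqP->|ik]; first by exists None.
by have [|f Hf] := IH; [rewrite i0|exists (Some f)].
Qed.

(* E_f consists of the roots of the copies of T_(i+1) if T_(i+1) has a root,
   i = idx f, and of the predecessors of the leaves of T_i otherwise. *)
Definition img_level (c : nat -> color) k (f : symbols k) : nat :=
  if (c (idx f)).2 == Some 0 then idx f else (idx f).-1.

Section Level.
Variables (c : nat -> color) (k : nat).

(** This expresses in L_n that [x] has level at least [i]. If T_(i+1) has a root, D_f consists of
    these elements; otherwise E_f is level [i - 1] and has to be removed. For [i = k + 1] only the
    leaves remain. *)
Definition up D (I : interp (symbols k) D) i x : Prop :=
  (exists f : symbols k, idx f = i /\
     (fdom I f x /\ ((c i).2 = Some 0 \/ ~ fimg I f x))) \/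
  (i = k.+1 /\ leaf I x).

(** A sum of truth values is defined in every structure, leveled or not, and each of its values is
    first-order definable. *)
Definition level D (I : interp (symbols k) D) x : nat :=
  \sum_(i < k.+1) `[< up I i.+1 x >].

Definition leveled D (I : interp (symbols k) D) : Prop :=
  levtree I (level I) k.+1 c /\ level_symbols (@img_level c k) I (level I).

Section Uniqueness.
Variables (D : Type) (I : interp (symbols k) D) (lev : D -> nat).
Hypothesis LT : levtree I lev k.+1 c.
Hypothesis LS : level_symbols (@img_level c k) I lev.

Lemma up_level i x : 0 < i <= k.+1 -> up I i x <-> i <= lev x.
Proof.
move=> /andP[i0]; rewrite leq_eqVlt => /orP[/eqP iE|ik]; split.
- case=> [[f [Hf _]]|[_ /(lt_leaf LT)->]]; last by rewrite iE.
  by have := idx_leq f; rewrite Hf iE ltnn.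
- move=> ilev; right; split=> //; apply/(lt_leaf LT)/eqP.
  by rewrite eqn_leq (lt_bound LT) -iE.
- case=> [[f [Hf [df H]]]|[iE _]]; last by rewrite iE ltnn in ik.
  move: df => /(ls_dom LS); rewrite /img_level Hf; case: eqP => // ci.
  case: H => [//|/(ls_img LS)]; rewrite /img_level Hf; case: eqP => // _ N.
  by rewrite leq_eqVlt => /orP[/eqP /esym//|]; rewrite prednK.
- move=> ilev; left; have [|f Hf] := @idx_onto k i; first by rewrite i0.
  exists f; split=> //; split.
    apply/(ls_dom LS); rewrite /img_level Hf; case: eqP => // _.
    exact: leq_trans (leq_pred _) ilev.
  have [ci|ci] := pselect ((c i).2 = Some 0); [by left|right].
  move=> /(ls_img LS); rewrite /img_level Hf; case: eqP => // _ E.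
  by rewrite E -ltnS prednK // ltnn in ilev.
Qed.

(** Each summand is the truth value of [i < lev x], by [up_level]. Consequently a level function
    found by any construction is the definable one. *)
Lemma level_unique : level I = lev.
Proof.
apply: funext => x; rewrite /level.
have E (i : 'I_k.+1) : `[< up I i.+1 x >] = (i < lev x).
  have H : 0 < i.+1 <= k.+1 by rewrite /= ltn_ord.
  by apply/asboolP/idP => /(up_level x H).
under eq_bigr do rewrite E.
have S m : \sum_(i < m) (i < lev x : nat) = minn m (lev x).
  elim: m => [|m IH]; first by rewrite big_ord0 min0n.
  rewrite big_ord_recr /= IH /minn.
  case: (ltnP m (lev x)) => H.
    rewrite addn1; case: (ltnP m.+1 _) => // H'; apply/eqP.
    by rewrite eqn_leq H H'.
  by rewrite addn0 ltnNge (leq_trans H (leqnSn m)).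
by rewrite S; apply/minn_idPr/(lt_bound LT).
Qed.

Lemma leveledI : leveled I.
Proof. by rewrite /leveled level_unique. Qed.

End Uniqueness.

Section Definability.
Notation definable := (@definable (symbols k)).

Lemma def_up j i : definable (fun D I env => up I j (env i)).
Proof.
apply: def_or; last by apply: def_and; [apply: def_prop|definability].
apply: def_ex_fin => f; apply: def_and; first exact: def_prop.
apply: def_and; first by definability.
by apply: def_or; [apply: def_prop|definability].
Qed.

Lemma def_level_eqn i j : definable (fun D I env => level I (env i) = j).
Proof.
rewrite /level; elim: k.+1 j => [|m IH] j.
  by apply: def_iff (def_prop (0 = j)) => D I env; rewrite big_ord0.
have := def_or (def_and (def_up m.+1 i) (def_and (def_prop (0 < j)) (IH j.-1)))
  (def_and (def_not (def_up m.+1 i)) (IH j)).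
apply: def_iff => D I env; rewrite big_ord_recr /=.
have [H|H] := pselect (up I m.+1 (env i)).
  rewrite (asboolT H) addn1; split; last by move=> <-; left.
  by case=> [[_ [j0 ->]]|[]//]; rewrite prednK.
rewrite (asboolF H) addn0; split=> [[[]|[]]//|->]; by right.
Qed.

Lemma level_bound D (I : interp (symbols k) D) x : level I x <= k.+1.
Proof.
rewrite /level -[X in _ <= X]card_ord -sum1_card.
by apply: leq_sum => i _; case: `[< _ >].
Qed.

(** Levels take at most [k + 2] values, so any property of them is a finite disjunction of
    equations. *)
Lemma def_level1 (Q : nat -> Prop) i : definable (fun D I env => Q (level I (env i))).
Proof.
have := @def_ex_fin _ 'I_k.+2 (fun a D I env => level I (env i) = a /\ Q a)
  (fun a => def_and (def_level_eqn i a) (def_prop (Q a))).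
apply: def_iff => D I env; split=> [[a [-> //]]|H].
by exists (Ordinal (level_bound I (env i) : level I (env i) < k.+2)).
Qed.

Lemma def_level2 (Q : nat -> nat -> Prop) i j :
  definable (fun D I env => Q (level I (env i)) (level I (env j))).
Proof.
have := @def_ex_fin _ 'I_k.+2 (fun a D I env => level I (env i) = a /\ Q a (level I (env j)))
  (fun a => def_and (def_level_eqn i a) (def_level1 (Q a) j)).
apply: def_iff => D I env; split=> [[a [-> //]]|H].
by exists (Ordinal (level_bound I (env i) : level I (env i) < k.+2)).
Qed.

(** [js] lists the variables holding the elements chosen so far; each new quantifier shifts them by
    one and adds 0. *)
Lemma def_extends (K : forall D, interp (symbols k) D -> D -> D -> Prop)
    (A : forall D, interp (symbols k) D -> D -> D -> D -> Prop) :
  (forall i j, definable (fun D I env => K D I (env i) (env j))) ->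
  (forall i j l, definable (fun D I env => A D I (env i) (env j) (env l))) ->
  forall r i js, definable (fun D I env =>
    extends_by (K D I (env i)) (A D I (env i)) (map env js) r).
Proof.
move=> HK HS; elim=> [|r IH] i js /=; first exact: def_prop.
apply: def_ex; apply: def_and; first exact: HK.
apply: def_and.
  elim: js => [|j js IHj].
    by apply: def_iff (def_prop True) => D I env; split=> // _ s [].
  apply: def_iff (def_and (HS i.+1 0 j.+1) IHj) => D I env /=.
  split=> [[H1 H2] s [<-//|/H2//]|H].
  by split=> [|s Hs]; apply: H; [left|right].
apply: def_iff (IH i.+1 (0 :: map S js)) => D I env /=.
by rewrite -map_comp.
Qed.

End Definability.
End Level.

Ltac level_definability :=
  repeat first
    [ exact: def_level_eqn
    | exact: (@def_level1 _ _ (fun a => is_true (leq _ a)))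
    | exact: (@def_level1 _ _ (fun a => is_true (leq a.+1 _)))
    | exact: (@def_level1 _ _ (fun a => is_true (leq a _)))
    | exact: (@def_level2 _ _ (fun a b => is_true (leq a b)))
    | exact: (@def_level2 _ _ (fun a b => a = b))
    | exact: tdef_var | apply: tdef_meet | apply: tdef_fn
    | apply: def_eq | apply: def_le | apply: def_node | apply: def_leaf
    | apply: def_fdom | apply: def_fimg
    | apply: def_and | apply: def_or | apply: def_equiv | apply: def_not
    | apply: def_ex2 | apply: def_ex | apply: def_all | apply: def_imp ].

(** * The level axioms hold in all models of the theory of a class *)

Section Transfer.
Variables (c : nat -> color) (k : nat).
Variables (K : Type) (X : K -> Type) (fam : forall i, interp (symbols k) (X i)).
Hypothesis HK : forall i, leveled c (fam i).

Let LK i : levtree (fam i) (level c (fam i)) k.+1 c := (HK i).1.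
Let SK i : level_symbols (@img_level c k) (fam i) (level c (fam i)) := (HK i).2.
Let GK i : good_tree (fam i) := lt_good (LK i).

Lemma transfer_good D (I : interp (symbols k) D) : inhabited D ->
  in_class_theory fam I -> good_tree I.
Proof.
move=> D0 HI; split; move: D I D0 HI; rewrite /maximal /br /mkset;
  (apply: transfer; first by definability) => i.
- exact: (le_refl (GK i)).
- exact: (le_antisym (GK i)).
- exact: (le_trans (GK i)).
- exact: (br_chain (GK i)).
- exact: (meet_lel (GK i)).
- exact: (meet_ler (GK i)).
- exact: (meet_glb (GK i)).
- exact: (leafP (GK i)).
- exact: (nodeP (GK i)).
- exact: (below_leaf (GK i)).
- exact: (leaf_or_node (GK i)).
Qed.

Lemma def_border i j : definable (fun D (I : interp (symbols k) D) env =>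
  border I (level c I) (env i) (env j)).
Proof. rewrite /border /lt; level_definability. Qed.

Lemma def_inner i j : definable (fun D (I : interp (symbols k) D) env =>
  inner I (level c I) (env i) (env j)).
Proof. rewrite /inner /lt; level_definability. Qed.

Lemma def_apart i j l : definable (fun D (I : interp (symbols k) D) env =>
  apart I (env i) (env j) (env l)).
Proof. rewrite /apart; definability. Qed.

(** An infinite count is a scheme with one sentence for each [r]; a finite count is the sentence for
    [m] and the negation of the one for [m + 1]. All of them are transferred separately. *)
Lemma transfer_exactly (Kd : forall D, interp (symbols k) D -> D -> D -> Prop) l m :
  (forall i j, definable (fun D I env => Kd D I (env i) (env j))) ->
  (forall i x, level c (fam i) x = l ->
     exactly (Kd (X i) (fam i) x) (apart (fam i) x) m) ->
  forall D (I : interp (symbols k) D), inhabited D -> in_class_theory fam I ->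
    forall x, level c I x = l -> exactly (Kd D I x) (apart I x) m.
Proof.
move=> HKd Hm.
have D r : definable (fun D I env => at_least (Kd D I (env 0)) (apart I (env 0)) r).
  apply: def_iff (def_extends (K := Kd) (A := fun D I => @apart _ D I)
    HKd def_apart r 0 [::]) => D I env.
  exact: iff_sym (at_least_extends _ _ r).
case: m Hm => [m|] Hm D' I D0 HI x lx; last first.
  move=> r; move: D' I D0 HI x lx; apply: transfer => [|i x lx]; last exact: (Hm i x lx r).
  by apply: def_all; apply: def_imp; [exact: def_level_eqn|exact: D].
split; move: D' I D0 HI x lx; apply: transfer.
- by apply: def_all; apply: def_imp; [exact: def_level_eqn|exact: D].
- by move=> i x /Hm[].
- by apply: def_all; apply: def_imp; [exact: def_level_eqn|apply: def_not; exact: D].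
- by move=> i x /Hm[].
Qed.

Lemma transfer_leveled D (I : interp (symbols k) D) : inhabited D ->
  in_class_theory fam I -> leveled c I.
Proof.
move=> D0 HI; split; split.
- exact: transfer_good.
- move: D I D0 HI; apply: transfer => [|i]; last exact: (lt_mono (LK i)).
  level_definability.
- move: D I D0 HI; apply: transfer => [|i]; last exact: (lt_leaf (LK i)).
  level_definability.
- move: D I D0 HI; apply: transfer => [|i]; last exact: (lt_bound (LK i)).
  level_definability.
- move=> l; move: D I D0 HI; apply: transfer => [|i]; last exact: (lt_ex (LK i)).
  level_definability.
- move=> l x lk cl; move: x; rewrite /top_at; move: D I D0 HI; apply: transfer.
    level_definability.
  by move=> i x; apply: (lt_top (LK i)).
- move=> l x lk cl; move: x; rewrite /lt; move: D I D0 HI; apply: transfer.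
    level_definability.
  by move=> i x; apply: (lt_nofirst (LK i)).
- rewrite /lt; move: D I D0 HI; apply: transfer => [|i]; last exact: (lt_dense (LK i)).
  level_definability.
- move=> l x lk; move: D I D0 HI x; apply: (transfer_exactly def_border) => i x.
  exact: (lt_border (LK i)).
- move=> l x lk; move: D I D0 HI x; apply: (transfer_exactly def_inner) => i x.
  exact: (lt_inner (LK i)).
- move=> f; move: D I D0 HI; apply: transfer => [|i]; last exact: (ls_img (SK i)).
  level_definability.
- move=> f; move: D I D0 HI; apply: transfer => [|i]; last exact: (ls_dom (SK i)).
  level_definability.
- move=> f; move: D I D0 HI; apply: transfer => [|i]; last exact: (ls_out (SK i)).
  level_definability.
- move=> f; rewrite /top_at; move: D I D0 HI; apply: transfer => [|i].
    level_definability.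
  exact: (ls_fn (SK i)).
Qed.

End Transfer.

(** * 1-colored trees as trees with one level *)

Lemma list_in_nth T (t0 : T) (u : seq T) t :
  List.In t u <-> exists2 i, i < size u & t = nth t0 u i.
Proof.
elim: u => [|s u IH] /=; first by split=> // -[].
split=> [[->|/IH[i iu ->]]|[[|i]]]; [by exists 0|by exists i.+1|by left|].
by rewrite ltnS => iu tE; right; apply/IH; exists i.
Qed.

Section Cardinality.
Variables (D T : Type) (K : D -> Prop) (sep : D -> D -> Prop).
Variables (S : set T) (g : D -> T).
Hypothesis gS : forall t, K t -> S (g t).
Hypothesis Sg : forall C, S C -> exists2 t, K t & g t = C.
Hypothesis sepE : forall t u, K t -> K u -> sep t u <-> g t <> g u.

Lemma sepfam_nth t0 u : sepfam K sep u ->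
  {in `I_(size u) &, injective (fun i => g (nth t0 u i))} /\
  (fun i => g (nth t0 u i)) @` `I_(size u) `<=` S.
Proof.
move=> fu.
have Ku i : i < size u -> K (nth t0 u i).
  by move=> iu; apply: (sepfam_K fu); apply/(list_in_nth t0); exists i.
split=> [|C [i /= iu <-]]; last exact/gS/Ku.
have sym i j : i < j -> j < size u -> g (nth t0 u i) <> g (nth t0 u j).
  move=> ij ju; apply/sepE; [exact/Ku/(ltn_trans ij)|exact: Ku|].
  elim: u fu i j ij ju {Ku} => // t u IH [_ [Ht fu]] [|i] [|j] //= ij ju.
    by apply: Ht; apply/(list_in_nth t0); exists j.
  exact: IH.
move=> i j /[!inE] /= iu ju E; case: (ltngtP i j) => // ij.
- by case: (sym i j).
- by case: (sym j i).
Qed.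

(** A separated family is enlarged greedily. If this stops before length [r], the family represents
    all of [S], which then has fewer than [r] elements. *)
Lemma at_least_card r : at_least K sep r <-> `I_r #<= S.
Proof.
have card_u u t0 : sepfam K sep u ->
    (fun i => g (nth t0 u i)) @` `I_(size u) #= `I_(size u).
  by move=> /(sepfam_nth t0)[inj _]; apply: inj_card_eq.
split=> [[[|t0 u] <- fu]|rS].
- by rewrite II0; apply: card_ge0.
- have [_ /subset_card_le] := sepfam_nth t0 fu.
  by apply: card_le_trans; have /card_eqPle[] := card_u _ t0 fu.
suff: at_least K sep r \/ exists2 u, sepfam K sep u & size u < r /\
    forall C, S C -> exists2 t, List.In t u & g t = C.
  case=> // -[u fu [ur Hu]]; move: rS ur.
  case: u fu Hu => [|t0 u] fu Hu rS ur.
    have S0 : S = set0.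
      by rewrite predeqE => C; split=> // /Hu[].
    have : `I_r 0 by exact: ur.
    by move: rS; rewrite S0 card_le0 => /eqP ->.
  have SI : S #<= `I_(size (t0 :: u)).
    apply: (@card_le_trans _ _ _ ((fun i => g (nth t0 (t0 :: u) i)) @` `I_(size (t0 :: u)))).
      apply: subset_card_le => C /Hu[t /(list_in_nth t0)[i iu ->] <-].
      by exists i.
    by have /card_eqPle[] := card_u _ t0 fu.
  have := card_le_trans rS SI; rewrite card_le_II => H.
  by have := leq_trans ur H; rewrite ltnn.
elim: r {rS} => [|r]; first by left; exists [::].
case=> [[u ur fu]|[u fu [ur Hu]]]; last by right; exists u => //; split=> //; apply: ltnW.
have [H|N] := pselect (forall C, S C -> exists2 t, List.In t u & g t = C).
  by right; exists u => //; rewrite ur.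
left; have [C [SC NC]] : exists C, S C /\ ~ exists2 t, List.In t u & g t = C.
  by apply: contrapT => N'; apply: N => C SC; apply: contrapT => NC; apply: N'; exists C.
have [t Kt tC] := Sg SC; exists (t :: u); first by rewrite /= ur.
split=> //; split=> // s su; apply/sepE => //; first exact: sepfam_K fu su.
by rewrite tC => E; apply: NC; exists s.
Qed.

Lemma has_card_exactly m : has_card S m -> exactly K sep m.
Proof.
case: m => [m|] /= Sm.
  split; first by apply/at_least_card; rewrite (card_le_eqr Sm).
  by move=> /at_least_card; rewrite (card_le_eqr Sm) card_le_II ltnn.
move=> r; apply/at_least_card; have /infiniteP := Sm.
by apply: card_le_trans; apply: card_leT.
Qed.

End Cardinality.

(** Given an injection [f] into [n] indices, one descends, by induction on [m], to an element with
    nothing of index below [m] under it. For [m = n] nothing is under it at all. *)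
Lemma infinite_no_min T (A : set T) (R : T -> T -> Prop) :
  (forall x, ~ R x x) -> (forall x y z, R x y -> R y z -> R x z) ->
  A !=set0 -> (forall x, A x -> exists2 y, A y & R y x) -> infinite_set A.
Proof.
move=> Rirr Rtr [a Aa] Hmin /finite_setP[n /card_eqPle[/pcard_leP[f] _]].
have /(_ n)[y Ay Hy] : forall m, exists2 y, A y &
    forall z, A z -> f z < m -> ~ R z y.
  elim=> [|m [y Ay Hy]]; first by exists a.
  have [[z [Az [fz zy]]]|N] := pselect (exists z, A z /\ f z = m /\ R z y).
    exists z => // w Aw; rewrite ltnS leq_eqVlt => /orP[/eqP fw|fw] wz.
      have wE : w = z.
        by apply: (@inj _ _ _ f); [rewrite inE|rewrite inE|apply: etrans fw (esym fz)].
      by rewrite wE in wz; apply: (Rirr z).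
    exact: (Hy w Aw fw (Rtr _ _ _ wz zy)).
  exists y => // w Aw; rewrite ltnS leq_eqVlt => /orP[/eqP fw wy|]; last exact: Hy.
  by apply: N; exists w.
have [z Az zy] := Hmin y Ay.
by apply: (Hy z Az _ zy); apply: (@funS _ _ _ _ f z Az).
Qed.

Section OneColored.
Variables (c : color) (D : Type) (I : interp void D).
Hypotheses (V : valid_color c) (OC : one_colored c I).
Let G : good_tree I := OC.1.

Let lev x : nat := `[< leaf I x >].

Lemma leaf_lev x : leaf I x <-> lev x = 1.
Proof. by rewrite /lev; split=> [/asboolT->//|]; case: asboolP. Qed.

Lemma node_lev x : ~ leaf I x <-> lev x = 0.
Proof. by rewrite /lev; split=> [/asboolF->//|]; case: asboolP. Qed.

Lemma leaf_max a y : leaf I a -> ~ lt I a y.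
Proof. by move=> /(leafP G) m [/m]. Qed.

Lemma lt_not_leaf x y : lt I x y -> ~ leaf I x.
Proof. by move=> xy lx; apply: (leaf_max lx xy). Qed.

Lemma color_cases : [\/ type0 c, type1a c | type1b c].
Proof.
rewrite /type0 /type1a /type1b.
have [|H1] := pselect (c.1 = Some 0); first by constructor 2.
by have [|H2] := pselect (c.2 = Some 0); [constructor 1|constructor 3].
Qed.

Lemma cone_self x t : lt I x t -> cones I x [set s | lt I x s /\ lt I x (meet I t s)].
Proof. by move=> xt; exists t. Qed.

Lemma in_cone x t : lt I x t ->
  [set s | lt I x s /\ lt I x (meet I t s)] t.
Proof. by move=> xt; split=> //; rewrite (gt_meet_id G) //; apply: (le_refl G). Qed.

Lemma apart_cone x t u : lt I x t -> lt I x u -> apart I x t u <->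
  [set s | lt I x s /\ lt I x (meet I t s)] <>
  [set s | lt I x s /\ lt I x (meet I u s)].
Proof.
move=> xt xu; split=> [A E|N].
  have : [set s | lt I x s /\ lt I x (meet I u s)] u by apply: in_cone.
  by rewrite -E => -[_ /(lt_nle G)].
apply: contrapT => A; apply: N.
apply/seteqP; split=> s [xs ms]; split=> //; apply: (napart_lt G) => //.
  apply: (napart_trans G xu xs (p := t)); first by move=> /(apart_sym G).
  by move=> /(apart_sym G)/(lt_nle G ms).
apply: (napart_trans G xt xs (p := u)) => //.
by move=> /(apart_sym G)/(lt_nle G ms).
Qed.

(** Level 0 consists of all nodes, so a node of the cone below [t] would make it inner. As leaves
    are maximal, the cone is reduced to [t]: border cones are the single leaves counted by the
    color. *)
Lemma border_cone1 x t : border I lev x t -> leaf I t /\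
  [set s | lt I x s /\ lt I x (meet I t s)] = [set t].
Proof.
move=> [xt Nt]; have x0 : lev x = 0 by apply/node_lev/(lt_not_leaf xt).
have L z : lt I x z -> le I z t -> leaf I z.
  move=> xz zt; apply: contrapT => /node_lev lz; apply: Nt.
  by exists z; rewrite lz x0.
split; first by apply: L => //; apply: (le_refl G).
apply/seteqP; split=> [s [xs ms]|s ->]; last exact: in_cone.
have m := (leafP G _).1 (L _ ms (meet_lel G _ _)).
have lt' := (leafP G _).1 (L _ xt (le_refl G t)).
have E := m _ (meet_lel G _ _).
by apply/esym/lt'; rewrite -E; apply: (meet_ler G).
Qed.

Lemma leaf_cone_border x t a : lt I x t ->
  [set s | lt I x s /\ lt I x (meet I t s)] = [set a] -> leaf I a ->
  border I lev x t /\ t = a.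
Proof.
move=> xt E la; have ta : t = a.
  by have := in_cone xt; rewrite E.
split=> //; split=> // -[z [xz [zt lz]]].
have x0 : lev x = 0 by apply/node_lev/(lt_not_leaf xt).
move: lz; rewrite x0 => /node_lev; apply.
suff -> : z = a by [].
have : [set s | lt I x s /\ lt I x (meet I t s)] z.
  by split=> //; rewrite (gt_meetC G) (gt_meet_id G).
by rewrite E.
Qed.

Section Below.
Hypothesis Hbelow : forall a, leaf I a -> exists2 A : set D, dense_without_first I A &
  (forall y, A y -> lt I y a) /\
  (forall y, lt I y a -> A y).

Lemma below_ex a : leaf I a -> exists2 y, lt I y a & ~ leaf I y.
Proof.
move=> /Hbelow[A [[y Ay] _] [Aa _]]; exists y; first exact: Aa.
exact: (lt_not_leaf (Aa _ Ay)).
Qed.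

Lemma below_nofirst x : ~ leaf I x -> exists2 y, lt I y x & ~ leaf I y.
Proof.
move=> nx; have [a la xa] := below_leaf G x.
have xa' : lt I x a by split=> // E; rewrite E in nx.
have [A [_ [_ Nf]] [Aa HA]] := Hbelow la.
have [y [Ay Nxy]] : exists y, A y /\ ~ le I x y.
  apply: contrapT => N; apply: Nf; exists x; split; first exact: HA.
  by move=> y Ay; apply: contrapT => Nxy; apply: N; exists y.
have yx : lt I y x by apply: (nle_lt G _ _ Nxy); [exact: xa|case: (Aa _ Ay)].
by exists y => //; apply: (lt_not_leaf yx).
Qed.

Lemma below_dense x y : lt I x y -> ~ leaf I y ->
  exists z, lt I x z /\ lt I z y.
Proof.
move=> xy ny; have [a la ya] := below_leaf G y.
have ya' : lt I y a by split=> // E; rewrite E in ny.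
have [A [_ [Ad _]] [Aa HA]] := Hbelow la.
have [|z [_ Hz]] := Ad x y _ (HA _ ya') xy; last by exists z.
by apply: HA; apply: (lt_le_trans G xy).
Qed.

End Below.

(** [A] is the set of elements strictly below a leaf: its open branch in type (1.a), the closed
    branch of its predecessor in type (1.b). This lets the two types share the density argument;
    type (0) has a single node. *)
Lemma levtree_one (cc : nat -> color) : cc 0 = c ->
  (type0 c \/ forall a, leaf I a -> exists2 A : set D, dense_without_first I A &
    (forall y, A y -> lt I y a) /\ (forall y, lt I y a -> A y)) ->
  (forall a, leaf I a -> exists2 y, lt I y a & ~ leaf I y) ->
  (c.1 <> Some 0 -> forall a, leaf I a -> exists y, top_at I lev 0 a y) ->
  (forall x, ~ leaf I x -> exactly (border I lev x) (apart I x) c.1 /\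
                           exactly (inner I lev x) (apart I x) c.2) ->
  levtree I lev 1 cc.
Proof.
move=> cc0 Hb Hex Htop Hcard.
have dense : ~ type0 c -> forall x y, lt I x y -> ~ leaf I y ->
    exists z, lt I x z /\ lt I z y.
  by case: Hb => // Hb _; apply: below_dense Hb.
split.
- exact: G.
- move=> x y xy; rewrite /lev.
  case: asboolP => // lx; case: asboolP => // ny.
  by case: ny; rewrite -((leafP G x).1 lx _ xy).
- exact: leaf_lev.
- by move=> x; rewrite /lev; case: asboolP.
- move=> [|i] x ix.
    have [lx|/node_lev lx] := pselect (leaf I x).
      by have [y [yx _] /node_lev ly] := Hex _ lx; exists y.
    by exists x; split=> //; apply: (le_refl G).
  exists x; split; first exact: (le_refl G).
  by apply/eqP; rewrite eqn_leq ix andbT; rewrite /lev; case: asboolP.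
- move=> [|i] x // _; rewrite cc0 => ci.
  rewrite /lev; case: asboolP => // lx _; exact: Htop.
- move=> [|i] x // _; rewrite cc0 => ci /node_lev nx.
  by case: Hb => // Hb; have [y yx /node_lev] := below_nofirst Hb nx; exists y.
- move=> x y xy lxy; have nx := lt_not_leaf xy.
  have ny : ~ leaf I y by apply/node_lev; rewrite -lxy; apply/node_lev.
  (* Two comparable nodes give an inner cone, which excludes type (0). *)
  apply: dense => // c0; have [_] := Hcard x nx; rewrite c0 => -[_ []].
  exists [:: y] => //; split=> //; split=> //; exists y; split=> //.
  by split=> //; apply: (le_refl G).
- by move=> [|i] x // _ /node_lev /Hcard[]; rewrite cc0.
- by move=> [|i] x // _ /node_lev /Hcard[]; rewrite cc0.
Qed.

Lemma inner_of_not_border x t : lt I x t -> ~ border I lev x t -> inner I lev x t.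
Proof. by move=> xt; have [//|] := border_or_inner lev xt. Qed.

Lemma levtree_type0 cc : cc 0 = c -> type0 c -> levtree I lev 1 cc.
Proof.
move=> cc0 c0; have [Hn Hl] := OC.2.1 c0.
have nodeE x y : ~ leaf I x -> ~ leaf I y -> x = y.
  move=> /(node_not_leaf x G) nx /(node_not_leaf y G) ny.
  move: Hn; rewrite /= II1 => /card_eqPle[/pcard_leP[f] _].
  apply: (@inj _ _ _ f); rewrite ?inE //.
  exact: etrans (@funS _ _ _ _ f x nx) (esym (@funS _ _ _ _ f y ny)).
have two a : leaf I a -> exists2 b, leaf I b & a <> b.
  move=> la; apply: contrapT => N.
  have E : leaf I = [set a].
    apply/seteqP; split=> [b lb|b ->//]; apply: contrapT => /= ab.
    by apply: N; exists b => // E; apply: ab.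
  move: Hl V; rewrite E /valid_color c0 /=; case: (c.1) => [m|] /= Hl.
    move=> m2; have : `I_1 #= `I_m.
      by rewrite -(card_eql (_ : [set a] #= `I_1)) //; apply: card_set1.
    by move=> /card_eq_II m1; rewrite -m1 in m2.
  by move=> _; apply: Hl.
have below a : leaf I a -> exists2 y, lt I y a & ~ leaf I y.
  move=> la; have [b lb ab] := two a la; exists (meet I a b).
    split=> [|E]; first exact: (meet_lel G).
    apply: ab; apply: ((leafP G a).1 la); rewrite -E; exact: (meet_ler G).
  by apply/(node_not_leaf _ G)/(nodeP G); exists a, b.
apply: levtree_one => //; first by left.
  move=> _ a la; have [y ya ny] := below a la; exists y; split; first by case: ya.
  split=> [|z _ /node_lev nz]; first exact/node_lev.
  by rewrite (nodeE y z); first exact: (le_refl G).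
move=> x nx; split; last first.
  rewrite c0; split; first by exists [::].
  move=> [[|t []] //= _ [[xt [z [xz [_ lz]]]] _]].
  apply: xz.2; apply: nodeE => //; apply/node_lev; rewrite lz; exact/node_lev.
have Bl t : border I lev x t <-> leaf I t.
  split=> [/border_cone1[]//|lt'].
  split.
    have [y yt ny] := below t lt'.
    by rewrite (nodeE x y).
  move=> [z [xz [_ lz]]]; apply: xz.2; apply: nodeE => //.
  apply/node_lev; rewrite lz; exact/node_lev.
apply: (has_card_exactly (g := id) (S := leaf I)) Hl.
- by move=> t /Bl.
- by move=> t lt'; exists t => //; apply/Bl.
- move=> t u /Bl lt' /Bl lu; split=> [A tu|tu].
    move: A; rewrite /= in tu; rewrite tu; apply: (napart_refl G).
    by have /Bl[] := lu.
  rewrite /apart (nodeE x (meet I t u)) //; first exact: (le_refl G).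
  by apply/(node_not_leaf _ G)/(nodeP G); exists t, u.
Qed.

Lemma levtree_type1a cc : cc 0 = c -> type1a c -> levtree I lev 1 cc.
Proof.
move=> cc0 c0; have [Hl Hn] := OC.2.2.1 c0.
have Hb : forall a, leaf I a -> exists2 A : set D, dense_without_first I A &
    (forall y, A y -> lt I y a) /\ (forall y, lt I y a -> A y).
  by move=> a la; exists [set x | lt I x a]; first exact: Hl.
apply: levtree_one => //; first by right.
  exact: below_ex.
move=> x /[dup] nx /(node_not_leaf _ G)/Hn[Hc Hinf].
have NB t : ~ border I lev x t.
  move=> Bt; have [_ E] := border_cone1 Bt.
  apply: (Hinf _ (cone_self Bt.1)); rewrite E; exact: finite_set1.
split.
  rewrite c0; split; first by exists [::].
  by move=> [[|t []] //= _ [/NB]].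
apply: (has_card_exactly (g := fun t => [set s | lt I x s /\ lt I x (meet I t s)])) Hc.
- by move=> t [xt _]; apply: cone_self.
- by move=> C [t xt ->]; exists t => //; apply: inner_of_not_border (NB t).
- by move=> t u [xt _] [xu _]; apply: apart_cone.
Qed.

(** Border cones are single leaves. Inner cones are infinite, since by density the interval from [x]
    to a further node has no least element. Hence they are the leaf cones and the infinite cones
    counted by the color. *)
Lemma levtree_type1b cc : cc 0 = c -> type1b c -> levtree I lev 1 cc.
Proof.
move=> cc0 c0; have [Hl Hn] := OC.2.2.2 c0.
have Hp a p y : is_pred I p a -> lt I y a -> le I y p.
  move=> [pa Hp] ya; have [//|py] := gt_chain G ya.1 pa.1.
  have [->|N] := pselect (p = y); first exact: (le_refl G).
  by case: (Hp y).
have Hb : forall a, leaf I a -> exists2 A : set D, dense_without_first I A &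
    (forall y, A y -> lt I y a) /\ (forall y, lt I y a -> A y).
  move=> a la; have [p pa Hd] := Hl a la; exists (br I p) => //.
  split=> y; last exact: Hp.
  by move=> yp; apply: (le_lt_trans G yp); case: pa.
have inner_inf x t : inner I lev x t ->
    infinite_set [set s | lt I x s /\ lt I x (meet I t s)].
  move=> [xt [z [xz [zt lz]]]].
  apply: (@sub_infinite_set _ [set s | lt I x s /\ le I s z]).
    move=> s [xs sz]; split=> //; rewrite (gt_meetC G) (gt_meet_id G) //.
    exact: (le_trans G sz zt).
  apply: (infinite_no_min (R := lt I)).
  - by move=> s [].
  - by move=> s u v su [uv _]; apply: (lt_le_trans G su).
  - by exists z; split=> //; apply: (le_refl G).
  - move=> s [xs sz]; have [|u [xu us]] := below_dense Hb xs.
      have x0 : lev x = 0 by apply/node_lev/(lt_not_leaf xt).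
      move=> ls; move: lz; rewrite x0 => /node_lev; apply.
      by rewrite -((leafP G s).1 ls _ sz).
    by exists u => //; split=> //; apply: (le_trans G us.1).
apply: levtree_one => //; first by right.
- exact: below_ex.
- move=> _ a la; have [p pa _] := Hl a la; exists p; split; first by case: pa => -[].
  split; first exact/node_lev/(lt_not_leaf pa.1).
  move=> z za /node_lev nz; apply: (Hp a) => //; split=> // E.
  by rewrite E in nz.
move=> x /(node_not_leaf _ G)/Hn[Hc1 Hc2]; split.
  apply: (has_card_exactly (g := fun t => [set s | lt I x s /\ lt I x (meet I t s)])) Hc1.
  - move=> t Bt; have [lt' E] := border_cone1 Bt; split; first exact: cone_self Bt.1.
    by exists t.
  - move=> C [[t xt CE] [a la Ca]]; exists t => //.
    by rewrite CE in Ca; have [] := leaf_cone_border xt Ca la.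
  - by move=> t u [xt _] [xu _]; apply: apart_cone.
apply: (has_card_exactly (g := fun t => [set s | lt I x s /\ lt I x (meet I t s)])) Hc2.
- by move=> t It; split; [apply: cone_self It.1|apply: inner_inf].
- move=> C [[t xt CE] Cinf]; exists t => //; apply: inner_of_not_border => // Bt.
  apply: Cinf; rewrite CE (border_cone1 Bt).2; exact: finite_set1.
- by move=> t u [xt _] [xu _]; apply: apart_cone.
Qed.

Lemma one_colored_levtree cc : cc 0 = c -> levtree I lev 1 cc.
Proof.
move=> cc0; case: color_cases => c0.
- exact: levtree_type0.
- exact: levtree_type1a.
- exact: levtree_type1b.
Qed.

End OneColored.

Lemma one_colored_leveled (cc : nat -> color) (M : structure (symbols 0)) :
  valid_color (cc 0) -> one_colored (cc 0) (interp_of M) -> leveled cc M.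
Proof.
by move=> V OC; apply: (@leveledI cc 0 _ M _ (one_colored_levtree V OC erefl)); split=> -[].
Qed.

(** * Models of an extension have one more level *)

Lemma leveled_equiv c k D D' (I : interp (symbols k) D) (J : interp (symbols k) D') :
  inhabited D -> leveled c I -> elem_equiv J I -> inhabited D' -> leveled c J.
Proof.
move=> D0 LM E D'0.
apply: (@transfer_leveled c k unit (fun=> D) (fun=> I)) => // phi Sphi H.
exact/(E phi Sphi)/(H tt).
Qed.

(** Inner cones come with level 0 having no first element. Without inner cones no two elements of
    level 0 are comparable, and since meets with an element of level 0 have level 0, it is a
    root. *)
Lemma root_color c (M : structure (symbols 0)) : leveled c M ->
  has_root M <-> (c 0).2 = Some 0.
Proof.
move=> [LT _]; have G := lt_good LT; split=> [[r Hr]|c0].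
  have [[|i] lr] : exists i, level c M r = i by exists (level c M r).
    apply: contrapT => N; have [y [yr _]] := lt_nofirst LT (ltn0Sn 0) N lr.
    by apply: (lt_nle G yr); apply: Hr.
  have [y [yr ly]] := @lt_ex _ _ _ _ _ _ LT 0 r (leq0n _).
  have := lt_mono LT (Hr y); by rewrite ly lr.
have [a] := carrier_inhabited M.
have [r [_ lr]] := @lt_ex _ _ _ _ _ _ LT 0 a (leq0n _).
exists r => x; suff -> : r = meet M x r by apply: (meet_lel G).
have lm : level c M (meet M x r) = 0.
  by have := lt_mono LT (meet_ler G x r); rewrite lr leqn0 => /eqP.
apply: contrapT => N; have rm : lt M (meet M x r) r.
  by split; [apply: (meet_ler G)|move=> E; apply: N].
have mn : level c M (meet M x r) < 1 by rewrite lm.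
have /(inner_nonzero LT mn) : inner M (level c M) (meet M x r) r.
  split=> //; exists r; split=> //; split; first exact: (le_refl G).
  by rewrite lr lm.
by rewrite lm.
Qed.

Lemma leaf_preds_level c k D (I : interp (symbols k) D) : leveled c I ->
  (c k).1 <> Some 0 -> leaf_preds I = [set y | level c I y = k].
Proof.
move=> [LT _] ck; apply/seteqP; split=> y.
  move=> [a la /(is_predP LT)[+ _]] /=.
  by rewrite ((lt_leaf LT a).1 la) => -[].
move=> /= ly; have [|t Ht] := (is_predecessorP LT y).2.
  by rewrite ly ltnSn; split=> //; split=> //; left.
exists t => //; apply/(lt_leaf LT).
by have [-> _] := (is_predP LT _ _).1 Ht; rewrite ly.
Qed.

Section Step.
Variables (c : nat -> color) (k : nat).
Variables (T : structure (symbols k)) (T0 : structure (symbols 0)).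
Variables (D : Type) (I : interp (symbols k.+1) D).
(** The colors as seen from [T0], whose level 0 becomes level [k.+1] of the extension. *)
Let cc i := c (i + k.+1).
Hypotheses (LT : leveled c T) (LT0 : leveled cc T0).
Hypothesis R : rtimes_spec (F := symbols k) T T0 I.
Hypothesis D0 : inhabited D.

Let F := symbols k.
Let e : D -> D := fn I None.
Let E : set D := fimg I None.
Let Ege : set D := fdom I None.
Let rt := has_root T0.
Let simD : D -> D -> Prop := @sim F T0 D I.
Let pi (x : D) : quotient simD := class simD x.
(** The union of the copies of [T0]: E_>= if [T0] has a root and E_> otherwise. Outside it the
    classes are single points. *)
Let U x := Ege x /\ (rt \/ ~ E x).

Let G : good_tree I := ext_tree R.

Lemma e_E x : Ege x -> E (e x).
Proof. by move=> xE; case: (ext_max R xE) => -[]. Qed.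

Lemma e_le x : le I (e x) x. Proof. exact: (ext_le R). Qed.

Lemma e_max x y : Ege x -> E y -> le I y x -> le I y (e x).
Proof. by move=> /(ext_max R)[_ H] Ey yx; apply: H. Qed.

Lemma Ege_up x y : Ege x -> le I x y -> Ege y.
Proof.
rewrite /Ege (ext_dom R) => -[z Ez zx] xy.
by exists z => //; apply: (le_trans G zx).
Qed.

Lemma E_Ege x : E x -> Ege x.
Proof. by rewrite /Ege (ext_dom R) => Ex; exists x => //; apply: (le_refl G). Qed.

Lemma e_fix x : E x -> e x = x.
Proof.
move=> Ex; apply: (le_antisym G); first exact: e_le.
by apply: e_max => //; [apply: E_Ege|apply: (le_refl G)].
Qed.

Lemma U_up x y : U x -> le I x y -> U y.
Proof.
move=> [xE H] xy; split; first exact: Ege_up xE xy.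
case: H => [|NE]; [by left|right=> Ey; apply: NE].
exact: (ext_convex R (e_E xE) Ey (e_le x) xy).
Qed.

Lemma sim_refl x : simD x x.
Proof.
have [xE|xE] := pselect (Ege x); last by left.
right; split=> //; split=> //.
by have [r|r] := pselect rt; [left|right; split=> //; right].
Qed.

Lemma sim_sym x y : simD x y -> simD y x.
Proof.
case=> [[-> H]|[xE [yE H]]]; first exact: sim_refl.
right; split=> //; split=> //; case: H => [[r ->]|[r H]]; [by left|right].
split=> //; case: H => [[exy H]|->]; [left|by right].
by rewrite -exy (gt_meetC G).
Qed.

Lemma sim_trans x y z : simD x y -> simD y z -> simD x z.
Proof.
case=> [[-> _]//|[xE [yE H]]]; case=> [[<- _]|[_ [zE H']]].
  by right; split.
right; split=> //; split=> //.
case: H => [[r exy]|[r H]]; case: H' => [[r' eyz]|[r' H']] //.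
  by left; rewrite exy.
right; split=> //; case: H => [[exy H]|->//]; case: H' => [[eyz H']|<-]; last by left.
left; rewrite exy; split=> //; rewrite exy in H.
apply: (napart_lt G); first exact: (lt_le_trans G H (meet_lel G _ _)).
apply: (napart_trans G _ _ (p := y)).
- exact: (lt_le_trans G H (meet_lel G _ _)).
- exact: (lt_le_trans G H' (meet_ler G _ _)).
- exact: (lt_napart G).
- by move=> /(apart_sym G); apply: (lt_napart G).
Qed.

Lemma pi_eq x y : pi x = pi y <-> simD x y.
Proof.
split=> [H|xy].
  have : sval (pi x) = sval (pi y) by rewrite H.
  by move=> /= ->; apply: sim_refl.
apply: eq_exist; apply: funext => z; apply: propext; split.
  exact: (sim_trans (sim_sym xy)).
exact: sim_trans.
Qed.

Lemma pi_onto C : exists x, C = pi x.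
Proof. by case: C => S [x xS]; exists x; apply: eq_exist. Qed.

Lemma sim_notU x y : ~ U x -> simD x y -> x = y.
Proof.
move=> NU [[//]|[xE [yE [[r _]|[r [[exy H]|//]]]]]]; first by case: NU; split; [|left].
have Ex : E x by apply: contrapT => NE; apply: NU; split; [|right].
have exx : e x = x by apply: e_fix.
rewrite -/(e x) exx in H.
by case: (lt_nle G H); apply: (meet_lel G).
Qed.

Lemma sim_U x y : simD x y -> U x -> U y.
Proof.
move=> xy Ux; have [//|NUy] := pselect (U y).
by rewrite (sim_notU NUy (sim_sym xy)).
Qed.

(** [e x] is at most [e y]. With a root they agree because [E] is an antichain. Without root [e y]
    must be below [x], since otherwise [x] would lie between two elements of the convex set [E], but
    it is outside [E]. *)
Lemma U_le_sim x y : U x -> le I x y -> simD x y.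
Proof.
move=> Ux xy; have [xE H] := Ux; have [yE H'] := U_up Ux xy.
have exy : le I (e x) (e y).
  by apply: e_max => //; [apply: e_E|apply: (le_trans G (e_le x) xy)].
right; split=> //; split=> //.
have [r|r] := pselect rt.
  by left; split=> //; apply: (ext_antichain R r) => //; apply: e_E.
right; split=> //; left.
have NE : ~ E x by case: H.
have eyx : le I (e y) x.
  have [//|xey] := gt_chain G (e_le y) xy.
  by case: NE; apply: (ext_convex R (e_E xE) (e_E yE) (e_le x) xey).
have -> : fn I None x = fn I None y.
  by apply: (le_antisym G) => //; apply: e_max => //; apply: e_E.
split=> //; rewrite (gt_meet_id G) //; split=> // eyE.
by apply: NE; rewrite -eyE; apply: e_E.
Qed.

Lemma leaf_U x : leaf I x -> U x.
Proof.
move=> lx; split; first exact: (ext_leaf_dom R).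
right=> Ex; have : (E `&` leaf I) x by [].
by rewrite (ext_leaf_img R).
Qed.

Lemma U_class x : U x -> exists J0 : interp (symbols 0) {y | simD x y},
  leveled cc J0 /\ forall u v, le J0 u v <-> le I (sval u) (sval v).
Proof.
move=> [xE H].
have [J0 [leJ0 EJ0]] : class_equiv T0 I x.
  have [r|r] := pselect rt; first exact: (ext_class_root R).
  by case: H => // NE; apply: (ext_class_noroot R).
exists J0; split=> //; apply: (@leveled_equiv cc 0 T0 _ T0 J0 (carrier_inhabited T0) LT0 EJ0).
by constructor; exists x; apply: sim_refl.
Qed.

(** The class carries, with the induced order, a good tree elementarily equivalent to [T0]; the meet
    taken there is a common lower bound inside the class. *)
Lemma sim_lower x y : U x -> simD x y ->
  exists z, U z /\ simD x z /\ le I z x /\ le I z y.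
Proof.
move=> Ux xy; have [J0 [[L0 _] leJ0]] := U_class Ux.
have G0 := lt_good L0.
pose x0 : {y | simD x y} := exist (simD x) x (sim_refl x).
pose y0 : {y | simD x y} := exist (simD x) y xy.
exists (sval (meet J0 x0 y0)); split.
  exact: (sim_U (svalP (meet J0 x0 y0)) Ux).
split; first exact: (svalP (meet J0 x0 y0)).
split; first by apply/(leJ0 _ x0); apply: (meet_lel G0).
by apply/(leJ0 _ y0); apply: (meet_ler G0).
Qed.

(** * Levels up to k, read in the quotient *)

Section Quotient.
Variable J : interp (symbols k) (quotient simD).
Hypothesis Q : quotient_structure (T0 := T0) (I := I) T J.

Lemma leveled_quotient : leveled c J.
Proof.
apply: (@leveled_equiv c k T _ T J (carrier_inhabited T) LT (quot_equiv Q)).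
by have [x] := D0; constructor; exact: (pi x).
Qed.

Let LJ : levtree J (level c J) k.+1 c := leveled_quotient.1.
Let SJ : level_symbols (@img_level c k) J (level c J) := leveled_quotient.2.
Let levJ := level c J.
Let GJ : good_tree J := lt_good LJ.

Lemma leJ_le x y : le I x y -> le J (pi x) (pi y).
Proof. by move=> xy; apply/(quot_le Q); exists x, y; split; [|split]; try exact: sim_refl. Qed.

(** The order of the quotient only speaks of some representatives. [x] is alone in its class; if [y]
    is in a copy of [T0], a lower bound [z] of the two representatives in that copy is comparable
    with [x], and cannot be below [x] because [U] is closed upwards. *)
Lemma le_leJ x y : ~ U x -> le J (pi x) (pi y) -> le I x y.
Proof.
move=> NU /(quot_le Q)[x' [y' [/= xx' [yy' xy']]]].
rewrite -(sim_notU NU xx') in xy'.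
have [Uy|NUy] := pselect (U y); last by rewrite (sim_notU NUy yy').
have [z [Uz [_ [zy zy']]]] := sim_lower Uy yy'.
have [xz|zx] := gt_chain G xy' zy'; first exact: (le_trans G xz zy).
by case: NU; apply: U_up Uz zx.
Qed.

Lemma pi_leaf x : leaf J (pi x) <-> U x.
Proof.
split=> [/(leafP GJ) lx|Ux].
  apply: contrapT => NU; have [a /leaf_U Ua xa] := below_leaf G x.
  have /pi_eq := lx _ (leJ_le xa) => /(sim_notU NU) xE.
  by apply: NU; rewrite xE.
apply/(leafP GJ) => C; have [y ->] := pi_onto C.
move=> /(quot_le Q)[x' [y' [/= xx' [yy' xy']]]]; apply/pi_eq.
apply: (sim_trans xx'); apply: (sim_trans (U_le_sim (sim_U xx' Ux) xy')).
exact: sim_sym.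
Qed.

Lemma levJ_U x : U x <-> levJ (pi x) = k.+1.
Proof. by rewrite -pi_leaf; apply: (lt_leaf LJ). Qed.

Lemma levJ_notU x : ~ U x <-> levJ (pi x) <= k.
Proof.
rewrite levJ_U; have := lt_bound LJ (pi x).
rewrite leq_eqVlt ltnS => /orP[/eqP H|H].
  by rewrite /levJ H ltnn.
by rewrite H; split=> // _ H'; move: H; rewrite -/levJ H' ltnn.
Qed.

(** A copy of [T0] is a leaf of the quotient, of level [k.+1]; its nodes keep this level and its
    leaves move to the next one. *)
Let lev x : nat :=
  if `[< U x >] then k.+1 + `[< leaf I x >] else levJ (pi x).

Lemma lev_U x : U x -> lev x = k.+1 + `[< leaf I x >].
Proof. by move=> H; rewrite /lev asboolT. Qed.

Lemma lev_notU x : ~ U x -> lev x = levJ (pi x).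
Proof. by move=> H; rewrite /lev asboolF. Qed.

Lemma lev_low x i : i <= k -> lev x = i <-> levJ (pi x) = i.
Proof.
move=> ik; have [Ux|Ux] := pselect (U x); last by rewrite lev_notU.
rewrite (lev_U Ux) ((levJ_U x).1 Ux).
split=> H; last by rewrite -H ltnn in ik.
by move: ik; rewrite -H leqNgt ltnS leq_addr.
Qed.

Lemma lev_high x : k < lev x <-> U x.
Proof.
have [Ux|Ux] := pselect (U x); first by rewrite lev_U // ltnS leq_addr.
by rewrite lev_notU //; move/levJ_notU: (Ux); rewrite ltnNge => ->.
Qed.

Lemma lev_top x : leaf I x <-> lev x = k.+2.
Proof.
split=> [lx|H]; first by rewrite (lev_U (leaf_U lx)) asboolT // addn1.
have Ux : U x by apply/lev_high; rewrite H ltnW.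
by move: H; rewrite lev_U //; case: asboolP => // _ /eqP; rewrite addn0 ltn_eqF.
Qed.

Lemma lev_mid x : lev x = k.+1 <-> U x /\ ~ leaf I x.
Proof.
split=> [H|[Ux Nl]]; last by rewrite lev_U // asboolF // addn0.
split; first by apply/lev_high; rewrite H.
by move=> /lev_top; rewrite H => /eqP; rewrite ltn_eqF.
Qed.

Lemma lev_le x : lev x <= k.+2.
Proof.
have [Ux|Ux] := pselect (U x); first by rewrite lev_U //; case: asboolP; rewrite ?addn1 ?addn0.
by rewrite lev_notU //; move/levJ_notU: Ux => /leq_trans; apply; rewrite leqW.
Qed.

Lemma lev_levJ_lt x i : i <= k -> i < lev x -> i < levJ (pi x).
Proof.
move=> ik; have [Ux _|Ux] := pselect (U x); last by rewrite lev_notU.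
by rewrite ((levJ_U x).1 Ux).
Qed.

Lemma lev_levJ_le x i : i <= k -> i <= lev x -> i <= levJ (pi x).
Proof.
move=> ik; have [Ux _|Ux] := pselect (U x); last by rewrite lev_notU.
by rewrite ((levJ_U x).1 Ux) leqW.
Qed.

Lemma notU_low x i : i <= k -> lev x = i -> ~ U x.
Proof. by move=> ik lx /lev_high; rewrite lx ltnNge ik. Qed.

Lemma lt_ltJ x y : ~ U x -> lt I x y <-> lt J (pi x) (pi y).
Proof.
move=> NU; split=> [[xy N]|[xy N]].
  by split; [apply: leJ_le|move=> /pi_eq/(sim_notU NU)].
by split; [apply: le_leJ|move=> xE; apply: N; rewrite xE].
Qed.

Lemma inner_innerJ x t : ~ U x -> inner I lev x t <-> inner J levJ (pi x) (pi t).
Proof.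
move=> NU; have xk : levJ (pi x) <= k by apply/levJ_notU.
split=> [[xt [z [xz [zt lz]]]]|[xt [C]]].
  split; first by apply/lt_ltJ.
  exists (pi z); split; first by apply/lt_ltJ.
  split; first exact: leJ_le.
  by apply/(lev_low _ xk); rewrite lz lev_notU.
have [z ->] := pi_onto C; move=> [xz [zt lz]].
have NUz : ~ U z by apply/levJ_notU; rewrite lz.
split; first by apply/lt_ltJ.
exists z; split; first by apply/lt_ltJ.
split; first exact: le_leJ.
by rewrite !lev_notU.
Qed.

Lemma border_borderJ x t : ~ U x -> border I lev x t <-> border J levJ (pi x) (pi t).
Proof.
move=> NU; split=> -[xt N]; split; try by apply/lt_ltJ.
  have xt' : lt J (pi x) (pi t) by apply/lt_ltJ.
  by move=> H; apply: N; have [] := (inner_innerJ t NU).2 (conj xt' H).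
have xt' : lt I x t by apply/lt_ltJ.
by move=> H; apply: N; have [] := (inner_innerJ t NU).1 (conj xt' H).
Qed.

(** A class [w] below those of [t] and [u] must be lifted to a common lower bound. Outside [U] this
    is [w] itself. Otherwise [t] and [u] lie in the same copy, where [sim_lower] provides it. *)
Lemma apart_apartJ x t u : ~ U x -> lt I x t -> lt I x u ->
  apart I x t u <-> apart J (pi x) (pi t) (pi u).
Proof.
move=> NU xt xu; split=> [A|A].
  apply: contrapT => N.
  have xt' : lt J (pi x) (pi t) by apply/lt_ltJ.
  have := napart_lt GJ xt' N; have := meet_lel GJ (pi t) (pi u).
  have := meet_ler GJ (pi t) (pi u).
  have [w ->] := pi_onto (meet J (pi t) (pi u)) => wu wt xw.
  suff [m [xm [mt mu]]] : exists m, lt I x m /\ le I m t /\ le I m u.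
    by case: (lt_nle G xm); apply: (le_trans G _ A); apply: (meet_glb G).
  have [Uw|NUw] := pselect (U w); last first.
    by exists w; split; [apply/lt_ltJ|split; apply: le_leJ].
  have lw := (leafP GJ _).1 ((pi_leaf w).2 Uw).
  have wt' : simD w t by apply/pi_eq; apply: lw.
  have wu' : simD w u by apply/pi_eq; apply: lw.
  have Ut := sim_U wt' Uw.
  have [m [Um [_ [mt mu]]]] := sim_lower Ut (sim_trans (sim_sym wt') wu').
  exists m; split=> //; apply: (nle_lt G mt xt.1) => mx.
  by apply: NU; apply: U_up Um mx.
apply: contrapT => N; have xm := napart_lt G xt N.
have := (lt_ltJ _ NU).1 xm => /(lt_nle GJ); apply; apply: (le_trans GJ _ A).
by apply: (meet_glb GJ); apply: leJ_le; [apply: (meet_lel G)|apply: (meet_ler G)].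
Qed.

(** Representatives in one direction and [pi] in the other turn families of pairwise apart elements
    into such families, so the counts agree. *)
Lemma exactly_quotient x i m : i <= k -> lev x = i ->
  (exactly (border J levJ (pi x)) (apart J (pi x)) m ->
   exactly (border I lev x) (apart I x) m) /\
  (exactly (inner J levJ (pi x)) (apart J (pi x)) m ->
   exactly (inner I lev x) (apart I x) m).
Proof.
move=> ik /(notU_low ik) NU.
have [s Hs] := choice pi_onto.
split; apply: exactly_iff => r; split.
- apply: (at_least_mono (f := s)) => [C|C C'].
    by rewrite {1}[C]Hs => /(border_borderJ _ NU).
  rewrite {1}[C]Hs {1}[C']Hs => /(border_borderJ _ NU)[xC _] /(border_borderJ _ NU)[xC' _].
  by rewrite {1}[C]Hs {1}[C']Hs => /(apart_apartJ NU xC xC').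
- apply: (at_least_mono (f := pi)) => [t|t u [xt _] [xu _]].
    by move/(border_borderJ _ NU).
  by move/(apart_apartJ NU xt xu).
- apply: (at_least_mono (f := s)) => [C|C C'].
    by rewrite {1}[C]Hs => /(inner_innerJ _ NU).
  rewrite {1}[C]Hs {1}[C']Hs => /(inner_innerJ _ NU)[xC _] /(inner_innerJ _ NU)[xC' _].
  by rewrite {1}[C]Hs {1}[C']Hs => /(apart_apartJ NU xC xC').
- apply: (at_least_mono (f := pi)) => [t|t u [xt _] [xu _]].
    by move/(inner_innerJ _ NU).
  by move/(apart_apartJ NU xt xu).
Qed.

Lemma top_quotient i x y : i <= k -> top_at J levJ i (pi x) (pi y) ->
  top_at I lev i x y.
Proof.
move=> ik [yx [ly Hy]].
have NUy : ~ U y by apply/levJ_notU; rewrite ly.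
split; first exact: le_leJ.
split=> [|z zx /[dup] lz /(lev_low _ ik) lzJ]; first by apply/lev_low.
apply: le_leJ; first exact: notU_low ik lz.
by apply: Hy => //; apply: leJ_le.
Qed.

(** * Level k+1, read in a copy of T0 *)

Section Fiber.
Variable x : D.
Hypothesis Ux : U x.
Variable J0 : interp (symbols 0) {y | simD x y}.
Hypotheses (L0 : levtree J0 (level cc J0) 1 cc)
  (leJ0 : forall u v, le J0 u v <-> le I (sval u) (sval v)).
Let G0 : good_tree J0 := lt_good L0.
Implicit Types u v w : {y | simD x y}.

Lemma fiber_U u : U (sval u).
Proof. exact: (sim_U (svalP u) Ux). Qed.

Lemma sval_inj (u v : {y | simD x y}) : sval u = sval v -> u = v.
Proof. by case: u v => [a Ha] [b Hb] /= ab; apply: eq_exist. Qed.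

Lemma fiber_lt u v : lt J0 u v <-> lt I (sval u) (sval v).
Proof.
split=> -[uv N]; split; try exact/leJ0.
  by move=> uE; apply: N; apply: sval_inj.
by move=> uE; apply: N; rewrite uE.
Qed.

Lemma fiber_above (u : {y | simD x y}) y : le I (sval u) y ->
  exists2 v : {y | simD x y}, sval v = y & le J0 u v.
Proof.
move=> uy; have xy := sim_trans (svalP u) (U_le_sim (fiber_U u) uy).
by exists (exist (simD x) y xy) => //; apply/leJ0.
Qed.

Lemma fiber_below (u : {y | simD x y}) y : U y -> le I y (sval u) ->
  exists2 v : {y | simD x y}, sval v = y & le J0 v u.
Proof.
move=> Uy yu; have xy := sim_trans (svalP u) (sim_sym (U_le_sim Uy yu)).
by exists (exist (simD x) y xy) => //; apply/leJ0.
Qed.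

Lemma fiber_leaf u : leaf J0 u <-> leaf I (sval u).
Proof.
rewrite (leafP G0) (leafP G); split=> m.
  by move=> y /fiber_above[v <- /m ->].
by move=> v /leJ0/m/sval_inj.
Qed.

Lemma fiber_lev u : lev (sval u) = k.+1 + level cc J0 u.
Proof.
rewrite (lev_U (fiber_U u)); congr addn.
have := lt_bound L0 u; have := lt_leaf L0 u; rewrite fiber_leaf.
case: asboolP; first by move=> /[swap] -[H _] /H ->.
by case: (level cc J0 u) => [|[|m]] // N [_ H]; case: N; apply: H.
Qed.

(** A copy is closed upwards, so the meet in the whole tree, being above the meet of the copy,
    belongs to the copy as well. *)
Lemma fiber_meet u v : sval (meet J0 u v) = meet I (sval u) (sval v).
Proof.
have mU : le I (sval (meet J0 u v)) (meet I (sval u) (sval v)).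
  by apply: (meet_glb G); apply/leJ0; [apply: (meet_lel G0)|apply: (meet_ler G0)].
have [w wE _] := fiber_above mU.
apply: (le_antisym G) => //; rewrite -wE; apply/leJ0.
by apply: (meet_glb G0); apply/leJ0; rewrite wE; [apply: (meet_lel G)|apply: (meet_ler G)].
Qed.

Lemma fiber_inner u v : inner J0 (level cc J0) u v <-> inner I lev (sval u) (sval v).
Proof.
split=> [[uv [z [uz [zv lz]]]]|[uv [z [uz [zv lz]]]]].
  split; first exact/fiber_lt.
  exists (sval z); split; first exact/fiber_lt.
  by split; [apply/leJ0|rewrite !fiber_lev lz].
split; first exact/fiber_lt.
have [w wE _] := fiber_above uz.1.
exists w; split; first by apply/fiber_lt; rewrite wE.
split; first by apply/leJ0; rewrite wE.
by apply: (@addnI k.+1); rewrite -!fiber_lev wE.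
Qed.

Lemma fiber_border u v : border J0 (level cc J0) u v <-> border I lev (sval u) (sval v).
Proof.
split=> -[uv N]; split; try exact/fiber_lt.
  have uv' : lt I (sval u) (sval v) by apply/fiber_lt.
  by move=> H; apply: N; have [] := (fiber_inner u v).2 (conj uv' H).
have uv' : lt J0 u v by apply/fiber_lt.
by move=> H; apply: N; have [] := (fiber_inner u v).1 (conj uv' H).
Qed.

Lemma fiber_apart u v w : apart J0 u v w <-> apart I (sval u) (sval v) (sval w).
Proof. by rewrite /apart leJ0 fiber_meet. Qed.

Let x0 : {y | simD x y} := exist (simD x) x (sim_refl x).

Lemma exactly_fiber m :
  (exactly (border J0 (level cc J0) x0) (apart J0 x0) m ->
   exactly (border I lev x) (apart I x) m) /\
  (exactly (inner J0 (level cc J0) x0) (apart J0 x0) m ->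
   exactly (inner I lev x) (apart I x) m).
Proof.
(* The elements above [x] all belong to its class and are taken as they are; elsewhere [x0] is a
   default value. *)
have /choice[s Hs] : forall t, exists v : {y | simD x y}, lt I x t -> sval v = t.
  move=> t; have [xt|N] := pselect (lt I x t); last by exists x0.
  by have [v vE _] := @fiber_above x0 t xt.1; exists v.
split; apply: exactly_iff => r; split.
- apply: (at_least_mono (f := sval)) => [t|t u _ _]; first by move/fiber_border.
  by move/fiber_apart.
- apply: (at_least_mono (f := s)) => [t B|t u [xt _] [xu _] A].
    by apply/fiber_border; rewrite Hs //; case: B.
  by apply/fiber_apart; rewrite !Hs.
- apply: (at_least_mono (f := sval)) => [t|t u _ _]; first by move/fiber_inner.
  by move/fiber_apart.
- apply: (at_least_mono (f := s)) => [t B|t u [xt _] [xu _] A].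
    by apply/fiber_inner; rewrite Hs //; case: B.
  by apply/fiber_apart; rewrite !Hs.
Qed.

End Fiber.

(** Each axiom about levels splits at [k.+1]: for smaller levels it is read in the quotient, at
    [k.+1] in the copy of [T0] containing the element. *)
Lemma levtree_step : levtree I lev k.+2 c.
Proof.
split.
- exact: G.
- move=> x y xy; have [Ux|NUx] := pselect (U x).
    have Uy := U_up Ux xy; rewrite !lev_U // leq_add2l.
    case: asboolP => // lx; case: asboolP => // ny.
    by case: ny; rewrite -((leafP G x).1 lx _ xy).
  have := lt_mono LJ (leJ_le xy); rewrite (lev_notU NUx).
  have [Uy _|NUy] := pselect (U y); last by rewrite lev_notU.
  move/levJ_notU: NUx => /leq_trans; apply; rewrite lev_U //.
  exact: leq_trans (leqnSn k) (leq_addr _ _).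
- exact: lev_top.
- exact: lev_le.
- move=> i x ix; have [ik|] := leqP i k.
    have [C [Cx lC]] := @lt_ex _ _ _ _ _ _ LJ i (pi x) (lev_levJ_le ik ix).
    move: Cx lC; have [y ->] := pi_onto C => yx ly; exists y.
    split; last exact/lev_low.
    by apply: le_leJ => //; apply/levJ_notU; rewrite /levJ ly.
  rewrite leq_eqVlt => /orP[/eqP iE|ki]; last first.
    exists x; split; first exact: (le_refl G).
    apply/eqP; rewrite eqn_leq ix andbT; exact: leq_trans (lev_le x) ki.
  have Ux : U x by apply/lev_high; rewrite iE.
  have [lx|nx] := pselect (leaf I x); last first.
    exists x; split; first exact: (le_refl G).
    by rewrite -iE; apply/lev_mid.
  have [J0 [[L0 _] leJ0]] := U_class Ux.
  have [u [ux lu]] := @lt_ex _ _ _ _ _ _ L0 0 (exist (simD x) x (sim_refl x)) (leq0n _).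
  exists (sval u); split; first exact: (leJ0 _ _).1 ux.
  by rewrite (fiber_lev Ux L0 leJ0) lu addn0.
- move=> i x; rewrite ltnS leq_eqVlt => /orP[/eqP ->|ik] ci ix; last first.
    have [C tC] := lt_top LJ ik ci (lev_levJ_lt ik ix).
    move: tC; have [y ->] := pi_onto C => ty.
    by exists y; apply: top_quotient.
  have Ux : U x by apply/lev_high; apply: ltn_trans ix.
  have [J0 [[L0 _] leJ0]] := U_class Ux.
  have [|v tv] := lt_top L0 (ltn0Sn 0) ci (x := exist (simD x) x (sim_refl x)).
    move: ix; rewrite -[x in lev x]/(sval (exist (simD x) x (sim_refl x))).
    by rewrite (fiber_lev Ux L0 leJ0) -[X in X < _]addn0 ltn_add2l.
  have [vx [lv Hv]] := tv.
  exists (sval v); split; first exact: (leJ0 _ _).1 vx.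
  split=> [|z zx lz]; first by rewrite (fiber_lev Ux L0 leJ0) lv addn0.
  have Uz : U z by apply/lev_high; rewrite lz.
  have [w wE wx] := fiber_below leJ0 (u := exist (simD x) x (sim_refl x)) Uz zx.
  rewrite -wE; apply/leJ0; apply: Hv => //.
  by apply: (@addnI k.+1); rewrite -(fiber_lev Ux L0 leJ0) wE lz addn0.
- move=> i x; rewrite ltnS leq_eqVlt => /orP[/eqP ->|ik] ci lx; last first.
    have lx' : levJ (pi x) = i by apply/lev_low.
    have [C [Cx lC]] := lt_nofirst LJ ik ci lx'.
    move: Cx lC; have [y ->] := pi_onto C => yx ly.
    have NUy : ~ U y by apply/levJ_notU; rewrite /levJ ly.
    by exists y; split; [apply/lt_ltJ|apply/lev_low].
  have [Ux nx] := (lev_mid x).1 lx.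
  have [J0 [[L0 _] leJ0]] := U_class Ux.
  have [|v [vx lv]] := lt_nofirst L0 (ltn0Sn 0) ci (x := exist (simD x) x (sim_refl x)).
    by apply: (@addnI k.+1); rewrite -(fiber_lev Ux L0 leJ0) /= lx addn0.
  exists (sval v); split; first by have := (fiber_lt leJ0 _ _).1 vx.
  by rewrite (fiber_lev Ux L0 leJ0) lv addn0.
- move=> x y xy lxy; have [Ux|NUx] := pselect (U x).
    have Uy := U_up Ux xy.1.
    have [J0 [[L0 _] leJ0]] := U_class Ux.
    have [v vE xv] := fiber_above Ux leJ0 (u := exist (simD x) x (sim_refl x)) xy.1.
    have [||z [xz zv]] := lt_dense L0 (x := exist (simD x) x (sim_refl x)) (y := v).
    + by apply/(fiber_lt leJ0); rewrite vE.
    + by apply: (@addnI k.+1); rewrite -!(fiber_lev Ux L0 leJ0) vE.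
    exists (sval z); rewrite -vE; split; first by have := (fiber_lt leJ0 _ _).1 xz.
    exact/(fiber_lt leJ0).
  have xk : levJ (pi x) <= k by apply/levJ_notU.
  have lyx : levJ (pi y) = levJ (pi x).
    by apply/(lev_low _ xk); rewrite -lxy lev_notU.
  have [C []] := lt_dense LJ ((lt_ltJ _ NUx).1 xy) (esym lyx).
  have [z ->] := pi_onto C => xz zy.
  have NUz : ~ U z.
    apply/levJ_notU; apply: leq_trans xk; rewrite -lyx.
    exact: (lt_mono LJ zy.1).
  by exists z; split; apply/lt_ltJ.
- move=> i x; rewrite ltnS leq_eqVlt => /orP[/eqP ->|ik] lx; last first.
    apply: (exactly_quotient _ ik lx).1; apply: (lt_border LJ) => //.
    exact/lev_low.
  have [Ux nx] := (lev_mid x).1 lx.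
  have [J0 [[L0 _] leJ0]] := U_class Ux.
  apply: (exactly_fiber Ux L0 leJ0 _).1; apply: (lt_border L0 (i := 0)) => //.
  by apply: (@addnI k.+1); rewrite -(fiber_lev Ux L0 leJ0) /= lx addn0.
- move=> i x; rewrite ltnS leq_eqVlt => /orP[/eqP ->|ik] lx; last first.
    apply: (exactly_quotient _ ik lx).2; apply: (lt_inner LJ) => //.
    exact/lev_low.
  have [Ux nx] := (lev_mid x).1 lx.
  have [J0 [[L0 _] leJ0]] := U_class Ux.
  apply: (exactly_fiber Ux L0 leJ0 _).2; apply: (lt_inner L0 (i := 0)) => //.
  by apply: (@addnI k.+1); rewrite -(fiber_lev Ux L0 leJ0) /= lx addn0.
Qed.

(** * The symbols of the extension in terms of its levels *)

Let LI : levtree I lev k.+2 c := levtree_step.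

Let cc0 : cc 0 = c k.+1. Proof. by []. Qed.

Lemma rootP : rt <-> (c k.+1).2 = Some 0.
Proof. exact: (root_color LT0). Qed.

Lemma img_level_None : img_level c (None : symbols k.+1) =
  if `[< rt >] then k.+1 else k.
Proof.
rewrite /img_level /=; case: asboolP => [/rootP->|N]; first by rewrite eqxx.
by case: eqP => // /rootP.
Qed.

Lemma img_level_Some f : img_level c (Some f : symbols k.+1) = img_level c f.
Proof. by []. Qed.

Lemma img_level_leq (f : symbols k) : img_level c f <= k.
Proof.
rewrite /img_level; case: ifP => _; first exact: idx_leq.
exact: leq_trans (leq_pred _) (idx_leq f).
Qed.

Lemma leaf_predsJ : ~ rt -> leaf_preds J = [set C | levJ C = k].
Proof.
move=> nr; have [Hiso _] := quot_pred Q nr.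
have ck : (c k).1 <> Some 0.
  have [x] := D0; have [a la _] := below_leaf GJ (pi x).
  have [_ [C]] := Hiso a la; move=> /(is_predP LJ)[la' [_ []]].
  by move: la' => /eqP; rewrite ((lt_leaf LJ a).1 la) eqSS => /eqP <-.
exact: leaf_preds_level leveled_quotient ck.
Qed.

(** With a root, a node [x] of a copy outside [E] would have [e x] strictly below it on the same
    level, hence in an inner cone, which the color of [T0] forbids. Without root, [E] corresponds to
    the predecessors of the leaves of the quotient, which form level [k]. *)
Lemma E_level x : E x <-> lev x = img_level c (None : symbols k.+1).
Proof.
rewrite img_level_None; case: asboolP => r.
  rewrite lev_mid; split=> [Ex|[Ux nx]].
    split; first by split; [apply: E_Ege|left].
    move=> lx; have : (E `&` leaf I) x by [].
    by rewrite (ext_leaf_img R).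
  have [xE _] := Ux; apply: contrapT => NE.
  have ex : lt I (e x) x.
    by split=> [|exE]; [apply: e_le|apply: NE; rewrite -exE; apply: e_E].
  have Uex : U (e x) by split; [apply/E_Ege/e_E|left].
  have le : lev (e x) = k.+1.
    by apply/lev_mid; split=> // /(leafP G)/(_ _ ex.1); case: ex.
  have len : lev (e x) < k.+2 by rewrite le.
  have /(inner_nonzero LI len) : inner I lev (e x) x.
    split=> //; exists x; split=> //; split; first exact: (le_refl G).
    by rewrite le; apply/lev_mid.
  by rewrite le; case; apply/rootP.
have [_ imE] := quot_pred Q r; rewrite (leaf_predsJ r) in imE.
rewrite (lev_low _ (leqnn k)); split=> [Ex|lx].
  have : (class simD @` E) (pi x) by exists x.
  by rewrite imE.
have : [set C | levJ C = k] (pi x) by [].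
rewrite -imE => -[y Ey /pi_eq/sim_sym xy].
by rewrite (sim_notU _ xy) //; apply/levJ_notU; rewrite lx.
Qed.

Lemma Ege_level x : Ege x <-> img_level c (None : symbols k.+1) <= lev x.
Proof.
rewrite /Ege (ext_dom R); split=> [[y /E_level <-]|]; first exact: (lt_mono LI).
by move=> /(lt_ex LI)[y [yx /E_level Ey]]; exists y.
Qed.

Lemma img_Some f x : fimg I (Some f) x <-> lev x = img_level c f.
Proof. by rewrite (lev_low _ (img_level_leq f)) (quot_img Q) (ls_img SJ). Qed.

Lemma dom_Some f x : fdom I (Some f) x <-> img_level c f <= lev x.
Proof.
rewrite (star_dom (quot_star Q f)); split=> [[y /img_Some <-]|].
  exact: (lt_mono LI).
by move=> /(lt_ex LI)[y [yx /img_Some Ey]]; exists y.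
Qed.

Lemma fn_Some_low f x : ((~` Ege) `|` E) x -> img_level c f <= lev x ->
  top_at J levJ (img_level c f) (pi x) (pi (fn I (Some f) x)).
Proof.
move=> Hx hx; have [[_ fE] _] := quot_fn Q Hx ((dom_Some f x).2 hx).
rewrite /pi fE; apply/(ls_fn SJ) => //.
exact: (lev_levJ_le (img_level_leq f) hx).
Qed.

Lemma fn_Some f x : img_level c f <= lev x ->
  top_at I lev (img_level c f) x (fn I (Some f) x).
Proof.
move=> hx; have hk := img_level_leq f.
have [xE|xE] := pselect (Ege x); last first.
  by apply: top_quotient => //; apply: fn_Some_low => //; left.
rewrite (quot_fn_ge Q f xE).
have Ee : E (e x) by apply: e_E.
have le : img_level c f <= lev (e x).
  by rewrite ((E_level _).1 Ee) img_level_None; case: asboolP => _ //; apply: leqW.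
have tJ := fn_Some_low (or_intror Ee) le.
have [r|r] := pselect rt.
  have Ue : U (e x) by split; [apply: E_Ege|left].
  by apply: top_quotient => //; rewrite -((pi_eq _ _).2 (U_le_sim Ue (e_le x))).
have te := top_quotient hk tJ.
(* Here [e x] has level [k]. A last element of smaller level below [e x] is also last below [x]; if
   the level of [f] is [k], the value is [e x] itself. *)
move: le; rewrite leq_eqVlt => /orP[/eqP hE|]; last first.
  exact: (top_at_extend LI te (e_le x)).
have -> : fn I (Some f) (e x) = e x.
  by apply: (top_at_inj LI te); rewrite hE; apply: (top_at_self LI).
rewrite hE; split; first exact: e_le.
split=> // z zx lz; apply: e_max => //; apply/E_level.
by rewrite lz; apply/E_level.
Qed.

Lemma symbols_step : level_symbols (@img_level c k.+1) I lev.
Proof.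
split=> -[f|] x; rewrite ?img_level_Some.
- exact: img_Some.
- exact: E_level.
- exact: dom_Some.
- exact: Ege_level.
- move=> xh; apply: (star_out (quot_star Q f)) => /dom_Some.
  by rewrite leqNgt xh.
- by move=> xh; apply: (ext_out R) => /Ege_level; rewrite leqNgt xh.
- move=> y hx; have tx := fn_Some hx; split=> [->//|ty].
  exact: (top_at_inj LI ty tx).
- move=> y /Ege_level xE.
  have tx : top_at I lev (img_level c (None : symbols k.+1)) x (e x).
    split; first exact: e_le.
    split=> [|z zx /E_level Ez]; first by apply/E_level/e_E.
    exact: e_max.
  by split=> [->//|ty]; apply: (top_at_inj LI ty tx).
Qed.

End Quotient.

Lemma leveled_step : leveled c I.
Proof.
have [J Q] := ext_quotient R.
exact: leveledI (levtree_step Q) (symbols_step Q).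
Qed.

End Step.

(** * Existence of 1-colored trees *)

Definition label (m : enat) : Set :=
  if m is Some k then {i : nat | i < k} else nat.

Lemma has_card_eq T T' (A : set T) (B : set T') m :
  A #= B -> has_card A m -> has_card B m.
Proof.
case: m => [m|] /= AB; first by rewrite card_eq_sym in AB; apply: card_eq_trans.
by move=> HA HB; apply: HA; rewrite (eq_finite_set AB).
Qed.

Lemma has_card_label m : has_card [set: label m] m.
Proof.
case: m => [k|] /=; last exact: infinite_nat.
rewrite card_eq_sym.
have : sval @` [set: {i : nat | i < k}] #= [set: {i : nat | i < k}].
  by apply: inj_card_eq => -[i ik] [j jk] _ _ /= ij; apply: eq_exist.
suff -> : sval @` [set: {i : nat | i < k}] = `I_k by [].
apply/seteqP; split=> [i [[j jk] _ <-]//|i ik].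
by exists (exist (fun i => i < k) i ik).
Qed.

Lemma has_card_range T m (g : label m -> T) :
  injective g -> has_card (g @` setT) m.
Proof.
move=> gI; apply: (has_card_eq _ (has_card_label m)).
by rewrite card_eq_sym; apply: inj_card_eq => i j _ _; apply: gI.
Qed.

(** * Trees of finitely supported functions on initial segments *)

Section Cuts.
Variables (Q : Set) (q0 : Q) (ltQ : Q -> Q -> Prop).
Hypothesis ltQ_irr : forall p, ~ ltQ p p.
Hypothesis ltQ_trans : forall p q r, ltQ p q -> ltQ q r -> ltQ p r.
Hypothesis ltQ_total : forall p q, [\/ ltQ p q, p = q | ltQ q p].
Hypothesis ltQ_dense : forall p q, ltQ p q -> exists r, ltQ p r /\ ltQ r q.
Hypothesis ltQ_max : forall p, exists q, ltQ p q.
Hypothesis ltQ_min : forall p, exists q, ltQ q p.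
Variables (K : Set) (k0 : K) (tops : bool).

(** A height [Some q] stands for the initial segment below [q], and [None] for the whole of [Q]. *)
Definition below (p : Q) (h : option Q) : Prop := if h is Some q then ltQ p q else True.
Definition le_height (h h' : option Q) : Prop := forall p, below p h -> below p h'.

(* Functions of finite support defined on an initial segment of Q, extended by
   k0; the ones defined on all of Q are kept when [tops] is true. *)
Definition cut : Set := {x : (Q -> K) * option Q |
  (exists s : seq Q, forall p, x.1 p <> k0 -> List.In p s) /\
  (forall p, ~ below p x.2 -> x.1 p = k0) /\ (x.2 = None -> tops)}.

Definition val_at (x : cut) := (sval x).1.
Definition height (x : cut) := (sval x).2.

Definition cut_le (x y : cut) : Prop :=
  le_height (height x) (height y) /\
  forall p, below p (height x) -> val_at x p = val_at y p.

Lemma height_inj h h' : le_height h h' -> le_height h' h -> h = h'.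
Proof.
case: h h' => [p|] [q|] //= H1 H2.
- by case: (ltQ_total p q) => [/H2|->|/H1] // /ltQ_irr.
- by case: (@ltQ_irr p (H2 p I)).
- by case: (@ltQ_irr q (H1 q I)).
Qed.

Lemma height_total h h' : le_height h h' \/ le_height h' h.
Proof.
case: h h' => [p|] [q|] //=; [|by left|by right|by left].
case: (ltQ_total p q) => [pq|->|qp].
- by left=> r /= rp; apply: ltQ_trans rp pq.
- by left.
- by right=> r /= rq; apply: ltQ_trans rq qp.
Qed.

Lemma below_le p h : below p h -> le_height (Some p) h.
Proof. by case: h => //= q pq r /= rp; apply: ltQ_trans pq. Qed.

Lemma nbelow_le p h : ~ below p h -> le_height h (Some p).
Proof. by case: h => [q|] /= N; [move=> r rq /=; case: (ltQ_total q p) => [|<-//|//]; exact: ltQ_trans|case: N]. Qed.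

Lemma cut_eq x y : height x = height y -> (forall p, val_at x p = val_at y p) -> x = y.
Proof.
case: x y => [[f h] Hx] [[g h'] Hy] /= E H; apply: eq_exist.
by congr pair; [apply: funext|].
Qed.

Lemma cut_out x p : ~ below p (height x) -> val_at x p = k0.
Proof. by case: x => [x [H1 [H2 H3]]]; apply: H2. Qed.

Lemma cut_refl x : cut_le x x. Proof. by split. Qed.

Lemma cut_anti x y : cut_le x y -> cut_le y x -> x = y.
Proof.
move=> [hxy H] [hyx H']; have E := height_inj hxy hyx.
apply: cut_eq => // p.
have [b|b] := pselect (below p (height x)); first exact: H.
by rewrite !cut_out // -E.
Qed.

Lemma cut_trans x y z : cut_le x y -> cut_le y z -> cut_le x z.
Proof.
move=> [h1 H1] [h2 H2]; split=> [p /h1/h2//|p b].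
by rewrite H1 // H2 //; apply: h1.
Qed.

Lemma cut_chain x y z : cut_le y x -> cut_le z x -> cut_le y z \/ cut_le z y.
Proof.
move=> [h1 H1] [h2 H2]; case: (height_total (height y) (height z)) => h; [left|right].
  by split=> // p b; rewrite H1 // H2 //; apply: h.
by split=> // p b; rewrite H2 // H1 //; apply: h.
Qed.

Lemma cut_truncate x p : below p (height x) ->
  exists y, height y = Some p /\ cut_le y x.
Proof.
move=> b; have [s Hs] := (svalP x).1.
have H : (exists s : seq Q, forall q, (if `[< ltQ q p >] then val_at x q else k0) <> k0 ->
    List.In q s) /\ (forall q, ~ below q (Some p) ->
    (if `[< ltQ q p >] then val_at x q else k0) = k0) /\ (Some p = None -> tops).
  split; first by exists s => q; case: asboolP => // _ /Hs.
  by split=> // q /= N; rewrite asboolF.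
exists (exist _ (fun q => if `[< ltQ q p >] then val_at x q else k0, Some p) H).
split=> //; split; first exact: below_le.
by move=> q /= qp; rewrite /val_at /= asboolT.
Qed.

(** Finite supports leave only finitely many places where [x] and [y] can differ, so there is a
    first one. *)
Lemma min_diff x y : (exists p, below p (height x) /\ val_at x p <> val_at y p) ->
  exists p, below p (height x) /\ val_at x p <> val_at y p /\
    forall q, ltQ q p -> val_at x q = val_at y q.
Proof.
move=> [p0 [b0 N0]]; have [s Hs] := (svalP x).1; have [s' Hs'] := (svalP y).1.
have Hin p : val_at x p <> val_at y p -> List.In p (s ++ s').
  move=> N; apply/List.in_app_iff; have [E|/Hs] := pselect (val_at x p = k0); last by left.
  by right; apply: Hs' => E'; apply: N; rewrite E.
suff [p [bp [Np Hp]]] : exists p, below p (height x) /\ val_at x p <> val_at y p /\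
    forall q, List.In q (s ++ s') -> ltQ q p -> val_at x q = val_at y q.
  exists p; split=> //; split=> // q qp; apply: contrapT => N.
  exact: (N (Hp q (Hin q N) qp)).
elim: (s ++ s') => [|q u [p [bp [Np Hp]]]]; first by exists p0.
have [[qp Nq]|N] := pselect (ltQ q p /\ val_at x q <> val_at y q).
  exists q; split; first exact: (below_le bp).
  split=> // r [<- /ltQ_irr//|ru rq]; apply: Hp => //; exact: ltQ_trans qp.
exists p; split=> //; split=> // r [<- qp|ru]; last exact: Hp.
by apply: contrapT => Nq; apply: N.
Qed.

(** Both functions are truncated at the first place where they differ; if they do not differ up to
    the smaller height, the lower one is the meet. The last clause keeps the difference at the
    height of the meet, which tells cones apart. *)
Lemma cut_meet_ex x y : exists m, cut_le m x /\ cut_le m y /\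
  (forall z, cut_le z x -> cut_le z y -> cut_le z m) /\
  [\/ m = x, m = y | exists2 p, height m = Some p & val_at x p <> val_at y p].
Proof.
wlog h : x y / le_height (height x) (height y).
  move=> W; case: (height_total (height x) (height y)) => h; first exact: W.
  have [m [mx [my [H H']]]] := W y x h; exists m; split=> //; split=> //.
  split; first by move=> z zx zy; apply: H.
  case: H' => [->|->|[p hp N]]; [by constructor 2|by constructor 1|constructor 3].
  by exists p => // E; apply: N.
have [D|A] := pselect (exists p, below p (height x) /\ val_at x p <> val_at y p); last first.
  exists x; split; first exact: cut_refl.
  split; last by split=> //; constructor 1.
  by split=> // p b; apply: contrapT => N; apply: A; exists p.
have [p [bp [Np Hp]]] := min_diff D.
have [m [hm mx]] := cut_truncate bp.
exists m; split=> //; split.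
  split; first by move=> q /(mx.1)/h.
  by move=> q b; rewrite mx.2 //; apply: Hp; rewrite hm in b.
split; last by constructor 3; exists p.
move=> z zx zy; have hz : le_height (height z) (height m).
  rewrite hm; apply: nbelow_le => b; apply: Np.
  by rewrite -zx.2 // zy.2.
by split=> // q b; rewrite zx.2 // mx.2 //; apply: hz.
Qed.

Definition cut_meet x y : cut := sval (cid (cut_meet_ex x y)).

Lemma cut_meetP x y : cut_le (cut_meet x y) x /\ cut_le (cut_meet x y) y /\
  (forall z, cut_le z x -> cut_le z y -> cut_le z (cut_meet x y)) /\
  [\/ cut_meet x y = x, cut_meet x y = y |
     exists2 p, height (cut_meet x y) = Some p & val_at x p <> val_at y p].
Proof. by rewrite /cut_meet; case: cid. Qed.

Definition cut_lt x y := cut_le x y /\ x <> y.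

(* The cone of y above the node x is determined by the value of y at the
   height of x. *)
Definition branch (x y : cut) : K := if height x is Some p then val_at y p else k0.

Lemma cut_lt_below x y p : height x = Some p -> cut_lt x y -> below p (height y).
Proof.
move=> hx [[h H] N]; apply: contrapT => /nbelow_le h'; apply: N.
by apply: cut_anti => //; split; [rewrite hx|move=> q b; apply/esym/H; rewrite hx; exact: h'].
Qed.

Lemma below_cut_lt x y p : height x = Some p -> cut_le x y -> below p (height y) -> cut_lt x y.
Proof. by move=> hx xy b; split=> // E; rewrite -E hx /= in b; apply: ltQ_irr b. Qed.

Lemma branch_meet x y z : height x <> None -> cut_lt x y -> cut_lt x z ->
  cut_lt x (cut_meet y z) <-> branch x y = branch x z.
Proof.
case hx: (height x) => [p|] // _ xy xz; rewrite /branch hx.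
have [my [mz [H Hm]]] := cut_meetP y z; split=> [xm|E].
  have b := cut_lt_below hx xm.
  by rewrite -my.2 // mz.2.
split; first by apply: H; [case: xy|case: xz].
move=> xm; case: Hm; rewrite -xm.
- by move=> E'; apply: xy.2.
- by move=> E'; apply: xz.2.
- by rewrite hx => -[q [<-]].
Qed.

(** Give the function the value [k] at the height [p] of [x] and end it at some [q] above [p]. *)
Lemma branch_onto x (k : K) : height x <> None ->
  exists y, height y <> None /\ cut_lt x y /\ branch x y = k.
Proof.
case hx: (height x) => [p|] // _; have [q pq] := ltQ_max p.
have [s Hs] := (svalP x).1.
have H : (exists s : seq Q, forall r, (if `[< r = p >] then k else val_at x r) <> k0 ->
    List.In r s) /\ (forall r, ~ below r (Some q) ->
    (if `[< r = p >] then k else val_at x r) = k0) /\ (Some q = None -> tops).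
  split; first by exists (p :: s) => r; case: asboolP => [->|_ /Hs]; [left|right].
  split=> // r /= N; case: asboolP => [E|_]; first by rewrite E in N.
  by apply: cut_out; rewrite hx /= => rp; apply: N; apply: ltQ_trans pq.
exists (exist _ (fun r => if `[< r = p >] then k else val_at x r, Some q) H).
split=> //; split; last by rewrite /branch hx /val_at /= asboolT.
apply: (below_cut_lt hx) => //; split; first by rewrite hx; apply: below_le.
move=> r; rewrite hx /= => rp; rewrite /val_at /= asboolF // => E.
by rewrite E in rp; apply: ltQ_irr rp.
Qed.

Lemma cut_dense x y : cut_lt x y -> exists z, height z <> None /\ cut_lt x z /\ cut_lt z y.
Proof.
move=> xy; have hx : exists p, height x = Some p.
  case hx: (height x) => [p|]; first by exists p.
  case: xy => [[h H]] []; apply: cut_eq; last by move=> p; apply: H; rewrite hx.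
  by apply: height_inj => //; rewrite hx.
have [p hp] := hx; have b := cut_lt_below hp xy.
have [q [pq bq]] : exists q, ltQ p q /\ below q (height y).
  by case: (height y) b => [r /ltQ_dense//|_]; have [q pq] := ltQ_max p; exists q.
have [z [hz zy]] := cut_truncate bq.
exists z; rewrite hz; split=> //; split; last exact: below_cut_lt zy bq.
apply: (below_cut_lt hp); last by rewrite hz.
have [xz|zx] := cut_chain xy.1 zy => //.
by have := zx.1 p; rewrite hz hp => /(_ pq)/ltQ_irr.
Qed.

Lemma cut_nofirst x : exists y, height y <> None /\ cut_lt y x.
Proof.
have [p b] : exists p, below p (height x).
  by case: (height x) => [r|]; [exact: ltQ_min|exists q0].
have [y [hy yx]] := cut_truncate b.
by exists y; rewrite hy; split=> //; apply: below_cut_lt yx b.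
Qed.

End Cuts.

(** The part of [good_tree] that does not speak of leaves and nodes: a tree of cuts without total
    functions has no leaf. *)
Record meet_tree F D (I : interp F D) : Prop := MeetTree {
  mt_refl : forall x, le I x x;
  mt_antisym : forall x y, le I x y -> le I y x -> x = y;
  mt_trans : forall x y z, le I x y -> le I y z -> le I x z;
  mt_chain : forall x y z, le I y x -> le I z x -> le I y z \/ le I z y;
  mt_meetl : forall x y, le I (meet I x y) x;
  mt_meetr : forall x y, le I (meet I x y) y;
  mt_glb : forall x y z, le I z x -> le I z y -> le I z (meet I x y)
}.

(** [b x y] is the label of the cone of [y] at the node [x], and each label of [K] occurs at each
    node. The other clauses are the density conditions shared by types (1.a) and (1.b). *)
Record branching F K D (I : interp F D) (b : D -> D -> K) : Prop := Branching {
  bt_tree : meet_tree I;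
  bt_meet : forall x y z, node I x -> lt I x y -> lt I x z ->
    lt I x (meet I y z) <-> b x y = b x z;
  bt_onto : forall x k, node I x ->
    exists y, node I y /\ lt I x y /\ b x y = k;
  bt_dense : forall x y, lt I x y -> exists z, node I z /\ lt I x z /\ lt I z y;
  bt_nofirst : forall x, exists y, node I y /\ lt I y x
}.

Definition void_interp D (leD : D -> D -> Prop) (m : D -> D -> D)
    (nd lf : set D) : interp void D :=
  @Interp void D leD m nd lf (of_void _) (of_void _) (of_void _).

Definition ltq (p q : rat) : Prop := (p < q)%R.

Section RatCuts.
Variables (K : Set) (k0 : K) (tops : bool).
Import Order.TTheory GRing.Theory Num.Theory.

Lemma ltq_irr p : ~ ltq p p. Proof. by rewrite /ltq ltxx. Qed.
Lemma ltq_trans p q r : ltq p q -> ltq q r -> ltq p r.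
Proof. exact: lt_trans. Qed.
Lemma ltq_total p q : [\/ ltq p q, p = q | ltq q p].
Proof.
by rewrite /ltq; case: (ltgtP p q) => H; [constructor 1|constructor 3|constructor 2].
Qed.
Lemma ltq_dense p q : ltq p q -> exists r, ltq p r /\ ltq r q.
Proof. by move=> /midf_lt[H1 H2]; eexists; split; [exact: H1|exact: H2]. Qed.
Lemma ltq_max p : exists q, ltq p q.
Proof. by exists (p + 1)%R; rewrite /ltq ltrDl. Qed.
Lemma ltq_min p : exists q, ltq q p.
Proof. by exists (p - 1)%R; rewrite /ltq ltrBlDr ltrDl. Qed.

Let C := cut ltq k0 tops.
Let lf : set C := [set x | height x = None].

Definition cut_interp : interp void C :=
  void_interp (@cut_le _ _ _ _ _) (cut_meet ltq_irr ltq_trans ltq_total (tops := tops))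
    (~` lf) lf.

Lemma cut_branching : branching cut_interp (@branch _ _ _ k0 tops).
Proof.
split.
- split=> [x|x y|x y z|x y z|x y|x y|x y z].
  + exact: cut_refl.
  + exact: (cut_anti ltq_irr ltq_total).
  + exact: cut_trans.
  + exact: (cut_chain ltq_trans ltq_total).
  + by have [] := cut_meetP ltq_irr ltq_trans ltq_total x y.
  + by have [_ []] := cut_meetP ltq_irr ltq_trans ltq_total x y.
  + by have [_ [_ [H _]]] := cut_meetP ltq_irr ltq_trans ltq_total x y; apply: H.
- by move=> x y z; apply: branch_meet.
- by move=> x k; apply: (branch_onto ltq_irr ltq_trans ltq_max).
- by move=> x y; apply: (cut_dense ltq_irr ltq_trans ltq_total ltq_dense ltq_max).
- by move=> x; apply: (cut_nofirst (0%R : rat) ltq_irr ltq_trans ltq_min).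
Qed.

Lemma cut_leaf_max x y : leaf cut_interp x -> le cut_interp x y -> x = y.
Proof.
move=> lx [h H]; apply: cut_eq; last by move=> p; apply: H; rewrite lx.
by apply: (height_inj ltq_irr ltq_total h); rewrite lx.
Qed.

Lemma cut_below_leaf x : tops -> exists2 y, leaf cut_interp y & le cut_interp x y.
Proof.
move=> tt; case: (svalP x) => H1 [H2 H3].
have H : (exists s : seq rat, forall p, (sval x).1 p <> k0 -> List.In p s) /\
  (forall p, ~ below ltq p None -> (sval x).1 p = k0) /\ (@None rat = None -> tops).
  by split=> //; split=> // p [].
by exists (exist _ ((sval x).1, None) H).
Qed.

Lemma cut_all_nodes x : tops = false -> node cut_interp x.
Proof. by move=> tf lx; case: (svalP x) => _ [_ /(_ lx)]; rewrite tf. Qed.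

End RatCuts.

Section MeetTree.
Variables (F D : Type) (I : interp F D).
Hypothesis M : meet_tree I.

Lemma mt_meet_id x y : le I x y -> meet I x y = x.
Proof.
move=> xy; apply: (mt_antisym M); first exact: (mt_meetl M).
by apply: (mt_glb M) => //; apply: (mt_refl M).
Qed.

Lemma mt_lt_le x y z : lt I x y -> le I y z -> lt I x z.
Proof.
move=> [xy N] yz; split; first exact: (mt_trans M xy yz).
by move=> E; apply: N; apply: (mt_antisym M) => //; rewrite E.
Qed.

Lemma mt_lt_trans x y z : lt I x y -> lt I y z -> lt I x z.
Proof. by move=> xy [yz _]; apply: mt_lt_le yz. Qed.

Lemma mt_lt_nle x y : lt I x y -> ~ le I y x.
Proof. by move=> [xy N] yx; apply: N; apply: (mt_antisym M). Qed.

Variables (K : Type) (b : D -> D -> K).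
Hypothesis B : branching I b.

Lemma branch_le x y z : node I x -> lt I x y -> le I y z -> b x y = b x z.
Proof.
move=> nx xy yz; apply/(bt_meet B nx xy (mt_lt_le xy yz)).
by rewrite mt_meet_id.
Qed.

Lemma branch_cone_infinite x k : node I x ->
  infinite_set [set s | lt I x s /\ b x s = k].
Proof.
move=> nx; apply: (infinite_no_min (R := lt I)).
- by move=> s [].
- exact: mt_lt_trans.
- by have [y [_ [xy yk]]] := bt_onto B k nx; exists y.
- move=> s [xs sk]; have [z [_ [xz zs]]] := bt_dense B xs.
  by exists z => //; split=> //; rewrite (branch_le nx xz zs.1).
Qed.

End MeetTree.

(** * Trees of type (1.a) *)

Section Type1a.
Variables (m : enat) (D : Type) (I : interp void D) (b : D -> D -> label m).
Hypothesis B : branching I b.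
Hypothesis leaf_node : forall x, leaf I x <-> ~ node I x.
Hypothesis leaf_maxi : forall x, leaf I x -> maximal I x.
Hypothesis leaf_above : forall x, exists2 a, leaf I a & le I x a.
Hypothesis two : exists k1 k2 : label m, k1 <> k2.
Let M : meet_tree I := bt_tree B.

Let nodeN x : node I x <-> ~ leaf I x.
Proof. by rewrite leaf_node; split=> [H /(_ H)|/contrapT]. Qed.

Lemma good_type1a : good_tree I.
Proof.
split; try by case: M.
- move=> x; split=> [/leaf_maxi//|mx].
  by have [a la xa] := leaf_above x; rewrite (mx a xa).
- move=> x; split=> [nx|[a [c [la [lc [ac ->]]]]]]; last first.
    apply/nodeN => lm; apply: ac.
    exact: etrans (esym (leaf_maxi lm (mt_meetl M a c))) (leaf_maxi lm (mt_meetr M a c)).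
  have [k1 [k2 k12]] := two.
  have [y1 [_ [xy1 b1]]] := bt_onto B k1 nx; have [y2 [_ [xy2 b2]]] := bt_onto B k2 nx.
  have [a1 la1 ya1] := leaf_above y1; have [a2 la2 ya2] := leaf_above y2.
  have xa1 := mt_lt_le M xy1 ya1; have xa2 := mt_lt_le M xy2 ya2.
  have N : b x a1 <> b x a2.
    by rewrite -(branch_le M B nx xy1 ya1) -(branch_le M B nx xy2 ya2) b1 b2.
  exists a1, a2; split=> //; split=> //; split; first by move=> E; rewrite E in N.
  apply: contrapT => N'; apply: N; apply/(bt_meet B nx xa1 xa2); split=> //.
  by apply: (mt_glb M); [case: xa1|case: xa2].
- by move=> x; have [lx|/nodeN] := pselect (leaf I x); [left|right].
Qed.

Lemma one_colored_type1a : m <> Some 0 -> one_colored (Some 0, m) I.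
Proof.
move=> m0; split; first exact: good_type1a.
split; first by move=> c0; case: m0.
split; last by case.
move=> _; split=> [a la|x nx].
  split; first by have [y [_ ya]] := bt_nofirst B a; exists y.
  split=> [x y _ ya /(bt_dense B)[z [_ [xz zy]]]|[x [_ Hx]]].
    by exists z; split=> //; apply: (mt_lt_trans M zy).
  have [y [_ yx]] := bt_nofirst B x.
  apply: (mt_lt_nle M yx).
  have [xa|N] := pselect (lt I x a).
    by apply: Hx; apply: (mt_lt_trans M yx).
  have [z [_ za]] := bt_nofirst B a; have xz := Hx z za.
  by case: N; split; [apply: (mt_trans M xz za.1)|move=> E; apply: (mt_lt_nle M za); rewrite -E].
pose g k := [set s | lt I x s /\ b x s = k].
have coneE t : lt I x t -> [set s | lt I x s /\ lt I x (meet I t s)] = g (b x t).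
  move=> xt; apply/seteqP; split=> s [xs H]; split=> //.
    exact/esym/(bt_meet B nx xt xs).
  exact/(bt_meet B nx xt xs)/esym.
split.
  suff -> : cones I x = g @` setT.
    apply: has_card_range => k k' E; have [y [_ [xy yk]]] := bt_onto B k nx.
    have : g k y by [].
    by rewrite E => -[_ <-].
  apply/seteqP; split=> [C [t xt ->]|C [k _ <-]].
    by exists (b x t) => //; rewrite coneE.
  have [y [_ [xy yk]]] := bt_onto B k nx.
  by exists y => //; rewrite coneE // yk.
by move=> C [t xt ->]; rewrite coneE //; apply: (branch_cone_infinite M B).
Qed.

End Type1a.

(** * Attaching leaves to a tree *)

Section Attach.
Variables (D L : Type) (J : interp void D) (l0 : L).
Hypothesis M : meet_tree J.
Hypothesis two : (exists l1 l2 : L, l1 <> l2) \/ forall x, exists y, lt J x y.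

(* The tree J with one leaf above each element for each l : L. *)
Definition attach_le (p q : D * option L) : Prop :=
  p = q \/ (p.2 = None /\ le J p.1 q.1).

Definition attach_meet (p q : D * option L) : D * option L :=
  if `[< p = q >] then p else (meet J p.1 q.1, None).

Definition attach : interp void (D * option L) :=
  void_interp attach_le attach_meet [set p | p.2 = None] [set p | p.2 <> None].

Lemma attach_meet_neq p q : p <> q -> attach_meet p q = (meet J p.1 q.1, None).
Proof. by move=> pq; rewrite /attach_meet asboolF. Qed.

Lemma attach_le_base p q : attach_le p q -> le J p.1 q.1.
Proof. by case=> [->|[]//]; apply: (mt_refl M). Qed.

Lemma attach_tree : meet_tree attach.
Proof.
split=> /=.
- by left.
- move=> [x o] [y o'] [//|[/= -> xy]] [//|[/= -> yx]].
  by rewrite (mt_antisym M xy yx).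
- move=> p q r [->//|[p0 pq]] [<-|[q0 qr]]; first by right.
  by right; split=> //; apply: (mt_trans M pq).
- move=> x y z [->|[y0 yx]] [->|[z0 zx]]; [by left; left|by right; right|by left; right|].
  by case: (mt_chain M yx zx) => H; [left|right]; right.
- move=> p q; rewrite /attach_meet; case: asboolP => pq; [by left|right].
  by split=> //; apply: (mt_meetl M).
- move=> p q; rewrite /attach_meet; case: asboolP => pq; [by left|right].
  by split=> //; apply: (mt_meetr M).
- move=> p q r rp rq; rewrite /attach_meet; case: asboolP => // pq; right; split.
    case: rp => [rp|[]//]; case: rq => [rq|[]//].
    by case: pq; rewrite -rp -rq.
  by apply: (mt_glb M); apply: attach_le_base.
Qed.

(** By [two], an element of [J] is the meet of two leaves attached to it, or of a leaf attached to
    it and one attached to a larger element. *)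
Lemma good_attach : good_tree attach.
Proof.
split; try by case: attach_tree.
- move=> [x o]; split=> [lp q|mx].
    by case=> [//|[o0 _]]; case: lp.
  move=> /= o0; have xl : le attach (x, o) (x, Some l0).
    by right; split=> //; apply: (mt_refl M).
  by have := mx _ xl; rewrite o0.
- move=> [x o]; split=> [/= ->|[a [c [_ [_ [ac ->]]]]]]; last first.
    by rewrite /= attach_meet_neq.
  case: two => [[l1 [l2 l12]]|H].
    exists (x, Some l1), (x, Some l2); split=> //; split=> //.
    have N : (x, Some l1) <> (x, Some l2) by case.
    by split=> //; rewrite /= attach_meet_neq // mt_meet_id //; apply: (mt_refl M).
  have [y [xy Nxy]] := H x.
  exists (x, Some l0), (y, Some l0); split=> //; split=> //.
  have N : (x, Some l0) <> (y, Some l0) by case.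
  by split=> //; rewrite /= attach_meet_neq // mt_meet_id.
- move=> [x [l|]]; first by exists (x, Some l) => //; left.
  by exists (x, Some l0) => //; right; split=> //; apply: (mt_refl M).
- by move=> [x [l|]]; [left|right].
Qed.

Lemma attach_ltN x y : lt attach (x, None) (y, None) <-> lt J x y.
Proof.
split=> -[H N]; split.
- exact: attach_le_base H.
- by move=> E; apply: N; rewrite E.
- by right.
- by case.
Qed.

Lemma attach_lt_leaf x y l : lt attach (x, None) (y, Some l) <-> le J x y.
Proof. by split=> [[/attach_le_base]|xy]; last by split=> //; right. Qed.

Lemma attach_pred x l : is_pred attach (x, None) (x, Some l).
Proof.
split; first by apply/attach_lt_leaf; apply: (mt_refl M).
move=> [y [l'|]] [xy yx].
  by case: yx => -[E|[]//] N; apply: N.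
move/attach_ltN: xy => /(mt_lt_nle M); apply; exact/attach_lt_leaf/yx.
Qed.

Lemma attach_leaf_cone x l :
  [set s | lt attach (x, None) s /\ lt attach (x, None) (meet attach (x, Some l) s)]
  = [set (x, Some l)].
Proof.
apply/seteqP; split=> [s [xs /=]|s ->]; last first.
  have H : lt attach (x, None) (x, Some l) by apply/attach_lt_leaf; apply: (mt_refl M).
  by split=> //=; rewrite /attach_meet asboolT.
have [<-//|N] := pselect ((x, Some l) = s).
rewrite attach_meet_neq // => /attach_ltN/(mt_lt_nle M) H.
by case: H; apply: (mt_meetl M).
Qed.

End Attach.

(** * Trees of type (1.b) *)

Section Type1b.
Variables (m mu : enat) (D : Type) (J : interp void D) (b : D -> D -> label mu).
Variable l0 : label m.
Hypothesis B : branching J b.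
Hypothesis nodes : forall x, node J x.
Hypotheses (m0 : m <> Some 0) (mu0 : mu <> Some 0).
Variable k0 : label mu.
Let M : meet_tree J := bt_tree B.
Let I := attach (label m) J.

Let G : good_tree I.
Proof.
apply: good_attach => //; right=> x.
by have [y [_ [xy _]]] := bt_onto B k0 (nodes x); exists y.
Qed.

Let g x (k : label mu) : set (D * option (label m)) :=
  [set s | lt J x s.1 /\ b x s.1 = k].

Let lt_base x (s : D * option (label m)) : lt J x s.1 -> lt I (x, None) s.
Proof. by case: s => y [l|] xy; [apply/(attach_lt_leaf M); case: xy|apply/(attach_ltN _ M)]. Qed.

Let cone_base x (t : D * option (label m)) : lt J x t.1 ->
  [set s | lt I (x, None) s /\ lt I (x, None) (meet I t s)] = g x (b x t.1).
Proof.
move=> xt; apply/seteqP; split=> s [].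
  move=> xs; have [<- _ //|ts] := pselect (t = s).
  rewrite /= attach_meet_neq // => /(attach_ltN _ M) xm.
  have xs' := mt_lt_le M xm (mt_meetr M _ _).
  by split=> //; apply/esym/(bt_meet B (nodes x) xt xs').
move=> xs E; split; first exact: lt_base.
have [<-|ts] := pselect (t = s); first by rewrite /= /attach_meet asboolT //; apply: lt_base.
rewrite /= attach_meet_neq //; apply/(attach_ltN _ M).
by apply/(bt_meet B (nodes x) xt xs).
Qed.

Let g_infinite x k : infinite_set (g x k).
Proof.
apply: (infinite_no_min (R := fun s t => lt J s.1 t.1)).
- by move=> s [].
- by move=> s t u; apply: (mt_lt_trans M).
- by have [y [_ [xy yk]]] := bt_onto B k (nodes x); exists (y, None).
- move=> s [xs sk]; have [z [_ [xz zs]]] := bt_dense B xs.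
  by exists (z, None) => //; split=> //; rewrite (branch_le M B (nodes x) xz zs.1).
Qed.

Let cone_cases x (t : D * option (label m)) : lt I (x, None) t ->
  lt J x t.1 \/ exists l, t = (x, Some l).
Proof.
case: t => y [l|] xt; last by left; exact: (attach_ltN _ M x y).1 xt.
have [<-|N] := pselect (x = y); first by right; exists l.
by left; split=> //; apply/(attach_lt_leaf M)/xt.
Qed.

Lemma one_colored_type1b : one_colored (m, mu) I.
Proof.
split; first exact: G.
split; first by move=> c0; case: mu0.
split; first by move=> c0; case: m0.
move=> _; split.
  move=> [x [l|]] // _; exists (x, None); first exact: attach_pred.
  have br1 p : br I (x, None) p -> p.2 = None /\ le J p.1 x.
    by case=> [->|//]; split=> //; apply: (mt_refl M).
  split; first by exists (x, None); left.
  split=> [[y o] [z o'] /br1[/= -> yx] /br1[/= -> zx] /(attach_ltN _ M) yz|].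
    have [u [_ [yu uz]]] := bt_dense B yz.
    exists (u, None); split; last by split; apply/(attach_ltN _ M).
    by right; split=> //; apply: (mt_trans M uz.1).
  move=> [[y o] [/br1[/= -> yx] Hy]].
  have [z [_ zy]] := bt_nofirst B y.
  have := Hy (z, None); case; first by right; split=> //; apply: (mt_trans M zy.1).
    by case=> E; apply: zy.2.
  by case=> _ /(mt_lt_nle M zy).
move=> [x o] /= ->; split.
  suff -> : leaf_cones I (x, None) = (fun l => [set (x, Some l)]) @` setT.
    apply: has_card_range => l l' E.
    have : [set (x, Some l)] (x, Some l) by [].
    by rewrite E => -[].
  apply/seteqP; split=> [C [[t xt ->] [a la Ca]]|C [l _ <-]]; last first.
    split; last by exists (x, Some l).
    exists (x, Some l); last by rewrite attach_leaf_cone.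
    by apply/(attach_lt_leaf M); apply: (mt_refl M).
  case: (cone_cases xt) => [xt'|[l ->]]; last by exists l => //; rewrite attach_leaf_cone.
  case: (g_infinite (x := x) (k := b x t.1)); rewrite -cone_base // Ca.
  exact: finite_set1.
suff -> : infinite_cones I (x, None) = (g x) @` setT.
  apply: has_card_range => k k' E; have [y [_ [xy yk]]] := bt_onto B k (nodes x).
  have : g x k (y, None) by [].
  by rewrite E => -[_ <-].
apply/seteqP; split=> [C [[t xt ->] Cinf]|C [k _ <-]].
  case: (cone_cases xt) => [xt'|[l tE]]; first by exists (b x t.1) => //; rewrite cone_base.
  by case: Cinf; rewrite tE attach_leaf_cone //; apply: finite_set1.
have [y [_ [xy yk]]] := bt_onto B k (nodes x).
split; last exact: g_infinite.
by exists (y, None); [apply/(attach_ltN _ M)|rewrite cone_base //= yk].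
Qed.

End Type1b.

(** * Trees of type (0): leaves attached to a single point *)

Definition one_point : interp void unit :=
  void_interp (fun _ _ => True) (fun _ _ => tt) set0 set0.

Section Type0.
Variables (m : enat) (l1 l2 : label m).
Hypothesis l12 : l1 <> l2.
Lemma one_colored_type0 : one_colored (m, Some 0) (attach (label m) one_point).
Proof.
have M : meet_tree one_point by split=> //; [move=> [] []|left].
split; first by apply: good_attach => //; left; exists l1, l2.
split; last first.
  by split=> [m0|[_ []]//]; move: l1; rewrite /type1a /= in m0; rewrite m0 => -[].
move=> _; split.
  suff -> : node (attach (label m) one_point) = [set (tt, None)] by apply: card_set1.
  by apply/seteqP; split=> [[[] o] /= ->|p ->].
suff -> : leaf (attach (label m) one_point) = (fun l => (tt, Some l)) @` setT.
  by apply: has_card_range => l l' [].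
apply/seteqP; split=> [[[] [l|]] //= _|p [l _ <-]//].
by exists l.
Qed.

End Type0.

Lemma two_labels m : (if m is Some i then is_true (2 <= i) else True) ->
  exists k1 k2 : label m, k1 <> k2.
Proof.
case: m => [[|[|i]]|] //= _; last by exists 0, 1.
by exists (exist (fun j => j < i.+2) 0 isT), (exist (fun j => j < i.+2) 1 isT) => -[].
Qed.

Lemma one_label m : m <> Some 0 -> exists k : label m, True.
Proof. by case: m => [[|i]|] //= _; [exists (exist (fun j => j < i.+1) 0 isT)|exists 0]. Qed.

Lemma one_colored_exists c : valid_color c ->
  exists M : structure void, one_colored c M.
Proof.
case: c => m mu; rewrite /valid_color /=.
have [->|mu0] := pselect (mu = Some 0).
  case: m => [m|] V.
    have [|l1 [l2 l12]] := @two_labels (Some m); first by move: V; rewrite /enat_add /= addn0.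
    exists (Structure (attach (label (Some m)) one_point) (inhabits (tt, None))).
    exact: one_colored_type0 l12.
  have [//|l1 [l2 l12]] := @two_labels None.
  exists (Structure (attach (label None) one_point) (inhabits (tt, None))).
  exact: one_colored_type0 l12.
have [k0 _] := one_label mu0.
move=> V; have [m0|m0] := pselect (m = Some 0).
  rewrite m0 in V *.
  have two : exists k1 k2 : label mu, k1 <> k2.
    by apply: two_labels; move: V; rewrite /enat_add; case: (mu).
  (* In type (1.a) the leaves are the functions defined on all rationals. *)
  have x0 : cut ltq k0 true by exists (fun=> k0, None); split=> //; exists [::].
  exists (Structure (cut_interp k0 true) (inhabits x0)).
  apply: (one_colored_type1a (cut_branching k0 true)) => //.
  - by move=> x /=; rewrite notK.
  - by move=> x lx y; apply: cut_leaf_max.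
  - by move=> x; apply: cut_below_leaf.
have [l0 _] := one_label m0.
(* In type (1.b) total functions are left out, so every cut is a node to which leaves are
   attached. *)
have x0 : cut ltq k0 false.
  exists (fun=> k0, Some 0%R); split; first by exists [::].
  by [].
exists (Structure (attach (label m) (cut_interp k0 false)) (inhabits (x0, None))).
apply: (one_colored_type1b l0 (cut_branching k0 false)) => //.
by move=> x; apply: cut_all_nodes.
Qed.

(** * Existence of extensions *)

Section Pullback.
Variables (F A B : Type) (I : interp F A) (g : B -> A) (h : A -> B).
Hypotheses (hg : cancel g h) (gh : cancel h g).

Definition pullback : interp F B :=
  Interp (fun x y => le I (g x) (g y)) (fun x y => h (meet I (g x) (g y)))
    (g @^-1` node I) (g @^-1` leaf I) (fun f x => h (fn I f (g x)))
    (fun f => g @^-1` fdom I f) (fun f => g @^-1` fimg I f).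

Lemma pullback_eval env t : g (eval pullback env t) = eval I (g \o env) t.
Proof. by elim: t => //= [t -> u ->|f t ->]; rewrite gh. Qed.

Lemma pullback_sat phi : forall env, sat pullback env phi <-> sat I (g \o env) phi.
Proof.
elim: phi => //= [t u|t u|t|t|f t|f t|p IHp q IHq|x p IH] env;
  rewrite -?pullback_eval //.
- by split=> [->//|/(can_inj hg)].
- by rewrite IHp IHq.
- have upd a : g \o update env x a = update (g \o env) x (g a).
    by apply: funext => y; rewrite /update /=; case: eqP.
  split=> H a; last by apply/IH; rewrite upd; apply: H.
  by have /IH := H (h a); rewrite upd gh.
Qed.

Lemma pullback_equiv : inhabited A -> elem_equiv pullback I.
Proof.
move=> [a] phi _; split=> H env; last exact/pullback_sat/H.
have := H (h \o env) => /pullback_sat; congr sat.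
by apply: funext => x; rewrite /= gh.
Qed.

End Pullback.

Lemma isolated_color c k D (I : interp (symbols k) D) a : leveled c I ->
  leaf I a -> isolated I a <-> (c k).1 <> Some 0.
Proof.
move=> [LT _] la; have l := (lt_leaf LT a).1 la; split=> [[_ H]|ck].
  have [i [+ [ci _]]] := (has_predP LT a).1 H.
  by rewrite l => /eqP; rewrite eqSS => /eqP ik; rewrite ik.
by split=> //; apply/(has_predP LT); exists k; split=> //; split=> //; left.
Qed.

Lemma leveled_star c k D (I : interp (symbols k) D) f : leveled c I -> star I f.
Proof.
move=> [LT LS]; have hk := img_level_leq c f; split.
- by move=> x /(lt_leaf LT) lx; apply/(ls_dom LS); rewrite lx leqW.
- apply/seteqP; split=> x.
    by move=> /(ls_dom LS)/(lt_ex LT)[y [yx ly]]; exists y => //; apply/(ls_img LS).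
  by move=> [y /(ls_img LS) ly /(lt_mono LT)]; rewrite ly => /(ls_dom LS).
- rewrite predeqE => x; split=> // -[/(ls_img LS) lx /(lt_leaf LT)].
  by rewrite lx => E; move: hk; rewrite E ltnn.
- move=> x N; apply: (ls_out LS); rewrite ltnNge; apply/negP.
  by move/(ls_dom LS).
- apply/seteqP; split=> [y [x /(ls_dom LS)/(level_fn_top LS)[_ [ly _]] <-]|x /(ls_img LS) lx].
    exact/(ls_img LS).
  have hx : img_level c f <= level c I x by rewrite lx.
  exists x; first exact/(ls_dom LS).
  by apply/esym/(ls_fn LS) => //; rewrite -lx; apply: (top_at_self LT).
- by move=> x /(ls_dom LS)/(level_fn_top LS)[].
- move=> x /(ls_img LS) lx; apply/esym/(ls_fn LS); first by rewrite lx.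
  by rewrite -lx; apply: (top_at_self LT).
Qed.

Lemma leveled_nontriv c k D (I : interp (symbols k) D) : leveled c I ->
  inhabited D -> ~ singleton D.
Proof.
move=> [LT _] [x0] [x Hx].
have [a la _] := below_leaf (lt_good LT) x0.
have [y [_ ly]] := @lt_ex _ _ _ _ _ _ LT 0 a (leq0n _).
have := (lt_leaf LT a).1 la; by rewrite (Hx a) -(Hx y) ly.
Qed.

(** * The extension of T by T0 *)

Section Product.
Variables (c : nat -> color) (k : nat).
Variables (T : structure (symbols k)) (T0 : structure (symbols 0)).
Let cc i := c (i + k.+1).
Hypotheses (LT : leveled c T) (LT0 : leveled cc T0).
Hypothesis type_ck : type1a (c k) -> type0 (c k.+1).

Let lev := level c T.
Let L : levtree T lev k.+1 c := LT.1.
Let S : level_symbols (@img_level c k) T lev := LT.2.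
Let G : good_tree T := lt_good L.
Let G0 : good_tree T0 := lt_good LT0.1.
Let rt := has_root T0.

Lemma noroot_color : ~ rt -> (c k).1 <> Some 0.
Proof.
move=> nr ck; apply: nr; apply/(root_color LT0).
exact: type_ck.
Qed.

Lemma extension_hypI : extension_hyp T T0.
Proof.
split.
- exact: G.
- by move=> f; apply: leveled_star LT.
- exact: G0.
- exact: (leveled_nontriv LT (carrier_inhabited T)).
- exact: (leveled_nontriv LT0 (carrier_inhabited T0)).
- have [ck|ck] := pselect ((c k).1 = Some 0).
    by right=> a la /(isolated_color LT la).
  by left=> a la; apply/(isolated_color LT la).
- move=> [a [la /(isolated_color LT la) Na]]; apply: contrapT => /noroot_color.
  exact: Na.
- move=> [a [la /= Ha]]; have ck : (c k).1 <> Some 0.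
    by apply/(isolated_color LT la).
  rewrite (leaf_preds_level LT ck) => x y z /= lx lz xy yz.
  have := lt_mono L yz; have := lt_mono L xy; rewrite /lev lx lz => H1 H2.
  by apply/eqP; rewrite eqn_leq H1 H2.
Qed.

Variable t0 : T0.
(** The union of the nodes of [T] and of the pairs of a leaf and an element of [T0], coded by pairs:
    a node carries the dummy second component [t0]. *)
Local Notation W := {x : T * T0 | leaf T x.1 \/ x.2 = t0}.
Implicit Types p q r : W.

Definition base (p : W) : T := (sval p).1.
Definition fib (p : W) : T0 := (sval p).2.
Definition canon (a : T) : W := exist (fun x : T * T0 => leaf T x.1 \/ x.2 = t0) (a, t0) (or_intror erefl).
Definition point (a : T) (la : leaf T a) (t : T0) : W :=
  exist (fun x : T * T0 => leaf T x.1 \/ x.2 = t0) (a, t) (or_introl la).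

Lemma W_eq p q : base p = base q -> fib p = fib q -> p = q.
Proof.
case: p q => [[a t] Ha] [[b u] Hb]; rewrite /base /fib /= => ab tu.
by apply: eq_exist; rewrite ab tu.
Qed.

Lemma fib_node p : ~ leaf T (base p) -> fib p = t0.
Proof. by case: p => [[a t] []]. Qed.

Lemma W_node_eq p q : ~ leaf T (base p) -> base p = base q -> p = q.
Proof.
move=> N E; apply: W_eq => //; rewrite !fib_node //.
by rewrite -E.
Qed.

Definition leW p q : Prop :=
  (base p = base q /\ le T0 (fib p) (fib q)) \/ lt T (base p) (base q).

Lemma leW_base p q : leW p q -> le T (base p) (base q).
Proof. by case=> [[-> _]|[]//]; apply: (le_refl G). Qed.

Lemma leW_refl p : leW p p. Proof. by left; split=> //; apply: (le_refl G0). Qed.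

Lemma leW_anti p q : leW p q -> leW q p -> p = q.
Proof.
case=> [[E H]|pq]; case=> [[E' H']|qp].
- by apply: W_eq => //; apply: (le_antisym G0).
- by case: qp => _; rewrite E.
- by case: pq => _; rewrite E'.
- by case: (lt_nle G pq); case: qp.
Qed.

Lemma leW_trans p q r : leW p q -> leW q r -> leW p r.
Proof.
case=> [[E H]|pq]; case=> [[E' H']|qr].
- by left; split; [rewrite E|apply: (le_trans G0 H)].
- by right; rewrite E.
- by right; rewrite -E'.
- by right; apply: (lt_le_trans G pq); case: qr.
Qed.

Lemma leW_chain p q r : leW q p -> leW r p -> leW q r \/ leW r q.
Proof.
case=> [[E H]|qp]; case=> [[E' H']|rp].
- by case: (br_chain G0 H H') => X; [left|right]; left; rewrite E E'.
- by right; right; rewrite E.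
- by left; right; rewrite E'.
- have [Eb|N] := pselect (base q = base r).
    left; left; split=> //; rewrite !fib_node ?Eb; first exact: (le_refl G0).
      by move=> /(leafP G)/(_ _ rp.1); case: rp.
    by move=> /(leafP G)/(_ _ rp.1); case: rp.
  case: (gt_chain G qp.1 rp.1) => X; [left|right]; right; split=> //.
  by move=> E; apply: N.
Qed.

(** Over different points of [T] the meet is that of [T], a node with a single point over it; over
    the same leaf it is computed in the copy of [T0]. *)
Lemma meetW_ex p q : exists m, leW m p /\ leW m q /\
  forall r, leW r p -> leW r q -> leW r m.
Proof.
have [E|N] := pselect (base p = base q); last first.
  pose m := canon (meet T (base p) (base q)).
  have mE : base m = meet T (base p) (base q) by [].
  have ml : ~ leaf T (base m).
    move=> /(leafP G) lm; apply: N.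
    by rewrite -(lm _ (meet_lel G _ _ : le T (base m) (base p)));
      exact: (lm _ (meet_ler G _ _ : le T (base m) (base q))).
  have nl r' : ~ leaf T (base r') -> base m = base r' -> leW m r'.
    by move=> nr E; rewrite (W_node_eq ml E); apply: leW_refl.
  have low r' : le T (base m) (base r') -> leW m r'.
    move=> H; have [E|N'] := pselect (base m = base r'); last by right.
    by apply: nl => //; rewrite -E.
  exists m; split; first by apply: low; apply: (meet_lel G).
  split; first by apply: low; apply: (meet_ler G).
  move=> r rp rq; have rm : le T (base r) (base m).
    by apply: (meet_glb G); apply: leW_base.
  have [E|N'] := pselect (base r = base m); last by right.
  by rewrite (W_node_eq _ E) ?E //; apply: leW_refl.
have [la|na] := pselect (leaf T (base p)); last first.
  rewrite -(W_node_eq na E); exists p; split; [exact: leW_refl|split; [exact: leW_refl|by []]].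
exists (point la (meet T0 (fib p) (fib q))); split.
  by left; split=> //; apply: (meet_lel G0).
split; first by left; split=> //; apply: (meet_ler G0).
move=> r [[Ep rp]|H]; last by move=> _; right.
case=> [[Eq rq]|H]; last by case: H => _ []; apply: etrans Ep E.
by left; split=> //; apply: (meet_glb G0).
Qed.

Definition meetW p q : W := sval (cid (meetW_ex p q)).

Lemma meetWP p q : leW (meetW p q) p /\ leW (meetW p q) q /\
  forall r, leW r p -> leW r q -> leW r (meetW p q).
Proof. by rewrite /meetW; case: cid. Qed.

Lemma base_meetW p q : le T (base (meetW p q)) (meet T (base p) (base q)).
Proof.
have [mp [mq _]] := meetWP p q.
by apply: (meet_glb G); apply: leW_base.
Qed.

(** The copies of [T0] begin here: at their roots if [T0] has a root, otherwise just above the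
    predecessors of the leaves of [T], which make up level [k]. *)
Definition E_W p : Prop :=
  if `[< rt >] then leaf T (base p) /\ forall t, le T0 (fib p) t
  else lev (base p) = k.

Definition D_W p : Prop := exists2 q, E_W q & leW q p.

Definition max_E p q : Prop := (E_W q /\ leW q p) /\
  forall r, E_W r /\ leW r p -> leW r q.

Definition e_W p : W :=
  if pselect (exists q, max_E p q) is left H then sval (cid H) else p.

Lemma e_W_max p q : max_E p q -> e_W p = q.
Proof.
move=> H; rewrite /e_W; case: pselect => [H'|[]]; last by exists q.
case: cid => r /= [Er Hr]; case: H => Eq Hq.
by apply: leW_anti; [apply: Hq|apply: Hr].
Qed.

Lemma E_W_root : rt -> forall p, E_W p <-> leaf T (base p) /\ forall t, le T0 (fib p) t.
Proof. by move=> r p; rewrite /E_W asboolT. Qed.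

Lemma E_W_noroot : ~ rt -> forall p, E_W p <-> lev (base p) = k.
Proof. by move=> r p; rewrite /E_W asboolF. Qed.

Lemma node_lev_leq a : ~ leaf T a <-> lev a <= k.
Proof.
rewrite (lt_leaf L); have := lt_bound L a; rewrite leq_eqVlt ltnS => /orP[/eqP H|H].
  by rewrite H ltnn.
by rewrite H; split=> // _ E; move: H; rewrite E ltnn.
Qed.

Lemma leW_low p q : ~ leaf T (base p) -> le T (base p) (base q) -> leW p q.
Proof.
move=> np H; have [E|N] := pselect (base p = base q); last by right.
by rewrite (W_node_eq np E); apply: leW_refl.
Qed.

Lemma leW_leaf p q : leaf T (base p) -> leW p q -> base p = base q /\ le T0 (fib p) (fib q).
Proof. by move=> /(leafP G) lp; case=> [//|[/lp E []]]. Qed.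

(** If [T0] has no root, the condition on consecutive types gives [(c k).1 <> Some 0], so level [k]
    has a last element below every leaf of [T]. *)
Lemma D_W_max p : D_W p -> exists q, max_E p q.
Proof.
move=> [q Eq qp]; have [r|nr] := pselect rt.
  exists q; split=> // s [Es sp].
  have [lq Hq] := (E_W_root r q).1 Eq; have [ls Hs] := (E_W_root r s).1 Es.
  have [E1 _] := leW_leaf lq qp; have [E2 _] := leW_leaf ls sp.
  by left; split=> //; rewrite E1.
have lq := (E_W_noroot nr q).1 Eq.
have nq : ~ leaf T (base q) by apply/node_lev_leq; rewrite lq.
have [lp|np] := pselect (leaf T (base p)).
  have klp : k < lev (base p) by rewrite ((lt_leaf L _).1 lp).
  have [y ty] := lt_top L (ltnSn k) (noroot_color nr) klp.
  have [yp [ly Hy]] := ty.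
  have ny : ~ leaf T (base (canon y)) by apply/node_lev_leq; rewrite /base /= ly.
  exists (canon y); split.
    by split; [apply/(E_W_noroot nr)|apply: leW_low].
  move=> s [/(E_W_noroot nr) ls sp]; apply: leW_low; last by apply: Hy => //; apply: leW_base.
  by apply/node_lev_leq; rewrite ls.
exists p; split; last by move=> s [].
split; last exact: leW_refl.
have := lt_mono L (leW_base qp); rewrite lq => kp.
by apply/(E_W_noroot nr)/eqP; rewrite eqn_leq kp andbT; apply/node_lev_leq.
Qed.

Lemma e_WP p : D_W p -> max_E p (e_W p).
Proof. by move=> /D_W_max[q Hq]; rewrite (e_W_max Hq). Qed.

Lemma e_W_out p : ~ D_W p -> e_W p = p.
Proof.
move=> N; rewrite /e_W; case: pselect => // H; case: N.
by have [q [[Eq qp] _]] := H; exists q.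
Qed.

Lemma E_W_fix p : E_W p -> e_W p = p.
Proof. by move=> Ep; apply: e_W_max; split=> [|r []//]; split=> //; apply: leW_refl. Qed.

Lemma E_W_dom p : E_W p -> D_W p.
Proof. by move=> Ep; exists p => //; apply: leW_refl. Qed.

Definition prod_fn (f : symbols k.+1) p : W :=
  if f is Some g then (if `[< fdom T g (base p) >] then canon (fn T g (base p)) else p)
  else e_W p.

Definition prod_dom (f : symbols k.+1) p : Prop :=
  if f is Some g then fdom T g (base p) else D_W p.

Definition prod_img (f : symbols k.+1) p : Prop :=
  if f is Some g then fimg T g (base p) else E_W p.

Definition leafW p : Prop := leaf T (base p) /\ leaf T0 (fib p).

Definition prod_interp : interp (symbols k.+1) W :=
  @Interp (symbols k.+1) W leW meetW (fun p => ~ leafW p) leafW prod_fn prod_dom prod_img.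

Lemma leafW_max p : leafW p <-> maximal prod_interp p.
Proof.
split=> [[lp l0] q pq|mp].
  have [E H] := leW_leaf lp pq; apply: W_eq => //.
  exact: (leafP G0 _).1 l0 _ H.
have [a la pa] := below_leaf G (base p).
have [ap|N] := pselect (base p = a); last first.
  have E : p = point la t0 by apply: mp; right.
  by case: N; rewrite E.
have lp : leaf T (base p) by rewrite ap.
split=> //; apply/(leafP G0) => t ft.
have E : p = point lp t by apply: mp; left.
by rewrite E.
Qed.

Lemma good_prod : good_tree prod_interp.
Proof.
have below p : exists2 a, leafW a & leW p a.
  have [lp|np] := pselect (leaf T (base p)).
    have [t lt' pt] := below_leaf G0 (fib p).
    by exists (point lp t); [split|left].
  have [a la pa] := below_leaf G (base p); have [t lt' _] := below_leaf G0 t0.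
  exists (point la t); [by split|right; split=> //].
  by move=> E; apply: np; rewrite E.
split.
- exact: leW_refl.
- exact: leW_anti.
- exact: leW_trans.
- exact: leW_chain.
- by move=> p q; have [] := meetWP p q.
- by move=> p q; have [_ []] := meetWP p q.
- by move=> p q r; have [_ [_]] := meetWP p q; apply.
- exact: leafW_max.
- move=> p; split=> [Np|[a [b [la [lb [ab ->]]]]] lm]; last first.
    have [ma [mb _]] := meetWP a b; have m := (leafW_max _).1 lm.
    by apply: ab; rewrite -(m _ ma); apply: m.
  have [lp|np] := pselect (leaf T (base p)).
    have nf : node T0 (fib p).
      by have [lf|//] := leaf_or_node G0 (fib p); case: Np.
    have [t [u [lt' [lu [tu E]]]]] := (nodeP G0 _).1 nf.
    exists (point lp t), (point lp u); split=> //; split=> //; split.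
      by move=> H; apply: tu; have : fib (point lp t) = fib (point lp u) by rewrite H.
    have [ma [mb H]] := meetWP (point lp t) (point lp u).
    have pm : leW p (meetW (point lp t) (point lp u)).
      by apply: H; left; split=> //; rewrite E; [apply: (meet_lel G0)|apply: (meet_ler G0)].
    apply: leW_anti => //; have [Em _] := leW_leaf lp pm.
    left; split=> //; rewrite E; apply: (meet_glb G0).
      by case: ma => [[]//|[_ N]]; case: N; rewrite -Em.
    by case: mb => [[]//|[_ N]]; case: N; rewrite -Em.
  have nb : node T (base p) by have [|//] := leaf_or_node G (base p).
  have [a [b [la [lb [ab E]]]]] := (nodeP G _).1 nb.
  have [t lt' _] := below_leaf G0 t0.
  exists (point la t), (point lb t); split=> //; split=> //; split.
    by move=> H; apply: ab; have : base (point la t) = base (point lb t) by rewrite H.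
  have [ma [mb H]] := meetWP (point la t) (point lb t).
  apply: leW_anti.
    by apply: H; apply: leW_low => //; rewrite E; [apply: (meet_lel G)|apply: (meet_ler G)].
  have mE := base_meetW (point la t) (point lb t).
  apply: leW_low; last by rewrite E.
  move=> /(leafP G) lm; apply: np; rewrite E.
  by rewrite -(lm _ mE); apply/(leafP G).
- exact: below.
- by move=> p; have [lp|np] := pselect (leafW p); [left|right].
Qed.

Lemma D_W_root : rt -> forall p, D_W p <-> leaf T (base p).
Proof.
move=> r p; split=> [[q Eq qp]|lp].
  have [lq _] := (E_W_root r q).1 Eq; have [<-//] := leW_leaf lq qp.
have [z Hz] := r; exists (point lp z); first exact/(E_W_root r).
by left.
Qed.

Lemma D_W_noroot : ~ rt -> forall p, D_W p <-> k <= lev (base p).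
Proof.
move=> nr p; split=> [[q Eq qp]|kp].
  by have := lt_mono L (leW_base qp); rewrite ((E_W_noroot nr q).1 Eq).
have [y [yp ly]] := lt_ex L kp.
exists (canon y); first exact/(E_W_noroot nr).
by apply: leW_low => //; apply/node_lev_leq; rewrite /base /= ly.
Qed.

Lemma base_e_root : rt -> forall p, D_W p -> base (e_W p) = base p.
Proof.
move=> r p /e_WP[[/(E_W_root r)[le _] ep] _].
by have [] := leW_leaf le ep.
Qed.

Lemma leaf_base_D p : leaf T (base p) -> D_W p.
Proof.
move=> lp; have [r|nr] := pselect rt; first exact/(D_W_root r).
by apply/(D_W_noroot nr); rewrite ((lt_leaf L _).1 lp).
Qed.

Lemma same_leaf_below p q : ~ rt -> leaf T (base p) -> base p = base q ->
  e_W p = e_W q.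
Proof.
move=> nr lp E; have lq : leaf T (base q) by rewrite -E.
apply: e_W_max; have [[Eq eq] Hq] := e_WP (leaf_base_D lq).
have low r s : E_W r -> base r = base r -> base p = base s -> leW r s ->
    forall u, base u = base p -> leW r u.
  move=> /(E_W_noroot nr) lr _ Es rs u Eu; apply: leW_low.
    by apply/node_lev_leq; rewrite lr.
  by rewrite Eu Es; apply: leW_base.
split; first by split=> //; apply: (low _ q Eq).
move=> r [Er rp]; apply: Hq; split=> //.
by apply: (low r p).
Qed.

Let simW : W -> W -> Prop := @sim (symbols k) T0 W prod_interp.

(** The delicate case is that of [T0] without root. If the base points differed, the meet would be a
    node strictly above [e_W p], hence of level [k] and in [E_W], against the maximality of
    [e_W p]. *)
Lemma sim_base p q : simW p q <-> base p = base q.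
Proof.
split.
  case=> [[->//]|[/= dp [dq [[r E]|[nr [[E H]|->//]]]]]].
    by rewrite -(base_e_root r dp) E (base_e_root r dq).
  apply: contrapT => N.
  have [mp [mq _]] := meetWP p q.
  have nm : ~ leaf T (base (meetW p q)).
    move=> lm; apply: N; have [<- _] := leW_leaf lm mp.
    by have [<- _] := leW_leaf lm mq.
  have [[Ep ep] Hp] := e_WP dp.
  have Em : E_W (meetW p q).
    apply/(E_W_noroot nr)/eqP; rewrite eqn_leq; apply/andP; split.
      exact/node_lev_leq.
    by rewrite -((E_W_noroot nr _).1 Ep); apply: (lt_mono L); apply: leW_base H.1.
  by apply: H.2; apply: leW_anti H.1 _; apply: Hp.
move=> E; have [lp|np] := pselect (leaf T (base p)); last first.
  rewrite -(W_node_eq np E); have [dp|dp] := pselect (D_W p); last by left.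
  right; split=> //; split=> //; right; split; last by right.
  by move=> r; apply: np; apply/(D_W_root r).
have lq : leaf T (base q) by rewrite -E.
have [dp dq] := (leaf_base_D lp, leaf_base_D lq).
right; split=> //; split=> //; have [r|nr] := pselect rt; [left|right]; split=> //.
  have [[/(E_W_root r)[le1 H1] ep] _] := e_WP dp.
  have [[/(E_W_root r)[le2 H2] eq] _] := e_WP dq.
  have [[E1 _] [E2 _]] := (leW_leaf le1 ep, leW_leaf le2 eq).
  by apply: W_eq; [rewrite E1 E2|apply: (le_antisym G0)].
left; have Epq := same_leaf_below nr lp E; split=> //.
have [[Ep ep] _] := e_WP dp; have [[_ eq] _] := e_WP dq.
have [mp [mq Hm]] := meetWP p q.
split; first by apply: Hm => //; rewrite /= Epq.
move=> /= X; have lm : leaf T (base (meetW p q)).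
  have le_pm : leW (point lp (meet T0 (fib p) (fib q))) (meetW p q).
    apply: Hm; left; split=> //; [exact: (meet_lel G0)|exact: (meet_ler G0)].
  by have [<-] := leW_leaf (lp : leaf T (base (point lp _))) le_pm.
have /node_lev_leq : lev (base (meetW p q)) <= k.
  by rewrite -X ((E_W_noroot nr _).1 Ep).
exact.
Qed.

Let F := symbols k.
Let Ele := (~` D_W) `|` (E_W : set W).

Lemma node_Ele p : ~ leaf T (base p) -> Ele p.
Proof.
move=> np; have [r|nr] := pselect rt; first by left=> /(D_W_root r).
have [|kp] := leqP k (lev (base p)); last first.
  by left=> /(D_W_noroot nr); rewrite leqNgt kp.
move=> kp; right; apply/(E_W_noroot nr)/eqP; rewrite eqn_leq kp andbT.
exact/node_lev_leq.
Qed.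

Lemma prod_class p : leaf T (base p) ->
  @class_equiv (symbols k) T0 W prod_interp p.
Proof.
move=> lp; pose g (u : {q | simW p q}) : T0 := fib (sval u).
have Hh t : simW p (point lp t) by apply/sim_base.
pose h t : {q | simW p q} := exist (simW p) (point lp t) (Hh t).
have gh : cancel h g by [].
have hg : cancel g h.
  move=> [q pq]; apply: eq_exist; apply: W_eq => //.
  exact: (sim_base p q).1 pq.
exists (pullback T0 g h); split; last first.
  exact: (@pullback_equiv void T0 _ (interp_of T0) g h hg gh (carrier_inhabited T0)).
move=> [q pq] [r pr]; have Eq := (sim_base _ _).1 pq; have Er := (sim_base _ _).1 pr.
split=> /= [H|]; first by left; split=> //; rewrite -Eq.
by case=> [[]//|[_ []]]; rewrite -Eq.
Qed.

Definition rep (C : quotient simW) : W := sval (cid (svalP C)).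

Lemma rep_class p : base (rep (class simW p)) = base p.
Proof.
rewrite /rep; case: cid => /= q E.
have : simW q p by rewrite -E; apply/sim_base.
by move/sim_base.
Qed.

Lemma class_rep C : class simW (rep C) = C.
Proof.
rewrite /rep; case: cid => q /= E; case: C E => S' HS /= E.
by apply: eq_exist; rewrite E.
Qed.

Lemma class_eq p q : class simW p = class simW q <-> base p = base q.
Proof.
split=> [E|E]; first by rewrite -(rep_class p) E rep_class.
apply: eq_exist; apply: funext => r; apply: propext.
by rewrite !sim_base E.
Qed.

Let g (C : quotient simW) : T := base (rep C).
Let h (a : T) : quotient simW := class simW (canon a).

Lemma quotient_gh : cancel h g. Proof. by move=> a; rewrite /g /h rep_class. Qed.
Lemma quotient_hg : cancel g h.
Proof. by move=> C; rewrite -[RHS]class_rep; apply/class_eq. Qed.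

(** Classes are fibers over [T], so [g] and [h] are inverse bijections and the quotient receives an
    isomorphic copy of [T]. *)
Let J := pullback T g h.

Lemma leaf_preds_pullback C : leaf_preds J C <-> leaf_preds T (g C).
Proof.
have ltE A B : lt J A B <-> lt T (g A) (g B).
  split=> -[H N]; split=> //; first by move/(can_inj quotient_hg).
  by move=> E; apply: N; rewrite E.
split=> [[A lA [CA H]]|[a la [Ca H]]].
  exists (g A) => //; split; first exact/ltE.
  move=> z [z1 z2]; apply: (H (h z)).
  by rewrite !ltE !quotient_gh.
exists (h a); first by rewrite /= quotient_gh.
split; first by apply/ltE; rewrite quotient_gh.
by move=> B [/ltE B1 /ltE]; rewrite quotient_gh => B2; apply: (H (g B)).
Qed.

Lemma prod_quotient : @quotient_structure (symbols k) T T0 W prod_interp J.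
Proof.
have fimg_node f a : fimg T f a -> ~ leaf T a.
  move=> /(ls_img S) la; apply/node_lev_leq; rewrite la.
  exact: img_level_leq.
have fn_node f a : fdom T f a -> ~ leaf T (fn T f a).
  move=> /(ls_dom S)/(level_fn_top S)[_ [la _]]; apply: (fimg_node f).
  exact/(ls_img S).
have star f := leveled_star f LT.
split.
- move=> C C'; split=> [H|[p [q [Hp [Hq pq]]]]].
    have [E|N] := pselect (base (rep C) = base (rep C')).
      exists (rep C), (rep C); split.
        by rewrite -{1}[C]class_rep; apply/sim_base.
      split; last exact: leW_refl.
      by rewrite -{1}[C']class_rep; apply/sim_base.
    exists (rep C), (rep C'); split; first by rewrite -{1}[C]class_rep; apply/sim_base.
    split; first by rewrite -{1}[C']class_rep; apply/sim_base.
    by right.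
  rewrite -[C]class_rep /= in Hp; rewrite -[C']class_rep /= in Hq.
  move/sim_base: Hp => /= Hp; move/sim_base: Hq => /= Hq.
  by rewrite /= /g Hp Hq; apply: leW_base.
- by move=> f p _; rewrite /= /g rep_class.
- move=> f p _ /= dp; rewrite asboolT // /h /g rep_class; split.
    by split=> //; apply: node_Ele; apply: fn_node.
  move=> q [_ /class_eq E]; apply: W_node_eq; first exact: fn_node.
  by rewrite E.
- move=> f p /= dp; have [[Ep ep] _] := e_WP dp.
  have [r|nr] := pselect rt.
    rewrite (base_e_root r dp); case: asboolP => // N.
    case: N; apply: (star_leaf (star f)); exact/(D_W_root r).
  have le := (E_W_noroot nr _).1 Ep; have hk := img_level_leq c f.
  have hp : img_level c f <= lev (base p).
    by apply: leq_trans ((D_W_noroot nr p).1 dp).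
  have he : img_level c f <= lev (base (e_W p)) by rewrite le.
  rewrite !asboolT; [|exact/(ls_dom S)|exact/(ls_dom S)].
  congr canon; apply/(ls_fn S) => //.
  have tp := level_fn_top S hp.
  (* If the level of [f] is [k], the last element of this level below [base p] is [base (e_W p)]
     itself; for smaller levels the last element restricts from [base p] to [base (e_W p)]. *)
  move: hk; rewrite leq_eqVlt => /orP[/eqP hE|hk]; last first.
    by apply: (top_at_restrict L tp (leW_base ep)); rewrite le.
  have te : top_at T lev (img_level c f) (base p) (base (e_W p)).
    have [_ Hm] := e_WP dp; split; first exact: leW_base.
    split=> [|z zp lz]; first by rewrite le.
    have nz : ~ leaf T (base (canon z)) by apply/node_lev_leq; rewrite /base /= lz hE.
    suff /leW_base : leW (canon z) (e_W p) by [].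
    apply: Hm; split; last exact: leW_low.
    by apply/(E_W_noroot nr); rewrite /base /= lz hE.
  rewrite (top_at_inj L tp te) hE.
  by have := top_at_self L (base (e_W p)); rewrite {1}le.
- by move=> f p; rewrite /= /g rep_class.
- move=> f; split.
  + by move=> p [lp _]; apply: (star_leaf (star f)).
  + apply/seteqP; split=> p /=.
      rewrite {1}(star_dom (star f)) => -[y fy yp]; exists (canon y) => //.
      by apply: leW_low => //; apply: fimg_node fy.
    move=> [q fq qp]; rewrite (star_dom (star f)).
    by exists (base q) => //; apply: leW_base.
  + rewrite predeqE => p; split=> // -[fp [lp _]].
    exact: (fimg_node f (base p)).
  + by move=> p /= N; rewrite asboolF.
  + apply/seteqP; split=> [p [q dq <-]|p fp].
      rewrite /= asboolT //; have : (fn T f @` fdom T f) (fn T f (base q)).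
        by exists (base q).
      by rewrite (star_img (star f)).
    have dp : fdom T f (base p).
      by rewrite (star_dom (star f)); exists (base p) => //; apply: (le_refl G).
    exists p => //; rewrite /= asboolT // (star_fix (star f)) //.
    by apply/esym/W_node_eq => //; apply: fimg_node fp.
  + move=> p dp; rewrite /= asboolT //; apply: leW_low; first exact: fn_node.
    exact: (star_le (star f)).
  + move=> p fp; have dp : fdom T f (base p).
      by rewrite (star_dom (star f)); exists (base p) => //; apply: (le_refl G).
    rewrite /= asboolT // (star_fix (star f)) //.
    by apply/esym/W_node_eq => //; apply: fimg_node fp.
- exact: (@pullback_equiv (symbols k) T _ (interp_of T) g h quotient_hg quotient_gh (carrier_inhabited T)).
- move=> nr; have ck := noroot_color nr.
  have pT := leaf_preds_level LT ck; split=> [C lC|].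
    split=> //; have [_ [y yC]] := (isolated_color LT lC).2 ck.
    have H : leaf_preds J (h y).
      by apply/leaf_preds_pullback; rewrite quotient_gh; exists (g C).
    exists (h y); split.
      split; first by rewrite /= quotient_gh; case: yC => -[].
      by move=> E; case: yC => -[_ []]; rewrite -E quotient_gh.
    move=> B [[B1 N1] [B2 N2]]; apply: (yC.2 (g B)).
    rewrite /= quotient_gh in B1; split; split=> //.
      by move=> E; apply: N1; rewrite E quotient_hg.
    by move/(can_inj quotient_hg).
  apply/seteqP; split=> [C [p /(E_W_noroot nr) Ep <-]|C /leaf_preds_pullback].
    by apply/leaf_preds_pullback; rewrite pT /= /g rep_class.
  rewrite pT => lC; exists (canon (g C)); last exact: quotient_hg.
  exact/(E_W_noroot nr).
Qed.

Lemma prod_rtimes_spec : @rtimes_spec (symbols k) T T0 W prod_interp.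
Proof.
have fib_leaf t : leaf T0 t -> ~ forall u, le T0 t u.
  move=> lt' Ht; apply: (leveled_nontriv LT0 (carrier_inhabited T0)).
  by exists t => y; apply: (esym ((leafP G0 t).1 lt' y (Ht y))).
have UE p : D_W p -> ~ E_W p -> leaf T (base p).
  by move=> dp NE; apply: contrapT => /node_Ele[].
split.
- exact: good_prod.
- move=> p q r Ep Er pq qr; have [z|nr] := pselect rt.
    apply/(E_W_root z); have [lp _] := (E_W_root z p).1 Ep.
    have [lr Hr] := (E_W_root z r).1 Er.
    have [Epq _] := leW_leaf lp pq; have lq : leaf T (base q) by rewrite -Epq.
    have [_ H] := leW_leaf lq qr; split=> // t.
    suff -> : fib q = fib r by [].
    by apply: (le_antisym G0).
  apply/(E_W_noroot nr)/eqP; rewrite eqn_leq; apply/andP; split.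
    by rewrite -((E_W_noroot nr r).1 Er); apply: (lt_mono L); apply: leW_base.
  by rewrite -{1}((E_W_noroot nr p).1 Ep); apply: (lt_mono L); apply: leW_base.
- by apply/seteqP; split=> p.
- apply/seteqP; split=> [p Ep|p [q dq <-]].
    by exists p; [apply: E_W_dom|apply: E_W_fix].
  by have [[]] := e_WP dq.
- apply/seteqP; split=> [p Ep|p [q [lq _] <-]]; last first.
    by have [[]] := e_WP (leaf_base_D lq).
  have [t lt' _] := below_leaf G0 t0.
  have [r|nr] := pselect rt.
    have [lp Hp] := (E_W_root r p).1 Ep.
    exists (point lp t); first by split.
    apply: e_W_max; split; first by split=> //; left.
    move=> q [/(E_W_root r)[lq Hq] qp]; have [E _] := leW_leaf lq qp.
    by left.
  (* An element of level [k] is the predecessor of some leaf [a] of [T], and [e_W] sends the leaf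
     chosen over [a] back to it. *)
  have ck := noroot_color nr; have lp := (E_W_noroot nr p).1 Ep.
  have : leaf_preds T (base p) by rewrite (leaf_preds_level LT ck).
  move=> [a la /(is_predP L)[_ [ty _]]]; rewrite lp in ty.
  have np : ~ leaf T (base p) by apply/node_lev_leq; rewrite lp.
  exists (point la t); first by split.
  apply: e_W_max; split; first by split=> //; apply: leW_low => //; case: ty.
  move=> q [/(E_W_noroot nr) lq qa]; apply: leW_low.
    by apply/node_lev_leq; rewrite lq.
  by apply: ty.2.2 => //; apply: leW_base qa.
- exact: e_W_out.
- by move=> p [lp _]; apply: leaf_base_D.
- rewrite predeqE => p; split=> // -[Ep [lp lf]]; have [r|nr] := pselect rt.
    by have [_ /(fib_leaf _ lf)] := (E_W_root r p).1 Ep.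
  have : lev (base p) <= k by rewrite ((E_W_noroot nr p).1 Ep).
  by move/node_lev_leq.
- move=> p /=; have [dp|dp] := pselect (D_W p).
    by have [[]] := e_WP dp.
  by rewrite e_W_out //; apply: leW_refl.
- by move=> p; apply: e_WP.
- move=> r p q Ep Eq pq.
  have [lp Hp] := (E_W_root r p).1 Ep; have [lq Hq] := (E_W_root r q).1 Eq.
  by have [E H] := leW_leaf lp pq; apply: W_eq => //; apply: (le_antisym G0).
- by move=> r p dp; apply: prod_class; apply/(D_W_root r).
- by move=> nr p [dp NE]; apply: prod_class; apply: UE.
- by exists J; apply: prod_quotient.
Qed.

End Product.

Lemma extension_exists c k (T : structure (symbols k)) (T0 : structure (symbols 0)) :
  leveled c T -> leveled (fun i => c (i + k.+1)) T0 ->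
  (type1a (c k) -> type0 (c k.+1)) ->
  exists M : structure (option (symbols k)), rtimes_spec (F := symbols k) T T0 M.
Proof.
move=> LT LT0 H; have [t0] := carrier_inhabited T0.
have [a] := carrier_inhabited T.
exists (Structure (prod_interp LT LT0 t0) (inhabits (canon t0 a))).
exact: prod_rtimes_spec H _.
Qed.

(** * Quantifier elimination *)

Section FiniteTypes.
Variables (F : Type) (phi : formula F) (K : set (structure F)).

Definition qf_over (psi : formula F) : Prop :=
  quantifier_free psi /\ forall x, free_var x psi -> free_var x phi.

(** Each formula of [Delta] splits the class in two, and when all have been used [phi] is constant
    on each piece; so on the class it is a Boolean combination of them. The pieces are described by
    the arbitrary property [P], which the induction refines. *)
Lemma qe_finite_on (Delta : seq (formula F)) :
  (forall d, List.In d Delta -> qf_over d) ->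
  forall P : forall M : structure F, (nat -> M) -> Prop,
  (forall M N env env', P M env -> P N env' ->
    (forall d, List.In d Delta -> sat M env d <-> sat N env' d) ->
    sat M env phi <-> sat N env' phi) ->
  exists psi, qf_over psi /\
    forall M env, P M env -> sat M env phi <-> sat M env psi.
Proof.
elim: Delta => [|d Delta IH] HD P H.
  have [[M [env [PM s]]]|N] := pselect (exists (M : structure F) env,
      P M env /\ sat M env phi).
    exists (Neg Fls); split=> [|N env' PN]; first by split=> // x [].
    by split=> [_ //|_]; apply/(H M N env env' PM PN).
  exists Fls; split=> // M env PM; split=> // s.
  by apply: N; exists M, env.
have HD' d' : List.In d' Delta -> qf_over d' by move=> Hd; apply: HD; right.
have [qd vd] := HD d (or_introl erefl).
have [|psi1 [[q1 v1] E1]] := IH HD' (fun M env => P M env /\ sat M env d).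
  move=> M N env env' [PM sM] [PN sN] A; apply: H => // d' [<-|/A//].
  by split.
have [|psi2 [[q2 v2] E2]] := IH HD' (fun M env => P M env /\ ~ sat M env d).
  move=> M N env env' [PM sM] [PN sN] A; apply: H => // d' [<-|/A//].
  by split.
exists (Or (And d psi1) (And (Neg d) psi2)); split.
  split; first by rewrite /=.
  by move=> x /=; have := vd x; have := v1 x; have := v2 x; tauto.
move=> M env PM; rewrite sat_Or !sat_And.
have [s|s] := pselect (sat M env d).
  by rewrite (E1 M env (conj PM s)) /=; tauto.
by rewrite (E2 M env (conj PM s)) /=; tauto.
Qed.

Lemma qe_finite (Delta : seq (formula F)) :
  (forall d, List.In d Delta -> qf_over d) ->
  (forall M N env env', K M -> K N ->
    (forall d, List.In d Delta -> sat M env d <-> sat N env' d) ->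
    sat M env phi <-> sat N env' phi) ->
  exists psi, qf_over psi /\
    forall M env, K M -> sat M env phi <-> sat M env psi.
Proof.
move=> HD H; have [|psi [Hpsi E]] := qe_finite_on HD (P := fun M _ => K M).
  exact: H.
by exists psi; split=> // M env KM; apply: E.
Qed.

End FiniteTypes.

Lemma sat_disj (T : eqType) F D (I : interp F D) env (P : T -> formula F) s :
  sat I env (foldr (fun f => Or (P f)) Fls s) <-> exists2 f, f \in s & sat I env (P f).
Proof.
elim: s => [|f s IH]; first by split=> // -[].
rewrite [foldr _ _ _]/= sat_Or IH; split=> [[H|[g gs H]]|[g]].
- by exists f => //; rewrite inE eqxx.
- by exists g => //; rewrite inE gs orbT.
- by rewrite inE => /orP[/eqP ->|gs] H; [left|right; exists g].
Qed.

(** * Terms of L_n^+ generating the closure of a tuple *)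

Section QE.
Variables (c : nat -> color) (k : nat).
Let F := symbols k.
Let FP := option F.

Definition up_formula i (t : term FP) : formula FP :=
  Or (foldr (fun f => Or (And (Dom (Some f) t)
        (if (c i).2 == Some 0 then Neg Fls else Neg (Img (Some f) t)))) Fls
       [seq f <- enum F | idx f == i])
    (if i == k.+1 then Leaf t else Fls).

Lemma up_formulaP D (I : interp F D) (J : interp FP D) env i t :
  plus_expansion I J -> sat J env (up_formula i t) <-> up c I i (eval J env t).
Proof.
move=> P; rewrite sat_Or sat_disj /up; split=> [[[f]|]|[[f [iE [df H]]]|[iE lf]]].
- rewrite mem_filter => /andP[/eqP iE _]; rewrite sat_And /= (plus_fdom P).
  move=> [df H]; left; exists f; split=> //; split=> //.
  by case: eqP H => [ci _|_ /=]; [left|rewrite (plus_fimg P); right].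
- by case: eqP => // iE; rewrite /= (plus_leaf P); right.
- left; exists f; first by rewrite mem_filter iE eqxx mem_enum.
  rewrite sat_And /= (plus_fdom P); split=> //.
  by case: eqP => [_ //|ci] /=; rewrite (plus_fimg P); case: H.
- by right; rewrite iE eqxx /= (plus_leaf P).
Qed.

Lemma up_formula_qf i t : quantifier_free (up_formula i t) /\
  forall x, free_var x (up_formula i t) -> term_var x t.
Proof.
rewrite /up_formula; set s := filter _ _; split.
  split; last by case: ifP.
  by split=> //; elim: s => [|f s IH] //; split=> //=; case: ifP.
move=> x [[H|[]]|]; last by case: ifP.
elim: s H => [|f s IH] // [[[[|H]|[]]|[]]|/IH] //.
by move: H; rewrite /=; case: ifP => _ /=; tauto.
Qed.

Definition expansion (J : structure FP) : Prop :=
  exists I : interp F J, leveled c I /\ plus_expansion I J.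

Section OneExpansion.
Variables (D : Type) (I : interp F D) (J : interp FP D).
Hypotheses (LI : leveled c I) (P : plus_expansion I J).
Let L : levtree I (level c I) k.+1 c := LI.1.
Let S : level_symbols (@img_level c k) I (level c I) := LI.2.

Lemma pred_top i x : level c I x = i.+1 -> pred_level k.+1 c i ->
  top_at I (level c I) i x (fn J None x).
Proof.
move=> lx pi; have dx : fdom J None x.
  by rewrite (plus_p_dom P) /=; apply/(has_predP L); exists i.
have [lx' [tx _]] := (is_predP L _ _).1 (plus_p P dx).
by move: tx; suff -> : level c I (fn J None x) = i by []; apply: succn_inj; rewrite -lx'.
Qed.

End OneExpansion.

(** For [i = k] only leaves lie higher, and [p] gives the last element. Otherwise the symbol of
    index [i + 1] is used: if level [i + 1] has first elements, it leads to one of them and [p] goes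
    one level down; if not, its image is already level [i]. *)
Lemma top_term i : i <= k -> (c i).1 <> Some 0 -> exists w : term FP -> term FP,
  (forall x t, term_var x (w t) -> term_var x t) /\
  forall D (I : interp F D) (J : interp FP D) env t, leveled c I ->
    plus_expansion I J -> i < level c I (eval J env t) ->
    top_at I (level c I) i (eval J env t) (eval J env (w t)).
Proof.
rewrite leq_eqVlt => /orP[/eqP ->|ik] ci.
  exists (App None); split=> // D I J env t LI P kt; apply: pred_top => //.
    by apply/eqP; rewrite eqn_leq kt (lt_bound LI.1).
  by split=> //; left.
have [f Hf] : exists f : F, idx f = i.+1 by apply: idx_onto; rewrite /= ik.
have [c0|c0] := pselect ((c i.+1).2 = Some 0).
  have hf : img_level c f = i.+1 by rewrite /img_level Hf c0 eqxx.
  exists (fun t => App None (App (Some f) t)); split=> // D I J env t LI P it.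
  have := level_fn_top LI.2 (f := f) (x := eval J env t); rewrite hf => /(_ it) ty.
  rewrite /= (plus_fn P); have [yx [ly _]] := ty.
  apply: (top_at_extend LI.1 _ yx); last by rewrite ly.
  by apply: pred_top => //; split=> //; right.
have hf : img_level c f = i by rewrite /img_level Hf; case: eqP.
exists (App (Some f)); split=> // D I J env t LI P it.
have := level_fn_top LI.2 (f := f) (x := eval J env t); rewrite hf => /(_ (ltnW it)).
by rewrite /= (plus_fn P).
Qed.

Lemma top_terms : exists W : nat -> term FP -> term FP,
  (forall i x t, term_var x (W i t) -> term_var x t) /\
  forall i D (I : interp F D) (J : interp FP D) env t, leveled c I ->
    plus_expansion I J -> (c i).1 <> Some 0 -> i < level c I (eval J env t) ->
    top_at I (level c I) i (eval J env t) (eval J env (W i t)).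
Proof.
have /choice[W HW] : forall i, exists w : term FP -> term FP,
    (forall x t, term_var x (w t) -> term_var x t) /\
    (i <= k -> (c i).1 <> Some 0 -> forall D (I : interp F D) (J : interp FP D) env t,
      leveled c I -> plus_expansion I J -> i < level c I (eval J env t) ->
      top_at I (level c I) i (eval J env t) (eval J env (w t))).
  move=> i; have [[ik ci]|N] := pselect (i <= k /\ (c i).1 <> Some 0).
    by have [w [w1 w2]] := top_term ik ci; exists w.
  by exists id; split=> // ik ci; case: N.
exists W; split=> [i x t|i D I J env t LI P ci it]; first exact: (HW i).1.
apply: (HW i).2 => //; rewrite -ltnS; apply: leq_trans it _.
exact: (lt_bound LI.1).
Qed.

(** Elements below a given one form a chain, so the meet of two meets is again the meet of two of
    the four elements, and one round of meets suffices. Last elements of a meet are inherited from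
    its arguments. *)
Lemma meets_closed D (I : interp F D) (lev : D -> nat) n (A : D -> Prop) :
  levtree I lev n c ->
  (forall i a, A a -> (c i).1 <> Some 0 -> i < lev a ->
     exists2 r, A r & top_at I lev i a r) ->
  gclosed I lev c (fun x => exists a b, A a /\ A b /\ x = meet I a b).
Proof.
move=> L HA; have G := lt_good L; split; last first.
  move=> i _ [a [b [Aa [Ab ->]]]] ci im.
  have ia := leq_trans im (lt_mono L (meet_lel G a b)).
  have [r Ar tr] := HA i a Aa ci ia; exists r.
    by exists r, r; rewrite (gt_meet_id G) //; apply: (le_refl G).
  exact: (top_at_restrict L tr (meet_lel G a b) im).
move=> _ _ [a [b [Aa [Ab ->]]]] [a' [b' [Aa' [Ab' ->]]]].
have [H|H] := gt_chain G (meet_lel G a a') (meet_lel G a b); last first.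
  have [H'|H'] := gt_chain G (le_trans G H (meet_ler G a a')) (meet_lel G a' b').
    by exists a, b; rewrite (gt_meet_id G).
  exists a', b'; split=> //; split=> //.
  by rewrite (gt_meetC G) (gt_meet_id G).
have [H'|H'] := gt_chain G (meet_ler G a a') (meet_lel G a' b').
  exists a, a'; split=> //; split=> //; apply: (le_antisym G).
    apply: (meet_glb G).
      exact: (le_trans G (meet_lel G _ _) (meet_lel G _ _)).
    exact: (le_trans G (meet_ler G _ _) (meet_lel G _ _)).
  exact: (meet_glb G).
exists a', b'; split=> //; split=> //.
by rewrite (gt_meetC G) (gt_meet_id G) //; apply: (le_trans G H' H).
Qed.

Section Terms.
Variable W : nat -> term FP -> term FP.
Hypothesis Wvar : forall i x t, term_var x (W i t) -> term_var x t.
Hypothesis Wtop : forall i D (I : interp F D) (J : interp FP D) env t, leveled c I ->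
  plus_expansion I J -> (c i).1 <> Some 0 -> i < level c I (eval J env t) ->
  top_at I (level c I) i (eval J env t) (eval J env (W i t)).
Variable xs : seq nat.

(* [ok i x]: the level i is below that of x, and has a maximal element there. *)
Definition base_terms (ok : nat -> nat -> Prop) : seq (term FP) :=
  List.flat_map (fun x => Var x ::
    map (fun i => W i (Var x)) [seq i <- iota 0 k.+1 | `[< ok i x >]]) xs.

Definition meet_terms ok : seq (term FP) :=
  List.flat_map (fun u => map (Meet u) (base_terms ok)) (base_terms ok).

Lemma in_base_terms ok u : List.In u (base_terms ok) <->
  exists x, List.In x xs /\ (u = Var x \/
    exists i, i <= k /\ ok i x /\ u = W i (Var x)).
Proof.
have mem (s : seq nat) i : List.In i s <-> i \in s.
  elim: s => //= j s IH; rewrite inE IH; split=> [[->|->]|/orP[/eqP->|]]; rewrite ?eqxx ?orbT; auto.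
rewrite List.in_flat_map; split=> [[x [xX [<-|/List.in_map_iff[i [<- /mem]]]]]|].
- by exists x; split=> //; left.
- rewrite mem_filter mem_iota add0n ltnS => /andP[/asboolP oki /andP[_ ik]].
  by exists x; split=> //; right; exists i.
- move=> [x [xX [->|[i [ik [oki ->]]]]]]; exists x; split=> //; [by left|right].
  apply/List.in_map_iff; exists i; split=> //; apply/mem.
  by rewrite mem_filter mem_iota leq0n add0n ltnS ik asboolT.
Qed.

Lemma in_meet_terms ok t : List.In t (meet_terms ok) <->
  exists u v, List.In u (base_terms ok) /\ List.In v (base_terms ok) /\ t = Meet u v.
Proof.
rewrite List.in_flat_map; split=> [[u [uU /List.in_map_iff[v [<- vV]]]]|[u [v [uU [vV ->]]]]].
  by exists u, v.
by exists u; split=> //; apply/List.in_map_iff; exists v.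
Qed.

Lemma meet_terms_var ok t x : List.In t (meet_terms ok) -> term_var x t -> List.In x xs.
Proof.
have B u : List.In u (base_terms ok) -> term_var x u -> List.In x xs.
  by move=> /in_base_terms[y [yX [->|[i [_ [_ ->]]]]]] /= => [->|/Wvar /= ->].
by move=> /in_meet_terms[u [v [uU [vV ->]]]] /= [/(B _ uU)|/(B _ vV)].
Qed.

Lemma base_terms_closed D (I : interp F D) (J : interp FP D) env ok :
  leveled c I -> plus_expansion I J ->
  (forall i x, List.In x xs -> ok i x <-> (c i).1 <> Some 0 /\ i < level c I (env x)) ->
  gclosed I (level c I) c
    (fun a => exists2 t, List.In t (meet_terms ok) & a = eval J env t).
Proof.
move=> LI P Hok; have L := LI.1.
have := @meets_closed D I (level c I) k.+1
  (fun a => exists2 u, List.In u (base_terms ok) & a = eval J env u) L.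
have -> : (fun a => exists2 t, List.In t (meet_terms ok) & a = eval J env t) =
  (fun x => exists a b, (exists2 u, List.In u (base_terms ok) & a = eval J env u) /\
     (exists2 u, List.In u (base_terms ok) & b = eval J env u) /\ x = meet I a b).
  apply: funext => a; apply: propext; split.
    move=> [t /in_meet_terms[u [v [uU [vV ->]]]] ->].
    exists (eval J env u), (eval J env v); split; first by exists u.
    by split; [exists v|rewrite /= (plus_meet P)].
  move=> [_ [_ [[u uU ->] [[v vV ->] ->]]]]; exists (Meet u v).
    by apply/in_meet_terms; exists u, v.
  by rewrite /= (plus_meet P).
apply=> i _ [u /in_base_terms[x [xX [->|[j [jk [okj ->]]]]]] ->] ci ix.
  have it : i < level c I (eval J env (Var x)) by [].
  exists (eval J env (W i (Var x))); last exact: Wtop.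
  exists (W i (Var x)) => //; apply/in_base_terms; exists x; split=> //; right.
  exists i; split; last by split=> //; apply/(Hok i x xX).
  by rewrite -ltnS; apply: leq_trans it (lt_bound L _).
(* The last element of level [i] below the last one of level [j] is the last one of level [i] below
   [x], so iteration produces no further elements. *)
have [cj jx] := (Hok j x xX).1 okj.
have [rx [lr _]] := Wtop (t := Var x) LI P cj jx.
rewrite lr in ix; have ixx : i < level c I (eval J env (Var x)) := ltn_trans ix jx.
exists (eval J env (W i (Var x))).
  exists (W i (Var x)) => //; apply/in_base_terms; exists x; split=> //; right.
  by exists i; split; [exact: leq_trans (ltnW ix) jk|split=> //; apply/(Hok i x xX)].
by apply: (top_at_restrict L (Wtop LI P ci ixx) rx); rewrite lr.
Qed.

(** The list must not depend on the structure, so it involves all terms, including those whose value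
    is not a last element in a given structure. The formulas [up_formula i.+1 t] together determine
    the level of [t]. *)
Definition atoms : seq (formula FP) :=
  List.flat_map (fun t => map (Le t) (meet_terms (fun _ _ => True))
    ++ map (fun i => up_formula i.+1 t) (iota 0 k.+1)) (meet_terms (fun _ _ => True)).

Lemma base_terms_sub ok u : List.In u (base_terms ok) ->
  List.In u (base_terms (fun _ _ => True)).
Proof.
move=> /in_base_terms[x [xX H]]; apply/in_base_terms; exists x; split=> //.
by case: H => [->|[i [ik [_ ->]]]]; [left|right; exists i].
Qed.

Lemma meet_terms_sub ok t : List.In t (meet_terms ok) ->
  List.In t (meet_terms (fun _ _ => True)).
Proof.
move=> /in_meet_terms[u [v [/base_terms_sub uU [/base_terms_sub vV ->]]]].
by apply/in_meet_terms; exists u, v.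
Qed.

(** The atoms fix the levels of the variables, so the same terms name last elements in both
    structures. The values of these terms form closed sets, and the atoms make the correspondence
    between them a configuration. *)
Lemma atoms_config D D' (I : interp F D) (J : interp FP D)
    (I' : interp F D') (J' : interp FP D') env env' :
  leveled c I -> plus_expansion I J -> leveled c I' -> plus_expansion I' J' ->
  (forall d, List.In d atoms -> sat J env d <-> sat J' env' d) ->
  exists2 s, config c I I' (level c I) (level c I') s &
    forall x, List.In x xs -> List.In (env x, env' x) s.
Proof.
move=> LI P LI' P' H.
have G := lt_good LI.1; have G' := lt_good LI'.1.
have Hle t u : List.In t (meet_terms (fun _ _ => True)) ->
    List.In u (meet_terms (fun _ _ => True)) ->
    le I (eval J env t) (eval J env u) <-> le I' (eval J' env' t) (eval J' env' u).
  move=> Ht Hu; have := H (Le t u); rewrite /= (plus_le P) (plus_le P'); apply.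
  apply/List.in_flat_map; exists t; split=> //; apply/List.in_app_iff; left.
  by apply/List.in_map_iff; exists u.
have Hlev t : List.In t (meet_terms (fun _ _ => True)) ->
    level c I (eval J env t) = level c I' (eval J' env' t).
  move=> Ht; apply: eq_bigr => i _; congr nat_of_bool; apply: asbool_equiv_eq.
  rewrite -(up_formulaP env _ t P) -(up_formulaP env' _ t P'); apply: H.
  apply/List.in_flat_map; exists t; split=> //; apply/List.in_app_iff; right.
  apply/(List.in_map_iff (fun i => up_formula i.+1 t) (iota 0 k.+1)); exists (i : nat); split=> //.
  apply/(list_in_nth 0); exists i; first by rewrite size_iota.
  by rewrite nth_iota // ltn_ord.
(* Only meets are listed, so a variable occurs as its meet with itself. *)
have varM ok x : List.In x xs -> List.In (Meet (Var x) (Var x)) (meet_terms ok).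
  by move=> xX; apply/in_meet_terms; exists (Var x), (Var x); split; last split=> //;
    apply/in_base_terms; exists x; split=> //; left.
have evM x : eval J env (Meet (Var x) (Var x)) = env x.
  by rewrite /= (plus_meet P) (gt_meet_id G) //; apply: (le_refl G).
have evM' x : eval J' env' (Meet (Var x) (Var x)) = env' x.
  by rewrite /= (plus_meet P') (gt_meet_id G') //; apply: (le_refl G').
pose ok i x := (c i).1 <> Some 0 /\ i < level c I (env x).
pose s := map (fun t => (eval J env t, eval J' env' t)) (meet_terms ok).
have Es a a' : List.In (a, a') s <-> exists t, List.In t (meet_terms ok) /\
    a = eval J env t /\ a' = eval J' env' t.
  rewrite List.in_map_iff; split=> [[t [[<- <-] Ht]]|[t [Ht [-> ->]]]]; by exists t.
exists s; last first.
  move=> x xX; apply/Es; exists (Meet (Var x) (Var x)); rewrite evM evM'.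
  by split=> //; apply: varM.
split.
- move=> x x' y y' /Es[t [/meet_terms_sub Ht [-> ->]]] /Es[u [/meet_terms_sub Hu [-> ->]]].
  exact: Hle.
- by move=> x x' /Es[t [/meet_terms_sub Ht [-> ->]]]; apply: Hlev.
- have -> : dom1 s = fun a => exists2 t, List.In t (meet_terms ok) & a = eval J env t.
    apply: funext => a; apply: propext; split=> [[a' /Es[t [Ht [-> _]]]]|[t Ht ->]].
      by exists t.
    by exists (eval J' env' t); apply/Es; exists t.
  by apply: base_terms_closed.
- have -> : dom2 s = fun a => exists2 t, List.In t (meet_terms ok) & a = eval J' env' t.
    apply: funext => a; apply: propext; split=> [[a' /Es[t [Ht [_ ->]]]]|[t Ht ->]].
      by exists t.
    by exists (eval J env t); apply/Es; exists t.
  apply: base_terms_closed => // i x xX; rewrite /ok.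
  by rewrite -[env x]evM -[env' x]evM' Hlev //; apply: varM.
Qed.

End Terms.

Lemma expansion_qe (phi : formula FP) : exists psi, qf_over phi psi /\
  forall M env, expansion M -> sat M env phi <-> sat M env psi.
Proof.
have [W [Wvar Wtop]] := top_terms.
have [s Hs] := free_var_seq phi.
(* Exactly the free variables of [phi], so that the atoms, and with them [psi], contain no
   others. *)
pose xs := [seq x <- s | `[< free_var x phi >]].
have mem x : List.In x xs <-> free_var x phi.
  have E (u : seq nat) : List.In x u <-> x \in u.
    by elim: u => //= j u IH; rewrite inE IH; split=> [[->|->]|/orP[/eqP->|]]; rewrite ?eqxx ?orbT; auto.
  rewrite E mem_filter; split=> [/andP[/asboolP]//|H].
  by rewrite Hs // andbT; apply/asboolP.
apply: (@qe_finite FP phi expansion (atoms W xs)).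
  move=> d /List.in_flat_map[t [Ht /List.in_app_iff[H|H]]].
    have [u [<- Hu]] := (List.in_map_iff (Le t) _ _).1 H.
    split=> // x /= [|] Hx; apply/mem; first exact: (meet_terms_var Wvar Ht).
    exact: (meet_terms_var Wvar Hu).
  have [u [<- _]] := (List.in_map_iff (fun i => up_formula i.+1 t) (iota 0 k.+1) _).1 H.
  have [q v] := up_formula_qf u.+1 t; split=> // x /v Hx; apply/mem.
  exact: (meet_terms_var Wvar Ht).
move=> M N env env' [I [LI P]] [I' [LI' P']] H.
have [st C Hst] := atoms_config Wtop LI P LI' P' H.
apply: (preserved_sat LI.1 LI'.1 (carrier_inhabited M) (carrier_inhabited N)
  (plus_le P) (plus_le P') (plus_meet P) (plus_meet P')
  (plus_preserved LI.1 LI'.1 LI.2 LI'.2 P P') C).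
by move=> x /mem; apply: Hst.
Qed.

End QE.

(** * The theories in S_n *)

Lemma class_leveled c k (K : set (structure (symbols k))) :
  (forall M, K M -> leveled c M) ->
  forall M, model (theory_of_class K) M -> leveled c M.
Proof.
move=> HK M HM.
apply: (@transfer_leveled c k {N | K N} (fun N => sval N) (fun N => interp_of (sval N))).
- by move=> [N KN]; apply: HK.
- exact: carrier_inhabited.
- by move=> phi Sphi H; apply: HM; split=> // N KN; apply: (H (exist K N KN)).
Qed.

Lemma Sigma_leveled cc (M : structure void) : valid_color (cc 0) ->
  model (Sigma (cc 0)) M -> leveled (k := 0) cc M.
Proof.
move=> V; apply: (@class_leveled cc 0) => N; exact: one_colored_leveled.
Qed.

Lemma model_of_class F (K : set (structure F)) M : K M -> model (theory_of_class K) M.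
Proof. by move=> KM phi [_]; apply. Qed.

Lemma Sigma_model c : valid_color c -> exists M, model (Sigma c) M.
Proof.
by move=> /one_colored_exists[M OC]; exists M; apply: model_of_class.
Qed.

(** The two claims are proved together, because the construction of a model relies on both factors
    being leveled. *)
Lemma rtimes_seq_leveled c k : admissible k.+1 c ->
  (forall M, model (rtimes_seq c k) M -> leveled c M) /\
  exists M, model (rtimes_seq c k) M.
Proof.
elim: k => [|k IH] A.
  have V : valid_color (c 0) by apply: (adm_valid A).
  by split=> [M|]; [apply: Sigma_leveled|apply: Sigma_model].
have [|IHl [T HT]] := IH.
  split=> i ik; [apply: (adm_valid A)|apply: (adm_type A)|apply: (adm_exc1 A)|
    apply: (adm_exc2 A)]; exact: ltnW.
have V : valid_color (c k.+1) by apply: (adm_valid A).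
have S0 (T0 : structure void) : model (Sigma (c k.+1)) T0 ->
    leveled (k := 0) (fun i => c (i + k.+1)) T0.
  by apply: (@Sigma_leveled (fun i => c (i + k.+1))).
split.
  apply: class_leveled => N [T' [T0 [HT' [HT0 [_ R]]]]].
  exact: (leveled_step (IHl _ HT') (S0 _ HT0) R (carrier_inhabited N)).
have [T0 HT0] := Sigma_model V.
have tk : type1a (c k) -> type0 (c k.+1) by apply: (adm_type A).
have [N R] := extension_exists (IHl _ HT) (S0 _ HT0) tk.
exists N; apply: model_of_class; exists T, T0; split=> //; split=> //; split=> //.
exact: (extension_hypI (IHl _ HT) (S0 _ HT0) tk).
Qed.

Lemma leveled_elem_equiv c k (M N : structure (symbols k)) :
  leveled c M -> leveled c N -> elem_equiv M N.
Proof.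
move=> [LM SM] [LN SN].
apply: (preserved_equiv LM LN (carrier_inhabited M) (carrier_inhabited N) erefl
  erefl erefl erefl).
exact: (symbols_preserved LM LN SM SN).
Qed.

Lemma rtimes_seq_class c k : exists K, rtimes_seq c k = theory_of_class K.
Proof. by case: k => [|k]; eexists; reflexivity. Qed.

(** A theory of a class contains every sentence true throughout the class, and all members of the
    class are models, hence elementarily equivalent to [M]. *)
Lemma S_Ln_theory_of k (Gamma : theory (Fn k.+1)) M : S_Ln k.+1 Gamma ->
  model Gamma M -> Gamma = theory_of M.
Proof.
move=> [c A ->] HM; have [HL _] := rtimes_seq_leveled A.
have [K E] := rtimes_seq_class c k.
apply/seteqP; split=> phi Hphi.
  by split; [move: Hphi; rewrite [rtimes_seq c _]E => -[]|apply: HM].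
have [Sphi H] := Hphi; rewrite [rtimes_seq c _]E; split=> // N KN.
have HN : model (rtimes_seq c k) N by rewrite E; apply: model_of_class.
exact/(leveled_elem_equiv (HL _ HM) (HL _ HN) Sphi).
Qed.

Lemma S_Ln_model k (Gamma : theory (Fn k.+1)) : S_Ln k.+1 Gamma ->
  exists M, model Gamma M.
Proof. by move=> [c A ->]; have [_] := rtimes_seq_leveled A. Qed.

Lemma model_theory_of F (M : structure F) : model (theory_of M) M.
Proof. by move=> phi []. Qed.

Lemma holds_Neg F (M : structure F) phi : sentence phi ->
  holds M (Neg phi) <-> ~ holds M phi.
Proof.
move=> Sphi; have [a] := carrier_inhabited M.
have E env env' : sat M env phi <-> sat M env' phi by apply: sat_ext => x /Sphi.
split=> [H H'|N env s]; first exact: (H (fun=> a) (H' _)).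
by apply: N => env'; apply: (E env env').1 s.
Qed.

Lemma sentence_Neg F (phi : formula F) : sentence phi -> sentence (Neg phi).
Proof. by move=> Sphi x [/Sphi|]. Qed.

Lemma complete_theory_of F (M : structure F) : complete (theory_of M).
Proof.
split=> [|phi Sphi]; first by exists M; apply: model_theory_of.
have [H|H] := pselect (holds M phi); [left|right] => N HN; apply: HN; split=> //.
  exact: sentence_Neg.
exact/holds_Neg.
Qed.

Lemma theory_of_model F (M N : structure F) : model (theory_of M) N ->
  theory_of N = theory_of M.
Proof.
move=> HN; apply/seteqP; split=> phi [Sphi H]; split=> //; last by apply: HN.
apply: contrapT => /(holds_Neg M Sphi) H'.
have : holds N (Neg phi) by apply: HN; split=> //; apply: sentence_Neg.
by move/(holds_Neg N Sphi).
Qed.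

(** * Reducts to L_1 and the theorem *)

Definition reduct F (M : structure F) : structure void :=
  Structure (void_interp (le M) (meet M) (node M) (leaf M)) (carrier_inhabited M).

Section Reduct.
Variables (F : Type) (M : structure F).
Let r := of_void F.

Lemma reduct_eval env t : eval (reduct M) env t = eval M env (map_term r t).
Proof. by elim: t => //= t -> u ->. Qed.

Lemma reduct_sat phi : forall env, sat (reduct M) env phi <-> sat M env (map_formula r phi).
Proof.
elim: phi => //= [t u|t u|t|t|p IHp q IHq|x p IH] env; rewrite ?reduct_eval //.
  by rewrite IHp IHq.
by split=> H a; apply/IH.
Qed.

Lemma reduct_holds phi : holds (reduct M) phi <-> holds M (map_formula r phi).
Proof. by split=> H env; apply/reduct_sat. Qed.

Lemma free_var_map phi x : free_var x (map_formula r phi) <-> free_var x phi.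
Proof.
have tv t : term_var x (map_term r t) <-> term_var x t.
  by elim: t => [y|t IHt u IHu|[]] //=; rewrite IHt IHu.
by elim: phi => [|t u|t u|t|t|[]|[]|p IHp q IHq|y p IH] //=; rewrite ?tv ?IHp ?IHq ?IH.
Qed.

Lemma restrict_theory_of : restrict_L1 (theory_of M) = theory_of (reduct M).
Proof.
apply/seteqP; split=> phi [Sphi H]; split; try exact/reduct_holds.
  by move=> x /free_var_map/Sphi.
by move=> x /free_var_map/Sphi.
Qed.

End Reduct.

Lemma S_L1_theory_of k (Gamma : theory void) : S_L1 k.+1 Gamma ->
  exists M, Gamma = theory_of M.
Proof.
move=> [Gamma' SG <-]; have [M HM] := S_Ln_model SG.
by exists (reduct M); rewrite (S_Ln_theory_of SG HM) restrict_theory_of.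
Qed.

Theorem theorem6p19 (n : nat) (hn : (1 <= n)%N) :
  (forall Gamma : theory (Fn n), S_Ln n Gamma ->
     complete Gamma /\ admits_qe (F := Fn_plus n) (plus_theory Gamma)) /\
  (forall Gamma : theory (Fn n),
     S_Ln n Gamma <-> exists2 M, colored_good_tree n M & Gamma = theory_of M) /\
  (forall Gamma : theory void, S_L1 n Gamma -> complete Gamma) /\
  (forall Gamma : theory void,
     S_L1 n Gamma <->
     exists2 M, colored_good_tree_L1 n M & Gamma = theory_of M).
Proof.
case: n hn => // k _; split; [|split; [|split]].
- move=> Gamma SG; have [M HM] := S_Ln_model SG.
  split; first by rewrite (S_Ln_theory_of SG HM); apply: complete_theory_of.
  have [c A GE] := SG; have [HL _] := rtimes_seq_leveled A.
  move=> phi; have [psi [[qpsi vpsi] E]] := expansion_qe c phi.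
  exists psi; split=> //; split=> // N HN env.
  (* A model of [plus_theory] is not given as an expansion of a model of [Gamma]. The equivalence is
     proved on such expansions and reaches the other models as the sentence [chi]. *)
  have [chi [Schi Echi]] := universal_closure (Iff phi psi).
  apply/sat_Iff; move: env; apply/Echi; apply: HN; split=> // _ [M' [J [HM' [P ->]]]].
  apply/Echi => env; apply/sat_Iff; apply: E.
  exists (interp_of M'); split=> //; apply: HL.
  by move: HM'; rewrite GE.
- move=> Gamma; split=> [SG|[M [Gamma' SG HM] ->]].
    have [M HM] := S_Ln_model SG; exists M; last exact: S_Ln_theory_of.
    by exists Gamma.
  by rewrite -(S_Ln_theory_of SG HM).
- by move=> Gamma /S_L1_theory_of[M ->]; apply: complete_theory_of.
- move=> Gamma; split=> [SG|[M [Gamma' SG HM] ->]].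
    have [M GE] := S_L1_theory_of SG; exists M => //.
    by exists Gamma => //; rewrite GE; apply: model_theory_of.
  have [N GE] := S_L1_theory_of SG.
  by rewrite (theory_of_model (M := N)) -?GE.
Qed.
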